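(* Let $\Omega\subset\mathbb{R}^d$ be a bounded open set with Lipschitz boundary. Let $a_{i,j},c\in L^\infty(\Omega)$ ($i,j=1,\dots,d$) with $a_{i,j}=a_{j,i}$ a.e., $c\ge0$ a.e., and suppose there are $0<\alpha\le\beta<\infty$ with $\alpha|\xi|^2\le\sum_{i,j=1}^da_{i,j}(x)\xi_i\xi_j\le\beta|\xi|^2$ for a.e. $x\in\Omega$ and all $\xi\in\mathbb{R}^d$. Let $Lu=-\sum_{i,j=1}^d\partial_i(a_{i,j}\partial_ju)+cu$, let $\gamma>0$, and define $F_L:H_0^1(\Omega)\to\mathbb{R}$ by $$F_L(u)=\frac12\int_\Omega\sum_{i,j=1}^da_{i,j}\,\partial_ju\,\partial_iu\,dx+\frac12\int_\Omega c|u|^2dx+\frac\gamma2\int_\Omega|u|^2dx-\gamma\Big(\int_\Omega|u|^2dx\Big)^{1/2}.$$ Then the set of nonzero critical points of $F_L$ is $$\Big\{\varphi\in H_0^1(\Omega): L\varphi=\lambda\varphi\text{ in }\Omega\text{ for some }\lambda\in\mathbb{R}\text{ and }\|\varphi\|_{L^2(\Omega)}=\frac{\gamma}{\gamma+\lambda}\Big\},$$ and $$\min_{u\in H_0^1(\Omega)}F_L(u)=-\frac{\gamma^2}{2(\gamma+\lambda_* )},$$ where $\lambda_*>0$ is the smallest eigenvalue of $L$.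
   Context: The equation $L\varphi=\lambda\varphi$ in $\Omega$, $\varphi\in H_0^1(\Omega)$ (zero Dirichlet boundary condition), is understood weakly: for every $\psi\in C_0^\infty(\Omega)$, $\int_\Omega\sum_{i,j}a_{i,j}\partial_j\varphi\,\partial_i\psi\,dx+\int_\Omega(c-\lambda)\varphi\psi\,dx=0$. Eigenvalues of $L$ are those $\lambda$ for which a nonzero weak solution exists. A nonzero critical point of $F_L$ is $u\in H_0^1(\Omega)\setminus\{0\}$ at which the derivative of $F_L$ vanishes. *)

(* Defs.v *)
From HB Require Import structures.
From mathcomp Require Import all_boot all_order all_algebra.
From mathcomp Require Import all_classical all_reals all_analysis.

Set Implicit Arguments.
Unset Strict Implicit.
Unset Printing Implicit Defensive.
Import Order.TTheory GRing.Theory Num.Theory.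
Import numFieldNormedType.Exports.

Local Open Scope classical_set_scope.
Local Open Scope ring_scope.

(* R^n is ['rV[R]_n], measured by the sigma-algebra generated by the coordinate
   maps, i.e. the Borel sigma-algebra.  Working with Borel instead of Lebesgue
   measurable functions loses nothing modulo almost everywhere equality. *)
Section measurable_rV.
Context {d : measure_display} {T : measurableType d}.
Variable n : nat.

Let coord : 'I_n -> 'rV[T]_n -> T := fun i v => v ord0 i.

Let rV_set0 : g_sigma_preimage coord set0.
Proof. exact: sigma_algebra0. Qed.

Let rV_setC A : g_sigma_preimage coord A -> g_sigma_preimage coord (~` A).
Proof. exact: sigma_algebraC. Qed.

Let rV_bigcup (F : _^nat) : (forall i, g_sigma_preimage coord (F i)) ->
  g_sigma_preimage coord (\bigcup_i (F i)).
Proof. exact: sigma_algebra_bigcup. Qed.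

HB.instance Definition _ := @isMeasurable.Build (measure_tuple_display d)
  'rV[T]_n (g_sigma_preimage coord) rV_set0 rV_setC rV_bigcup.

Lemma measurable_coord (i : 'I_n) :
  measurable_fun [set: 'rV[T]_n] (fun v : 'rV[T]_n => v ord0 i).
Proof.
move=> _ Y mY; rewrite setTI; apply: sub_sigma_algebra => /=.
rewrite -bigcup_seq/=; exists i => /=; first by rewrite mem_index_enum.
by exists Y => //; rewrite setTI.
Qed.

Lemma measurable_fun_rV d' (S : measurableType d') (f : S -> 'rV[T]_n) :
  (forall i, measurable_fun [set: S] (fun x => f x ord0 i)) ->
  measurable_fun [set: S] f.
Proof.
move=> mf; have H : g_sigma_preimage (fun i => coord i \o f) `<=` measurable.
  apply: smallest_sub; first exact: sigma_algebra_measurable.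
  move=> A; rewrite -bigcup_seq => -[i _ [B mB <-]]; exact: mf.
move=> _ A mA; apply: H; rewrite g_sigma_preimage_comp; by exists A.
Qed.

End measurable_rV.

Section lebesgue_rV.
Context {R : realType}.

Definition cons_rV n (p : measurableTypeR R * 'rV[R]_n) : 'rV[R]_n.+1 :=
  \row_i if unlift ord0 i is Some j then p.2 ord0 j else p.1.

Lemma measurable_cons_rV n : measurable_fun setT (@cons_rV n).
Proof.
apply: measurable_fun_rV => i.
under eq_fun do rewrite mxE.
case: unliftP => [j _|_].
  exact: (measurableT_comp (measurable_coord j) measurable_snd).
exact: measurable_fst.
Qed.

Lemma measurable_behead_rV n :
  measurable_fun setT (fun v : 'rV[R]_n.+1 => \row_j v ord0 (lift ord0 j)).
Proof.
apply: measurable_fun_rV => i.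
under eq_fun do rewrite mxE.
exact: measurable_coord.
Qed.

Definition cons_measure n (mu : {sigma_finite_measure set 'rV[R]_n -> \bar R})
    : set 'rV[R]_n.+1 -> \bar R :=
  pushforward (lebesgue_measure \x mu)%E (@cons_rV n).

Section cons_measure.
Variables (n : nat) (mu : {sigma_finite_measure set 'rV[R]_n -> \bar R}).

Let mup : {measure set 'rV[R]_n.+1 -> \bar R} :=
  measure_function_pushforward__canonical__measure_function_Measure
    (lebesgue_measure \x mu)%E (@measurable_cons_rV n).

HB.instance Definition _ := isMeasure.Build _ _ _ (cons_measure mu)
  (measure0 mup) (measure_ge0 mup) (@measure_semi_sigma_additive _ _ _ mup).

Lemma cons_measureX (A : set R) (B : set 'rV[R]_n) :
  measurable A -> measurable B ->
  cons_measure mu [set v : 'rV[R]_n.+1 | A (v ord0 ord0) /\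
                           B (\row_j v ord0 (lift ord0 j))] =
  (lebesgue_measure A * mu B)%E.
Proof.
move=> mA mB.
rewrite -(@product_measure1E _ _ (measurableTypeR R) 'rV[R]_n R
  lebesgue_measure mu A B mA mB) /cons_measure /pushforward.
have tlE x y : \row_j (@cons_rV n (x, y)) ord0 (lift ord0 j) = y.
  by apply/rowP => j; rewrite !mxE liftK.
have hdE x y : (@cons_rV n (x, y)) ord0 ord0 = x by rewrite mxE unlift_none.
by congr (_ _); apply/seteqP; split=> -[x y] /=; rewrite tlE hdE.
Qed.

Let cons_measure_sigma_finite : sigma_finite setT (cons_measure mu).
Proof.
have /sigma_finiteP[F [TF ndF Foo]] :=
  sigma_finiteT (@lebesgue_measure R : {sigma_finite_measure set _ -> \bar R}).
have /sigma_finiteP[G [TG ndG Goo]] := sigma_finiteT mu.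
pose tl (v : 'rV[R]_n.+1) : 'rV[R]_n := \row_j v ord0 (lift ord0 j).
exists (fun k => [set v : 'rV[R]_n.+1 | F k (v ord0 ord0) /\ G k (tl v)]).
  apply/esym; rewrite -subTset => v _.
  have : [set: measurableTypeR R] (v ord0 ord0) by [].
  rewrite TF => -[k _ Fk].
  have : [set: 'rV[R]_n] (tl v) by [].
  rewrite TG => -[l _ Gl]; exists (maxn k l) => //; split.
    by move: Fk; exact/subsetPset/ndF/leq_maxl.
  by move: Gl; exact/subsetPset/ndG/leq_maxr.
move=> k; have [mF Fk] := Foo k; have [mG Gk] := Goo k; split.
  apply: measurableI; rewrite -[X in measurable X]setTI.
    exact: measurable_coord.
  exact: measurable_behead_rV.
by rewrite cons_measureX// lte_mul_pinfty// ge0_fin_numE.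
Qed.

HB.instance Definition _ :=
  Measure_isSigmaFinite.Build _ _ _ (cons_measure mu) cons_measure_sigma_finite.

End cons_measure.

Fixpoint lebesgue_rV (n : nat) : {sigma_finite_measure set 'rV[R]_n -> \bar R} :=
  if n is m.+1 then cons_measure (lebesgue_rV m) else dirac (0 : 'rV[R]_0).

Lemma lebesgue_rV_box n (A : 'I_n -> set R) : (forall i, measurable (A i)) ->
  lebesgue_rV n [set v : 'rV[R]_n | forall i, A i (v ord0 i)] =
  (\prod_(i < n) lebesgue_measure (A i))%E.
Proof.
elim: n A => [A _|n IHn A mA] /=.
  rewrite big_ord0 diracE mem_set//= => -[].
  by case.
rewrite big_ord_recl -IHn// -cons_measureX//.
  congr (_ _); apply/seteqP; split=> v /=.
    by move=> Av; split=> // i; rewrite mxE.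
  move=> [A0 Av] i; case: (unliftP ord0 i) => [j ->|->]//.
  by have := Av j; rewrite mxE.
rewrite (_ : [set _ | _] =
    \bigcap_(i in [set: 'I_n]) (fun v : 'rV[R]_n => v ord0 i) @^-1`
      A (lift ord0 i)).
  apply: fin_bigcap_measurable => // i _.
  by rewrite -[X in measurable X]setTI; exact: measurable_coord.
by apply/seteqP; split=> v /=; [move=> Av i _; exact: Av|move=> Av i; exact: Av].
Qed.

End lebesgue_rV.

(* The coordinate hyperplane over which [g] is a graph is the one orthogonal to
   the [k]-th axis, in the coordinates [x *m Q]. *)
Definition lipschitz_boundary (R : realType) (d : nat) (Omega : set 'rV[R]_d) :=
  forall p, (closure Omega `\` interior Omega) p ->
  exists (Q : 'M[R]_d) (k : 'I_d) (g : 'rV[R]_d.-1 -> R),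
  [/\ Q *m Q^T = 1%:M,
      exists L : R, L.-lipschitz g &
      \forall x \near p,
        Omega x <-> g (col' k (x *m Q)) < (x *m Q) ord0 k].

Section sobolev.
Context {R : realType} {d : nat}.
Variable Omega : set 'rV[R]_d.
Implicit Types (u v g h phi psi : 'rV[R]_d -> R).

Local Notation mu := (@lebesgue_rV R d).

Definition L2 : set ('rV[R]_d -> R) :=
  [set u : 'rV[R]_d -> R | measurable_fun Omega u /\
           (\int[mu]_(x in Omega) (u x ^+ 2)%:E < +oo)%E].

Definition Linfty : set ('rV[R]_d -> R) :=
  [set u : 'rV[R]_d -> R | measurable_fun Omega u /\
           exists M : R, \forall x \ae mu, Omega x -> `|u x| <= M].

Definition L2norm u : R := Num.sqrt (\int[mu]_(x in Omega) (`|u x| ^+ 2)).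

Definition partial (i : 'I_d) u : 'rV[R]_d -> R :=
  'D_(delta_mx ord0 i : 'rV[R]_d) u.

Definition smooth u := forall s : seq 'I_d,
  continuous (foldr partial u s) /\
  forall (i : 'I_d) (x : 'rV[R]_d),
    derivable (foldr partial u s) x (delta_mx ord0 i).

Definition Cc_infty : set ('rV[R]_d -> R) :=
  [set psi : 'rV[R]_d -> R | let supp := closure [set x | psi x != 0] in
             [/\ smooth psi, compact supp & supp `<=` Omega]].

Definition is_weak_partial (i : 'I_d) u g :=
  L2 g /\ forall psi, Cc_infty psi ->
    \int[mu]_(x in Omega) (u x * partial i psi x) =
    - \int[mu]_(x in Omega) (g x * psi x).

Definition H1 : set ('rV[R]_d -> R) :=
  [set u : 'rV[R]_d -> R | L2 u /\ forall i, exists g, is_weak_partial i u g].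

(* Determined up to almost everywhere equality in [Omega]; only meaningful for
   [u] in [H1]. *)
Definition wpartial (i : 'I_d) u : 'rV[R]_d -> R :=
  xget 0 (is_weak_partial i u).

Definition H1norm u : R :=
  Num.sqrt (L2norm u ^+ 2 + \sum_(i < d) L2norm (wpartial i u) ^+ 2).

(* Elements are functions, not classes; membership and the quantities below
   depend only on the class of [u] for almost everywhere equality in [Omega],
   among the functions measurable on [Omega]. *)
Definition H10 : set ('rV[R]_d -> R) :=
  [set u : 'rV[R]_d -> R | H1 u /\
     forall e : R, 0 < e -> exists2 psi, Cc_infty psi & H1norm (u - psi) < e].

Definition H10_zero u := u = 0 %[ae mu in Omega].

Definition is_frechet_derivative (F : ('rV[R]_d -> R) -> R) u
    (l : ('rV[R]_d -> R) -> R) :=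
  [/\ forall (k : R) h1 h2, H10 h1 -> H10 h2 ->
        l (k *: h1 + h2) = k * l h1 + l h2,
      exists C : R, forall h, H10 h -> `|l h| <= C * H1norm h &
      forall e : R, 0 < e -> exists2 delta : R, 0 < delta &
        forall h, H10 h -> H1norm h < delta ->
          `|F (u + h) - F u - l h| <= e * H1norm h].

Definition nonzero_critical_point (F : ('rV[R]_d -> R) -> R) u :=
  [/\ H10 u, ~ H10_zero u &
      exists2 l, is_frechet_derivative F u l & forall h, H10 h -> l h = 0].

Section operator.
Variables (a : 'I_d -> 'I_d -> 'rV[R]_d -> R) (c : 'rV[R]_d -> R).

Definition F_L (gamma : R) u : R :=
  2^-1 * (\int[mu]_(x in Omega)
    (\sum_(i < d) \sum_(j < d) a i j x * wpartial j u x * wpartial i u x))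
  + 2^-1 * (\int[mu]_(x in Omega) (c x * `|u x| ^+ 2))
  + gamma / 2 * (\int[mu]_(x in Omega) (`|u x| ^+ 2))
  - gamma * Num.sqrt (\int[mu]_(x in Omega) (`|u x| ^+ 2)).

Definition weak_solution (lambda : R) phi :=
  H10 phi /\ forall psi, Cc_infty psi ->
    \int[mu]_(x in Omega)
      (\sum_(i < d) \sum_(j < d) a i j x * wpartial j phi x * partial i psi x)
    + \int[mu]_(x in Omega) ((c x - lambda) * phi x * psi x) = 0.

Definition eigenvalue (lambda : R) :=
  exists2 phi, weak_solution lambda phi & ~ H10_zero phi.

Definition smallest_eigenvalue (lambda : R) :=
  eigenvalue lambda /\ forall l, eigenvalue l -> lambda <= l.

End operator.
End sobolev.

Definition is_min_on (T : Type) (R : realType) (A : set T) (f : T -> R) (m : R) :=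
  (exists2 x, A x & f x = m) /\ forall x, A x -> m <= f x.

(* Main.v *)
(* Write B(u) for the quadratic form of L.  Then F_L(u) = B(u)/2 + g|u|^2/2 - g|u|
   with |u| the L^2 norm, and at u <> 0 its derivative is
   h |-> B(u, h) - (g/|u| - g)(u, h): critical points are the eigenfunctions with
   eigenvalue g/|u| - g.  If l is the least Rayleigh quotient B(u)/|u|^2, then
   F_L(u) >= (l + g)|u|^2/2 - g|u| >= - g^2/(2(g + l)), with equality at a suitable
   multiple of a minimiser of the quotient.

   A minimiser exists by compactness.  For C^1 functions on a cube Q of side e,
   int_Q u^2 <= |Q|^-1 (int_Q u)^2 + e^2 int_Q |grad u|^2; on a fine grid this makes
   a minimising family of test functions totally bounded in L^2, the parallelogram
   identity makes it Cauchy in H^1, and H^1_0 is complete.  On one large cube the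
   same inequality gives the Poincare inequality, hence l > 0. *)

Require Import Defs.
From HB Require Import structures.
From mathcomp Require Import all_boot all_order all_algebra.
From mathcomp Require Import all_classical all_reals all_analysis.
From mathcomp Require Import measurable_realfun.
From mathcomp Require Import ring lra.

Set Implicit Arguments.
Unset Strict Implicit.
Unset Printing Implicit Defensive.
Import Order.TTheory GRing.Theory Num.Theory.
Import numFieldNormedType.Exports.

Local Open Scope classical_set_scope.
Local Open Scope ring_scope.

(** * Positive semidefinite forms *)

Section psd_form.
Context {R : realType} {V : lmodType R}.
Implicit Types (H : set V) (B : V -> V -> R).

(** The elements of the function spaces are functions rather than classes, and [wpartial] selects a
    weak derivative by choice, so it is linear only almost everywhere. The Hilbert space arguments
    are therefore carried out for positive semidefinite forms on subspaces of an abstract module: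
    [H] is $H^1_0$, [D] the test functions, [M] the $L^2$ product, [B] the form of L and [G] the
    $H^1$ product. Concrete integrals come back when these forms are shown to satisfy the axioms.

    Since [D] is dense, compactness and the Poincare inequality have to be known for test functions
    only. These extend by zero, so both can be read off cubes, and no Sobolev function is ever
    regularised. The minimising sequence is taken inside [D], so its limit is in $H^1_0$ by
    definition. That the $L^2$ limits of the classical gradients are the gradient of the limit rests
    on uniqueness of weak derivatives, that is, on the fundamental lemma of the calculus of
    variations. *)

Definition subspace H := H 0 /\ forall (k : R) u v, H u -> H v -> H (k *: u + v).

Definition psd_form H B :=
  [/\ forall u v, H u -> H v -> B u v = B v u,
      forall (k : R) u v w, H u -> H v -> H w ->
        B (k *: u + v) w = k * B u w + B v w &
      forall u, H u -> 0 <= B u u].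

Lemma subspaceD H u v : subspace H -> H u -> H v -> H (u + v).
Proof. by move=> [_ HD] Hu Hv; rewrite -[u]scale1r; exact: HD. Qed.

Lemma subspaceZ H k u : subspace H -> H u -> H (k *: u).
Proof. by move=> [H0 HD] Hu; rewrite -[_ *: _]addr0; exact: HD. Qed.

Lemma subspaceB H u v : subspace H -> H u -> H v -> H (u - v).
Proof.
by move=> [_ HD] Hu Hv; rewrite addrC -scaleN1r; exact: HD.
Qed.

Lemma psd_form_add H B B' : psd_form H B -> psd_form H B' ->
  psd_form H (fun u v => B u v + B' u v).
Proof.
move=> [Bs Bl Bp] [Bs' Bl' Bp']; split.
- by move=> u v Hu Hv; rewrite Bs// Bs'.
- by move=> k u v w Hu Hv Hw; rewrite Bl// Bl'//; ring.
- by move=> u Hu; rewrite addr_ge0 ?Bp ?Bp'.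
Qed.

Lemma psd_form_sum n H (B : 'I_n -> V -> V -> R) : (forall i, psd_form H (B i)) ->
  psd_form H (fun u v => \sum_(i < n) B i u v).
Proof.
move=> pB; split.
- by move=> u v Hu Hv; apply: eq_bigr => i _; have [Bs _ _] := pB i; exact: Bs.
- move=> k u v w Hu Hv Hw; rewrite mulr_sumr -big_split; apply: eq_bigr => i _.
  by have [_ Bl _] := pB i; exact: Bl.
- by move=> u Hu; apply: sumr_ge0 => i _; have [_ _ Bp] := pB i; exact: Bp.
Qed.

Lemma psd_form_sub H H' B : H' `<=` H -> psd_form H B -> psd_form H' B.
Proof.
move=> H'H [Bs Bl Bp]; split.
- by move=> u v /H'H Hu /H'H Hv; exact: Bs.
- by move=> k u v w /H'H Hu /H'H Hv /H'H Hw; exact: Bl.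
- by move=> u /H'H Hu; exact: Bp.
Qed.

Variables (H : set V) (B : V -> V -> R).
Hypotheses (sH : subspace H) (pB : psd_form H B).

Lemma psd_formDZ t u v : H u -> H v ->
  B (t *: u + v) (t *: u + v) = t ^+ 2 * B u u + 2 * t * B u v + B v v.
Proof.
have [Bs Bl _] := pB => Hu Hv.
have Huv : H (t *: u + v) by case: sH => _; apply.
rewrite Bl// [B u _]Bs// [B v _]Bs// !Bl// [B v u]Bs//; ring.
Qed.

Lemma psd_formD u v : H u -> H v ->
  B (u + v) (u + v) = B u u + 2 * B u v + B v v.
Proof. by move=> Hu Hv; have := psd_formDZ 1 Hu Hv; rewrite scale1r => ->; ring. Qed.

Lemma psd_formB u v : H u -> H v ->
  B (u - v) (u - v) = B u u - 2 * B u v + B v v.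
Proof.
move=> Hu Hv; have [Bs _ _] := pB.
have := psd_formDZ (-1) Hv Hu; rewrite scaleN1r addrC => ->.
by rewrite (Bs v)//; ring.
Qed.

Lemma psd_formZr k u v : H u -> H v -> B u (k *: v) = k * B u v.
Proof.
move=> Hu Hv; have [Bs Bl _] := pB; have [H0 _] := sH.
have B0u : B 0 u = 0 by have := Bl 1 0 0 u H0 H0 Hu; rewrite scale1r addr0; lra.
rewrite !(Bs u)//; last exact: subspaceZ.
by rewrite -[k *: v]addr0 Bl// B0u addr0.
Qed.

Lemma psd_formZ k u : H u -> B (k *: u) (k *: u) = k ^+ 2 * B u u.
Proof.
move=> Hu; have [Bs _ _] := pB; have Hk := subspaceZ k sH Hu.
by rewrite psd_formZr// Bs// psd_formZr//; ring.
Qed.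

Lemma psd_form_CS u v : H u -> H v -> B u v ^+ 2 <= B u u * B v v.
Proof.
move=> Hu Hv; have [Bs Bl Bp] := pB.
have K t : 0 <= t ^+ 2 * B u u + 2 * t * B u v + B v v.
  by rewrite -psd_formDZ//; apply: Bp; case: sH => _; apply.
have := Bp _ Hu; move: (B u u) (B u v) (B v v) K => x y z K.
rewrite le_eqVlt => /predU1P[x0|x0].
  have [->|y0] := eqVneq y 0; first by rewrite -x0 mul0r expr0n.
  (* With [x = 0] the polynomial is affine in [t]; at this point its value would be -1. *)
  have := K (- (z + 1) / (2 * y)); rewrite -x0 mulr0 add0r.
  suff -> : 2 * (- (z + 1) / (2 * y)) * y = - (z + 1) by lra.
  by field.
have := K (- y / x); rewrite -(ler_pM2r x0) mul0r -subr_ge0.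
suff -> : ((- y / x) ^+ 2 * x + 2 * (- y / x) * y + z) * x = x * z - y ^+ 2.
  by rewrite subr0 !subr_ge0.
by field; rewrite gt_eqF.
Qed.

Lemma psd_form_sqrtD u v : H u -> H v ->
  Num.sqrt (B (u + v) (u + v)) <= Num.sqrt (B u u) + Num.sqrt (B v v).
Proof.
move=> Hu Hv; have [_ _ Bp] := pB.
have u0 := Bp _ Hu; have v0 := Bp _ Hv.
rewrite -[leRHS]ger0_norm ?addr_ge0// -sqrtr_sqr ler_sqrt ?sqr_ge0//.
rewrite sqrrD !sqr_sqrtr// psd_formD//.
have : B u v <= Num.sqrt (B u u) * Num.sqrt (B v v).
  rewrite -sqrtrM//; apply: le_trans (ler_norm _) _.
  by rewrite -sqrtr_sqr ler_wsqrtr// psd_form_CS.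
by lra.
Qed.

Lemma psd_form_ker u v : H u -> H v -> B u u = 0 -> B u v = 0.
Proof.
move=> Hu Hv u0; have := psd_form_CS Hu Hv; rewrite u0 mul0r => h.
by apply/eqP; rewrite -sqrf_eq0 eq_le h sqr_ge0.
Qed.

End psd_form.

(** * Minimisation of a Rayleigh quotient *)

Lemma sqr_normr {R : realDomainType} (x : R) : `|x| ^+ 2 = x ^+ 2.
Proof. by rewrite real_normK ?num_real. Qed.

(** The image of [U] clusters at some [l] of the compact interval. Either the preimage of a ball
    around [l] or its complement belongs to [U], and the complement would contradict clustering. *)
Lemma ultra_cauchy {R : realType} (T : Type) (U : set_system T) (f : T -> R)
    (A : set T) (C e : R) : UltraFilter U -> U A ->
  (forall x, A x -> `|f x| <= C) -> 0 < e ->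
  exists2 A' : set T, U A' & forall x y, A' x -> A' y -> `|f x - f y| < e.
Proof.
move=> UU UA fC e0; have PU : ProperFilter U := @ultra_proper _ _ UU.
have fU : (f @ U) [set` `[- C, C]].
  by apply: (filterS (P := A)) UA => x /fC; rewrite /= in_itv/= ler_norml.
have [l [_ cl]] := @segment_compact R (- C) C (f @ U) _ fU.
have e2 : 0 < e / 2 by lra.
exists (f @^-1` ball l (e / 2)).
  have [//|UC] := in_ultra_setVsetC (f @^-1` ball l (e / 2)) UU.
  have [y []] := cl (~` ball l (e / 2)) (ball l (e / 2)) UC (nbhsx_ballx l _ e2).
  by [].
move=> x y; rewrite /ball/= => lx ly.
by have := ler_distD l (f x) (f y); rewrite [`|f x - l|]distrC; lra.
Qed.

Section minimizer.
Context {R : realType} {V : lmodType R}.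
Variables (H D : set V) (M B G : V -> V -> R) (K P : R).
Hypotheses (sH : subspace H) (sD : subspace D) (DH : D `<=` H).
Hypotheses (pM : psd_form H M) (pB : psd_form H B) (pG : psd_form H G).
Hypothesis MG : forall u, H u -> M u u <= G u u.
Hypothesis BG : forall u, H u -> B u u <= K * G u u.
Hypothesis GMB : forall u, H u -> G u u <= M u u + K * B u u.
Hypothesis K_gt0 : 0 < K.
Hypothesis dense : forall u e, H u -> 0 < e ->
  exists2 v, D v & G (u - v) (u - v) < e.
(** [G] is a squared distance: the rate [4^-1 ^+ k] makes the distances at most [2^-1 ^+ k], hence
    summable. Completeness is asked only for such fast sequences. *)
Hypothesis complete : forall v : nat -> V, (forall k, D (v k)) ->
  (forall k, G (v k.+1 - v k) (v k.+1 - v k) <= 4^-1 ^+ k) ->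
  exists2 w, H w & forall e, 0 < e ->
    exists k0, forall k, (k0 <= k)%N -> G (w - v k) (w - v k) <= e.
(* Rellich's theorem in finite-rank form: up to a small multiple of [G], [M] is
   controlled by finitely many [M]-bounded functionals. *)
Hypothesis compact_embedding : forall e, 0 < e ->
  exists (I : finType) (l : I -> V -> R) (C : R),
    [/\ forall i u v, D u -> D v -> l i (u - v) = l i u - l i v,
        forall i u, D u -> l i u ^+ 2 <= C * M u u &
        forall u, D u -> M u u <= \sum_i l i u ^+ 2 + e * G u u].
Hypothesis poincare : forall u, D u -> M u u <= P * B u u.
Hypothesis P_gt0 : 0 < P.
Hypothesis D_nonzero : exists2 u, D u & 0 < M u u.

Let Rq := [set B u u | u in [set u | D u /\ M u u = 1]].
Let lam := inf Rq.

Let Rq_lb : lbound Rq P^-1.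
Proof.
move=> _ [u [Du Mu] <-]; have := poincare Du; rewrite Mu => h.
by rewrite -(ler_pM2l P_gt0) mulfV ?gt_eqF.
Qed.

Let normalize u : D u -> 0 < M u u -> exists2 k : R, k ^+ 2 * M u u = 1 &
  D (k *: u) /\ M (k *: u) (k *: u) = 1.
Proof.
move=> Du u0; have k1 : (Num.sqrt (M u u)^-1) ^+ 2 * M u u = 1.
  by rewrite sqr_sqrtr ?invr_ge0 1?ltW// mulVf ?gt_eqF.
exists (Num.sqrt (M u u)^-1) => //; split; first exact: subspaceZ.
by rewrite (psd_formZ sH pM _ (DH Du)).
Qed.

Let Rq_neq0 : Rq !=set0.
Proof.
have [u Du u0] := D_nonzero; have [k _ Dk] := normalize Du u0.
by exists (B (k *: u) (k *: u)); exists (k *: u).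
Qed.

Let Rq_has_inf : has_inf Rq.
Proof. by split => //; exists P^-1. Qed.

Let lam_gt0 : 0 < lam.
Proof.
apply: lt_le_trans (lb_le_inf Rq_neq0 Rq_lb); by rewrite invr_gt0.
Qed.

Let lam_le_D u : D u -> lam * M u u <= B u u.
Proof.
move=> Du; have [_ _ M0] := pM; have [_ _ B0] := pB.
have [u0|u0] := ltP 0 (M u u); last first.
  have -> : M u u = 0 by have := M0 _ (DH Du); lra.
  by rewrite mulr0; exact/B0/DH.
have [k k1 Dk] := normalize Du u0.
have : lam <= B (k *: u) (k *: u).
  by apply: ge_inf; [exists P^-1|exists (k *: u)].
rewrite (psd_formZ sH pB _ (DH Du)) => h.
have k0 : k ^+ 2 != 0 by apply/eqP => z; move: k1; rewrite z mul0r; lra.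
have k2 : 0 < k ^+ 2 by rewrite lt_def k0 sqr_ge0.
by rewrite -(ler_pM2l k2) mulrCA k1 mulr1.
Qed.

Let cont (F : V -> V -> R) C u : psd_form H F -> 0 < C ->
    (forall u, H u -> F u u <= C * G u u) -> H u ->
  forall e, 0 < e -> exists2 d, 0 < d &
    forall v, H v -> G (u - v) (u - v) <= d -> `|F u u - F v v| < e.
Proof.
move=> pF C0 FC Hu e e0; have [_ _ F0] := pF.
have q0 : 0 < 2 * Num.sqrt (F u u) + 1.
  by have := sqrtr_ge0 (F u u); lra.
(* With [x] and [y] the square roots of [F u u] and [F v v], the difference of squares is at most
   [|x - y| * (x + y)]. The minimum with 1 bounds [x + y] by [2 * x + 1]; the other term brings the
   product down to [e / 2]. *)
pose t := Num.min 1 (e / (2 * (2 * Num.sqrt (F u u) + 1))).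
have t0 : 0 < t by rewrite /t lt_min ltr01/= divr_gt0// mulr_gt0.
exists (t ^+ 2 / C); first by rewrite divr_gt0// exprn_gt0.
move=> v Hv Guv.
have Huv := subspaceB sH Hu Hv.
have : F (u - v) (u - v) <= t ^+ 2.
  by apply: le_trans (FC _ Huv) _; rewrite -ler_pdivlMl// mulrC.
move=> /ler_wsqrtr; rewrite sqrtr_sqr gtr0_norm// => h1.
have h2 := psd_form_sqrtD sH pF Huv Hv; rewrite subrK in h2.
have Hvu := subspaceB sH Hv Hu.
have h3 := psd_form_sqrtD sH pF Hvu Hu; rewrite subrK in h3.
have h4 : F (v - u) (v - u) = F (u - v) (u - v).
  have -> : v - u = (-1) *: (u - v) by rewrite scaleN1r opprB.
  by rewrite (psd_formZ sH pF)//; ring.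
rewrite h4 in h3.
have t1 : t <= 1 by rewrite /t ge_min lexx.
have t2 : t * (2 * (2 * Num.sqrt (F u u) + 1)) <= e.
  by rewrite -ler_pdivlMr ?mulr_gt0// /t ge_min lexx orbT.
rewrite -(sqr_sqrtr (F0 _ Hu)) -[F v v](sqr_sqrtr (F0 _ Hv)).
move: h1 h2 h3 t2 q0 (sqrtr_ge0 (F u u)) (sqrtr_ge0 (F v v)).
move: (Num.sqrt (F u u)) (Num.sqrt (F v v)) (Num.sqrt (F (u - v) (u - v))).
move=> x y z h1 h2 h3 t2 q0 x0 y0.
rewrite subr_sqr normrM (ger0_norm (addr_ge0 x0 y0)).
have d1 : `|x - y| <= t by rewrite ler_norml; apply/andP; split; lra.
have d2 : x + y <= 2 * x + 1 by lra.
apply: le_lt_trans (ler_pM _ _ d1 d2) _ => //; first lra.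
move: t2; rewrite mulrCA; lra.
Qed.

Let lam_le u : H u -> lam * M u u <= B u u.
Proof.
move=> Hu; apply/ler_addgt0Pl => e e0.
have MG1 v : H v -> M v v <= 1 * G v v by rewrite mul1r; exact: MG.
have e1 : 0 < e / (2 * lam) by rewrite divr_gt0// mulr_gt0.
have [d1 d10 h1] := cont pM ltr01 MG1 Hu e1.
have e2 : 0 < e / 2 by lra.
have [d2 d20 h2] := cont pB K_gt0 BG Hu e2.
have [|v Dv] := @dense u (Num.min d1 d2) Hu; first by rewrite lt_min d10.
rewrite lt_min => /andP[/ltW v1 /ltW v2].
have Hv := DH Dv.
have := h1 _ Hv v1; have := h2 _ Hv v2; rewrite !ltr_norml => /andP[k1 k2] /andP[k3 k4].
have k5 : lam * (M u u - M v v) < e / 2.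
  rewrite mulrC -ltr_pdivlMr//; apply: lt_le_trans k4 _.
  by rewrite invfM mulrA.
by have := lam_le_D Dv; lra.
Qed.

Let S (d : R) := [set u | [/\ D u, M u u = 1 & B u u < lam + d]].

Let S_neq0 d : 0 < d -> S d !=set0.
Proof.
move=> d0; have [_ [u [Du Mu] <-] h] := inf_adherent d0 Rq_has_inf.
by exists u.
Qed.

Let S_filter : ProperFilter (filter_from [set d : R | 0 < d] S).
Proof.
apply: filter_from_proper => //; apply: filter_from_filter; first by exists 1; exact: ltr01.
move=> i j /= i0 j0; exists (Num.min i j); first by rewrite /= lt_min i0.
move=> u [Du Mu Bu]; split; split=> //; apply: lt_le_trans Bu _;
by rewrite lerD2l ge_min lexx ?orbT.
Qed.

Let S_bounded u : S 1 u -> G u u <= 1 + K * (lam + 1).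
Proof.
move=> [Du Mu Bu]; apply: le_trans (GMB (DH Du)) _; rewrite Mu lerD2l.
by rewrite ler_pM2l// ltW.
Qed.

Let parallelogram F u v : psd_form H F -> H u -> H v ->
  F (u - v) (u - v) = 2 * F u u + 2 * F v v - F (u + v) (u + v).
Proof. by move=> pF Hu Hv; rewrite (psd_formB sH pF)// (psd_formD sH pF)//; ring. Qed.

(* Every bounded functional converges along an ultrafilter refining the sets of
   almost minimisers, so no diagonal extraction is needed. *)
Section ultra.
Variable U : set_system V.
Hypotheses (UU : UltraFilter U) (US : forall d, 0 < d -> U (S d)).

Let M_cauchy e : 0 < e ->
  exists2 A, U A & forall u v, A u -> A v -> M (u - v) (u - v) <= e.
Proof.
move=> e0; have PU : ProperFilter U := @ultra_proper _ _ UU.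
(* [Q] bounds [G] on [S 1], so [G (u - v) (u - v) <= 4 * Q] by the parallelogram identity, and the
   coefficient [e / (8 * Q)] makes this term cost [e / 2]. *)
pose Q := 1 + K * (lam + 1).
have Q0 : 0 < Q.
  by rewrite /Q ltr_wpDr// mulr_ge0 ?ltW// addr_gt0.
have [|I [l [C [lB lC lM]]]] := @compact_embedding (e / (8 * Q)).
  by rewrite divr_gt0// mulr_gt0.
have [C0 C00 C0C] : exists2 C0, 0 <= C0 & C <= C0 ^+ 2.
  exists (`|C| + 1) => //; rewrite expr2; have := ler_norm C.
  have := normr_ge0 C; nra.
have lb i u : S 1 u -> `|l i u| <= C0.
  move=> [Du Mu _]; rewrite -ler_sqr ?nnegrE// sqr_normr.
  by apply: le_trans (lC i u Du) _; rewrite Mu mulr1.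
(* [n] squares below [t] add up to at most [e / 2]; the successor keeps the denominator positive
   when [I] is empty. *)
pose n := #|I|; pose t := e / (2 * n.+1%:R).
have n0 : 0 < n.+1%:R :> R by rewrite ltr0n.
have t0 : 0 < t by rewrite divr_gt0// mulr_gt0.
have s0 : 0 < Num.sqrt t by rewrite sqrtr_gt0.
have /choice[A HA] : forall i, exists A : set V, U A /\
    (forall u v, A u -> A v -> `|l i u - l i v| < Num.sqrt t).
  move=> i; have [A' UA' A'P] := ultra_cauchy UU (US ltr01) (lb i) s0.
  by exists A'.
exists (S 1 `&` [set u | forall i, A i u]).
  apply: filterI; first exact: US.
  by apply: filter_forall => i; have [] := HA i.
move=> u v [Su Au] [Sv Av].
have [Du _ _] := Su; have [Dv _ _] := Sv.
have Duv := subspaceB sD Du Dv.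
apply: le_trans (lM _ Duv) _.
have h1 : \sum_i l i (u - v) ^+ 2 <= e / 2.
  apply: (@le_trans _ _ (\sum_(i : I) t)).
    apply: ler_sum => i _; rewrite lB// -sqr_normr -[leRHS](sqr_sqrtr (ltW t0)).
    rewrite ler_sqr ?nnegrE ?sqrtr_ge0// ltW//.
    by have [_] := HA i; apply; [exact: Au|exact: Av].
  rewrite sumr_const -/n -[leLHS]mulr_natl /t.
  have -> : e / (2 * n.+1%:R) = (e / 2) / n.+1%:R by rewrite invfM mulrA.
  rewrite mulrCA -[leRHS]mulr1 ler_pM2l; last lra.
  by rewrite ler_pdivrMr// mul1r ler_nat.
have h2 : G (u - v) (u - v) <= 4 * Q.
  rewrite (parallelogram pG (DH Du) (DH Dv)).
  have [_ _ G0] := pG.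
  have := G0 _ (subspaceD sH (DH Du) (DH Dv)).
  by have := S_bounded Su; have := S_bounded Sv; rewrite -/Q; lra.
have h3 : e / (8 * Q) * G (u - v) (u - v) <= e / 2.
  apply: (@le_trans _ _ (e / (8 * Q) * (4 * Q))).
    by rewrite ler_pM2l// divr_gt0// mulr_gt0.
  have -> : e / (8 * Q) * (4 * Q) = e / 2 by field; rewrite gt_eqF.
  by [].
lra.
Qed.

(* By the parallelogram identity and the minimality of [lam], almost minimisers
   that are close for [M] are close for [B]. *)
Let G_cauchy e : 0 < e ->
  exists2 A, U A & forall u v, A u -> A v -> G (u - v) (u - v) <= e.
Proof.
move=> e0; have PU : ProperFilter U := @ultra_proper _ _ UU.
(* If [M (u - v) (u - v) <= t] and both values of [B] are below [lam + t], then [B (u - v) (u - v)]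
   is at most [4 * (lam + t) - lam * (4 - t) = (lam + 4) * t]. Together with the [M] part this makes
   [e]. *)
pose t := e / (1 + K * (lam + 4)).
have q0 : 0 < 1 + K * (lam + 4).
  by rewrite ltr_wpDr// mulr_ge0 ?ltW// addr_gt0.
have t0 : 0 < t by rewrite divr_gt0.
have [A UA AP] := M_cauchy t0.
exists (A `&` S t); first by apply: filterI => //; exact: US.
move=> u v [Au [Du Mu Bu]] [Av [Dv Mv Bv]].
have [Hu Hv] := (DH Du, DH Dv).
have h1 := AP _ _ Au Av.
apply: le_trans (GMB (subspaceB sH Hu Hv)) _.
have h2 := lam_le_D (subspaceD sD Du Dv).
have h3 : B (u - v) (u - v) <= (lam + 4) * t.
  rewrite (parallelogram pB)//.
  have h4 := parallelogram pM Hu Hv; rewrite Mu Mv in h4.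
  have h5 : M (u + v) (u + v) >= 4 - t by lra.
  have := ler_wpM2l (ltW lam_gt0) h5; lra.
have : K * B (u - v) (u - v) <= K * ((lam + 4) * t) by rewrite ler_pM2l.
have -> : e = t * (1 + K * (lam + 4)) by rewrite /t divfK// gt_eqF.
lra.
Qed.

(** Choosing [v k] in the intersection of [A 0], ..., [A k] puts both [v k] and [v k.+1] in [A k],
    where differences are controlled. *)
Let minimizing_seq : exists v : nat -> V,
  [/\ forall k, D (v k), forall k, M (v k) (v k) = 1,
   forall k, B (v k) (v k) < lam + k.+1%:R^-1 &
   forall k, G (v k.+1 - v k) (v k.+1 - v k) <= 4^-1 ^+ k].
Proof.
have PU : ProperFilter U := @ultra_proper _ _ UU.
have /choice[A HA] : forall k, exists A : set V, U A /\
    forall u v, A u -> A v -> G (u - v) (u - v) <= 4^-1 ^+ k.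
  move=> k; have [|A UA AP] := @G_cauchy (4^-1 ^+ k).
    by rewrite exprn_gt0// invr_gt0.
  by exists A.
have /choice[v Hv] : forall k, exists u,
    ((forall i : 'I_k.+1, A i u) /\ S k.+1%:R^-1 u).
  move=> k; apply: (@filter_ex _ U).
  apply: filterI; last by apply: US; rewrite invr_gt0.
  by apply: filter_forall => i; have [] := HA i.
exists v; split=> [k|k|k|k]; try by have [_ []] := Hv k.
have [_ h] := HA k; apply: h.
  have [h _] := Hv k.+1; have lk : (k < k.+2)%N by rewrite ltnS.
  exact: (h (Ordinal lk)).
by have [h _] := Hv k; exact: (h ord_max).
Qed.

Lemma minimizer_ultra : exists u, [/\ H u, M u u = 1 & B u u = lam].
Proof.
have [v [vD vM vB vG]] := minimizing_seq.
have [w Hw wv] := complete vD vG; exists w; split=> //.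
  have MG1 u : H u -> M u u <= 1 * G u u by rewrite mul1r; exact: MG.
  apply/eqP; rewrite -subr_eq0 -normr_le0; apply/ler_addgt0Pl => e e0.
  have [d d0 h] := cont pM ltr01 MG1 Hw e0.
  have [k0 hk] := wv _ d0.
  have := h _ (DH (vD k0)) (hk _ (leqnn _)).
  by rewrite vM addr0 => /ltW.
apply/eqP; rewrite -subr_eq0 -normr_le0; apply/ler_addgt0Pl => e e0.
have e2 : 0 < e / 2 by lra.
have [d d0 h] := cont pB K_gt0 BG Hw e2.
have [k0 hk] := wv _ d0.
pose k := maxn k0 (Num.truncn (e / 2)^-1).
have := h _ (DH (vD k)) (hk _ (leq_maxl _ _)).
have h1 := vB k.
have h2 := lam_le_D (vD k); rewrite vM mulr1 in h2.
have h3 : k.+1%:R^-1 <= e / 2.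
  rewrite -[leRHS]invrK lef_pV2 ?posrE ?invr_gt0 ?ltr0n//.
  apply: le_trans (ltW (truncnS_gt _)) _.
  by rewrite ler_nat ltnS leq_maxr.
rewrite addr0 ltr_norml => /andP[h4 h5].
move: (B (v k) (v k)) (k.+1%:R^-1) h1 h2 h3 h4 h5 => b t h1 h2 h3 h4 h5.
by rewrite ler_norml; apply/andP; split; lra.
Qed.

End ultra.

Theorem rayleigh_minimizer : exists lambda : R,
  [/\ 0 < lambda, forall u, H u -> lambda * M u u <= B u u &
      exists u, [/\ H u, M u u = 1 & B u u = lambda]].
Proof.
exists lam; split=> //.
have [U [UU FU]] := ultraFilterLemma S_filter.
by apply: (@minimizer_ultra U) => // d d0; apply: FU; exists d.
Qed.

End minimizer.

(** * Borel structure and iterated integrals on cubes *)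

Section rV_topology.
Context {R : realType}.

Lemma cvg_rV (T : Type) (F : set_system T) {FF : Filter F} n
    (f : T -> 'rV[R]_n) (l : 'rV[R]_n) :
  (forall i, f x ord0 i @[x --> F] --> l ord0 i) -> f @ F --> l.
Proof.
move=> fl; apply/cvg_ballP => e e0.
have h : F (fun x => forall i, `|l ord0 i - f x ord0 i| < e).
  by apply: filter_forall => i; have /cvgrPdist_lt/(_ e e0) := fl i.
by apply: (filterS _ h) => x hx; split=> // j i; rewrite (ord1 j); exact: hx.
Qed.

Lemma continuous_coord_rV n (i : 'I_n) : continuous (fun v : 'rV[R]_n => v ord0 i).
Proof. exact: coord_continuous. Qed.

Lemma rV_ballP n (v w : 'rV[R]_n) e : 0 < e ->
  ball v e w <-> forall i, `|v ord0 i - w ord0 i| < e.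
Proof.
move=> e0; split; first by move=> [_ h] i; exact: (h ord0 i).
by move=> h; split=> // j i; rewrite (ord1 j); exact: h.
Qed.

(** A countable base of balls for the maximum norm: rational centre [q.1], radius [1 / (q.2 + 1)].
    It makes open sets Borel, and it later turns local statements almost everywhere into global
    ones. *)
Definition rat_ball n (q : 'rV[rat]_n * nat) : set 'rV[R]_n :=
  [set v | forall i, `|ratr (q.1 ord0 i) - v ord0 i| < q.2.+1%:R^-1].

(** The closed balls matter because a bump on a box is a test function only if the closed box lies
    in the domain. *)
Definition rat_cball n (q : 'rV[rat]_n * nat) : set 'rV[R]_n :=
  [set v | forall i, `|ratr (q.1 ord0 i) - v ord0 i| <= q.2.+1%:R^-1].

Lemma rat_ball_cball n q : @rat_ball n q `<=` rat_cball q.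
Proof. by move=> v qv i; exact/ltW/qv. Qed.

Lemma measurable_rat_ball n q : measurable (@rat_ball n q).
Proof.
rewrite (_ : rat_ball _ = \bigcap_(i in [set: 'I_n]) (fun v : 'rV[R]_n => v ord0 i) @^-1`
   [set x | `|ratr (q.1 ord0 i) - x| < q.2.+1%:R^-1]); last first.
  by apply/seteqP; split=> v /=; [move=> h i _; exact: h|move=> h i; exact: h].
apply: fin_bigcap_measurable => // i _.
rewrite -[X in measurable X]setTI; apply: measurable_coord => //.
rewrite [X in measurable X](_ : _ = ball (ratr (q.1 ord0 i) : R) q.2.+1%:R^-1) //.
by rewrite ball_itv; exact: measurable_itv.
Qed.

Lemma open_rat_ball n (A : set 'rV[R]_n) (x : 'rV[R]_n) : open A -> A x ->
  exists q, rat_ball q x /\ rat_cball q `<=` A.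
Proof.
rewrite openE => Ao Ax; have /nbhs_ballP[e/= e0 eA] := Ao _ Ax.
pose k := Num.truncn (e / 2)^-1.
have ke : k.+1%:R^-1 < e / 2.
  rewrite -[ltRHS]invrK ltf_pV2 ?posrE ?invr_gt0 ?ltr0n ?divr_gt0//.
  exact: truncnS_gt.
have k0 : 0 < k.+1%:R^-1 :> R by rewrite invr_gt0.
have /choice[q qP] : forall i, exists q : rat, `|ratr q - x ord0 i| < k.+1%:R^-1.
  move=> i; have [|q] := @rat_in_itvoo R (x ord0 i - k.+1%:R^-1) (x ord0 i + k.+1%:R^-1).
    by rewrite ltrD2l gtrN.
  by rewrite in_itv/= => h; exists q; rewrite distrC ltr_distlC.
exists (\row_i q i, k); split.
  by move=> i /=; rewrite mxE; exact: qP.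
move=> v /= hv; apply: eA; apply/rV_ballP => // i.
have := hv i; have := qP i; rewrite mxE /=.
have := ler_distD (ratr (q i)) (x ord0 i) (v ord0 i).
by rewrite (distrC _ (ratr (q i))); move: (k.+1%:R^-1) ke => t; lra.
Qed.

Lemma open_measurable_rV n (A : set 'rV[R]_n) : open A -> measurable A.
Proof.
move=> Ao.
rewrite (_ : A = \bigcup_q
    (if `[< @rat_ball n q `<=` A >] then rat_ball q else set0)).
  apply: countable_bigcupT_measurable => // q.
  by case: ifP => // _; exact: measurable_rat_ball.
apply/seteqP; split=> [x Ax|x [q _]].
  have [q [qx qA]] := open_rat_ball Ao Ax; exists q => //; rewrite asboolT//.
  exact: subset_trans (@rat_ball_cball _ q) qA.
by case: asboolP => // qA; exact: qA.
Qed.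

Lemma continuous_measurable_rV n (f : 'rV[R]_n -> R) :
  continuous f -> measurable_fun setT f.
Proof.
move=> cf; apply: (measurability _ (measurable_realfun.RGenOInfty.measurableE R)).
move=> _ [_ [x ->] <-]; rewrite setTI; apply: open_measurable_rV.
by move/continuousP : cf; apply; exact: rray_open.
Qed.

End rV_topology.

Lemma bounded_integrable (R : realType) d (T : measurableType d)
    (mu : {measure set T -> \bar R}) (D : set T) (f : T -> R) (C : R) :
  measurable D -> (mu D < +oo)%E -> measurable_fun D f ->
  (forall x, D x -> `|f x| <= C) -> mu.-integrable D (EFin \o f).
Proof.
move=> mD Doo mf fC; apply: measurable_bounded_integrable => //.
exists C; split; first exact: num_real.
by move=> M CM x /= Dx; apply: le_trans (fC x Dx) _; exact: ltW.
Qed.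

Section cube.
Context {R : realType}.

(* Half-open, so that the cells of a grid partition a cube. *)
Definition cube n (a : 'rV[R]_n) (e : R) : set 'rV[R]_n :=
  [set v | forall i, v ord0 i \in `[a ord0 i, a ord0 i + e[ ].

Definition tail_rV n (a : 'rV[R]_n.+1) : 'rV[R]_n :=
  \row_j a ord0 (lift ord0 j).

Lemma cons_rV0 n (t : R) (y : 'rV[R]_n) : cons_rV (t, y) ord0 ord0 = t.
Proof. by rewrite mxE unlift_none. Qed.

Lemma cons_rV_lift n (t : R) (y : 'rV[R]_n) j :
  cons_rV (t, y) ord0 (lift ord0 j) = y ord0 j.
Proof. by rewrite mxE liftK. Qed.

Lemma measurable_cube n (a : 'rV[R]_n) e : measurable (cube a e).
Proof.
rewrite (_ : cube a e = \bigcap_(i in [set: 'I_n]) (fun v : 'rV[R]_n => v ord0 i) @^-1`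
   [set` `[a ord0 i, a ord0 i + e[ ]); last first.
  by apply/seteqP; split=> v /=; [move=> h i _; exact: h|move=> h i; exact: h].
apply: fin_bigcap_measurable => // i _.
by rewrite -[X in measurable X]setTI; exact: measurable_coord.
Qed.

Lemma lebesgue_cube n (a : 'rV[R]_n) e : 0 <= e ->
  lebesgue_rV n (cube a e) = (e ^+ n)%:E.
Proof.
move=> e0; rewrite /cube.
rewrite (lebesgue_rV_box (A := fun i => [set` `[a ord0 i, a ord0 i + e[ ])); last first.
  by move=> i; exact: measurable_itv.
rewrite (eq_bigr (fun=> e%:E)); last first.
  move=> i _; rewrite lebesgue_measure_itv/= lte_fin ltrDl.
  have [_|e1] := ltP 0 e; first by rewrite -EFinD addrC addKr.
  by congr EFin; apply/eqP; rewrite eq_le e0.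
by rewrite prodEFin prodr_const card_ord.
Qed.

Lemma cube_lty n (a : 'rV[R]_n) e : 0 <= e ->
  (lebesgue_rV n (cube a e) < +oo)%E.
Proof. by move=> e0; rewrite lebesgue_cube// ltry. Qed.

Lemma cube_cons n (a : 'rV[R]_n.+1) e t y :
  cube a e (cons_rV (t, y)) <->
  (t \in `[a ord0 ord0, a ord0 ord0 + e[) /\ cube (tail_rV a) e y.
Proof.
split=> [h|[h0 h] i].
  split; first by have := h ord0; rewrite cons_rV0.
  by move=> i; have := h (lift ord0 i); rewrite cons_rV_lift mxE.
case: (unliftP ord0 i) => [k ->|->]; last by rewrite cons_rV0.
by rewrite cons_rV_lift; have := h k; rewrite mxE.
Qed.

Lemma cube_bounded n (a : 'rV[R]_n) e (f : 'rV[R]_n -> R) : continuous f ->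
  exists2 C, 0 <= C & forall v, cube a e v -> `|f v| <= C.
Proof.
move=> cf.
pose K (i : 'I_n) : set R := `[a ord0 i, a ord0 i + e]%classic.
have cK : compact [set v : 'rV[R]_n | forall i, K i (v ord0 i)].
  by apply: rV_compact => i; exact: segment_compact.
have /compact_bounded[C0 [_ C0P]] :=
  continuous_compact (continuous_subspaceT cf) cK.
have C1 : C0 < `|C0| + 1 by apply: le_lt_trans (ler_norm _) _; rewrite ltrDl.
exists (`|C0| + 1) => [|v vK]; first exact: addr_ge0.
apply: (C0P _ C1); exists v => // i.
by have := vK i; rewrite /K/= !in_itv/= => /andP[-> /ltW].
Qed.

Lemma integrable_cube n (a : 'rV[R]_n) e (f : 'rV[R]_n -> R) :
  0 <= e -> continuous f ->
  (lebesgue_rV n).-integrable (cube a e) (EFin \o f).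
Proof.
move=> e0 cf; have [C _ fC] := cube_bounded a e cf.
apply: (bounded_integrable (C := C)) => //; first exact: measurable_cube.
  exact: cube_lty.
by apply: measurable_funTS (continuous_measurable_rV cf).
Qed.

Lemma continuous_cons_rV_l n (t : R) : continuous (fun y : 'rV[R]_n => cons_rV (t, y)).
Proof.
move=> y; apply: (@cvg_rV _ _ (nbhs y) _) => i; rewrite mxE.
under eq_fun do rewrite mxE.
by case: unliftP => [j _|_]; [exact: continuous_coord_rV|exact: cvg_cst].
Qed.

Lemma continuous_cons_rV_r n (y : 'rV[R]_n) : continuous (fun t : R => cons_rV (t, y)).
Proof.
move=> t; apply: (@cvg_rV _ _ (nbhs t) _) => i; rewrite mxE.
under eq_fun do rewrite mxE.
by case: unliftP => [j _|_]; [exact: cvg_cst|exact: cvg_id].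
Qed.

Section fubini.
Variables (n : nat) (a : 'rV[R]_n.+1) (e : R) (f : 'rV[R]_n.+1 -> R).
Hypotheses (e0 : 0 <= e) (cf : continuous f).

Let I : set (measurableTypeR R) := [set` `[a ord0 ord0, a ord0 ord0 + e[ ].
Let Q := cube (tail_rV a) e.
Let mu := @lebesgue_rV R n.
Let leb := @lebesgue_measure R.
(** [lebesgue_rV n.+1] is by construction the image of a product measure under [cons_rV]. Pulling
    the zero extension of [f] back to the product gives the function to which Fubini's theorem
    applies. *)
Let g : measurableTypeR R * 'rV[R]_n -> \bar R := ((EFin \o f) \_ (cube a e)) \o @cons_rV R n.

Let ig : (leb \x mu)%E.-integrable setT g.
Proof.
have [C C0 fC] := cube_bounded a e cf.
rewrite (_ : g = (EFin \o (f \o @cons_rV R n)) \_ (@cons_rV R n @^-1` cube a e)); last first.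
  apply/funext => p; rewrite /g /patch /=.
  have -> : (p \in @cons_rV R n @^-1` cube a e) = (cons_rV p \in cube a e).
    by rewrite /in_mem.
  by [].
have mD : measurable (@cons_rV R n @^-1` cube a e).
  rewrite -[X in measurable X]setTI.
  by apply: measurable_cons_rV => //; exact: measurable_cube.
apply: (integrable_mkcond _ mD).1.
apply: (@bounded_integrable _ _ _ (leb \x mu)%E _ (f \o @cons_rV R n) C) => //.
- exact: (cube_lty a e0).
- apply: measurable_funTS; apply: measurableT_comp (continuous_measurable_rV cf) _.
  exact: measurable_cons_rV.
- by move=> p Dp; exact: fC.
Qed.

Let gE : (\int[lebesgue_rV n.+1]_(v in cube a e) (f v)%:E = \int[leb \x mu]_p g p)%E.
Proof.
have /measurable_int mg :=
  (integrable_mkcond _ (measurable_cube a e)).1 (integrable_cube a e0 cf).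
rewrite integral_mkcond /= /cons_measure integral_pushforward//.
exact: measurable_cons_rV.
Qed.

Let FE : fubini_F mu g = (EFin \o (fun t => \int[mu]_(y in Q) f (cons_rV (t, y)))) \_ I.
Proof.
apply/funext => t; rewrite /fubini_F /patch; case: ifPn => [tI|tI].
  rewrite /Rintegral /= fineK.
    rewrite [RHS]integral_mkcond; apply: eq_integral => y _.
    rewrite /g /patch /=; rewrite inE in tI.
    have -> : (cons_rV (t, y) \in cube a e) = (y \in Q).
      by apply/asbool_equiv_eq; rewrite cube_cons; split=> [[]|].
    by [].
  apply: integrable_fin_num; first exact: measurable_cube.
  apply: integrable_cube => // y; apply: continuous_comp; first exact: continuous_cons_rV_l.
  exact: cf.
rewrite integral0_eq// => y _; rewrite /g /patch /= memNset// => /cube_cons[h _].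
by move: tI; rewrite notin_setE.
Qed.

Let Ioo : (leb I < +oo)%E.
Proof.
by rewrite [leb I]lebesgue_measure_itv/=; case: ifP => // _; rewrite -EFinB ltry.
Qed.

Lemma slice_integrable y : Q y ->
  leb.-integrable I (EFin \o (fun t => f (cons_rV (t, y)))).
Proof.
move=> yQ; have mI : measurable I by exact: measurable_itv.
have [C C0 fC] := cube_bounded a e cf.
apply: (bounded_integrable (C := C)) => //.
  apply: measurable_funTS; apply: continuous_measurable_fun => t.
  by apply: continuous_comp; [exact: continuous_cons_rV_r|exact: cf].
by move=> t tI; apply: fC; apply/cube_cons.
Qed.

Let GE : fubini_G leb g = (EFin \o (fun y => \int[leb]_(t in I) f (cons_rV (t, y)))) \_ Q.
Proof.
have mI : measurable I by exact: measurable_itv.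
apply/funext => y; rewrite /fubini_G /patch; case: ifPn => [yQ|yQ].
  rewrite inE in yQ.
  rewrite /Rintegral /= fineK.
    rewrite [RHS]integral_mkcond; apply: eq_integral => t _.
    rewrite /g /patch /=.
    have -> : (cons_rV (t, y) \in cube a e) = (t \in I).
      by apply/asbool_equiv_eq; rewrite cube_cons; split=> [[]|].
    by [].
  by apply: integrable_fin_num => //; exact: slice_integrable.
rewrite integral0_eq// => t _; rewrite /g /patch /= memNset// => /cube_cons[_ h].
by move: yQ; rewrite notin_setE.
Qed.

Lemma integrable_slice_r :
  leb.-integrable I (EFin \o (fun t => \int[mu]_(y in Q) f (cons_rV (t, y)))).
Proof.
have mI : measurable I by exact: measurable_itv.
by apply: (@integrable_mkcond _ _ _ leb _ _ mI).2; rewrite -FE; exact: integrable_fubini_F.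
Qed.

Lemma integrable_slice_l :
  mu.-integrable Q (EFin \o (fun y => \int[leb]_(t in I) f (cons_rV (t, y)))).
Proof.
have mI : measurable I by exact: measurable_itv.
have [C C0 fC] := cube_bounded a e cf.
have mG := measurable_fubini_G ig; rewrite GE in mG.
apply: (bounded_integrable (C := C * fine (leb I))).
- exact: measurable_cube.
- exact: cube_lty.
- apply/measurable_EFinP; exact: (measurable_restrictT _ (measurable_cube _ _)).2 mG.
move=> y yQ; have iy := slice_integrable yQ.
have h := le_normr_Rintegral mI iy; apply: (le_trans h).
rewrite -(@Rintegral_cst _ _ _ leb _ mI); apply: le_Rintegral => //.
- have /integrable_abse := iy; apply: eq_integrable => // t _ /=; by [].
- by apply: (@bounded_integrable _ _ _ leb _ (cst C) C) => //= t _; rewrite ger0_norm.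
- by move=> t tI; apply: fC; apply/cube_cons.
Qed.

Lemma Fubini_cube_r : \int[lebesgue_rV n.+1]_(v in cube a e) f v =
  \int[leb]_(t in I) \int[mu]_(y in Q) f (cons_rV (t, y)).
Proof.
rewrite {1 2}/Rintegral gE -integral12_prod_meas1// FE -integral_mkcond//.
Qed.

Lemma Fubini_cube_l : \int[lebesgue_rV n.+1]_(v in cube a e) f v =
  \int[mu]_(y in Q) \int[leb]_(t in I) f (cons_rV (t, y)).
Proof.
rewrite {1 2}/Rintegral gE -integral21_prod_meas1// GE -integral_mkcond//.
Qed.

End fubini.
End cube.

(** * The mean value inequality on cubes *)

Section Rintegral_algebra.
Context {R : realType} d {T : measurableType d}.
Variables (mu : {measure set T -> \bar R}) (D : set T).
Hypothesis mD : measurable D.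
Implicit Types f g : T -> R.
Local Notation integrable f := (mu.-integrable D (EFin \o f)).

Lemma integrableDR f g : integrable f -> integrable g ->
  integrable (fun x => f x + g x).
Proof.
by move=> h1 h2; apply: eq_integrable (integrableD mD h1 h2) => // x _ /=; rewrite EFinD.
Qed.

Lemma integrableBR f g : integrable f -> integrable g ->
  integrable (fun x => f x - g x).
Proof.
by move=> h1 h2; apply: eq_integrable (integrableB mD h1 h2) => // x _ /=; rewrite EFinB.
Qed.

Lemma integrableZR k f : integrable f -> integrable (fun x => k * f x).
Proof.
by move=> h1; apply: eq_integrable (integrableZl mD k h1) => // x _ /=; rewrite EFinM.
Qed.

Lemma integrable_sumR (I : Type) (s : seq I) (f : I -> T -> R) :
  (forall i, integrable (f i)) -> integrable (fun x => \sum_(i <- s) f i x).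
Proof.
move=> fi; elim: s => [|i s IHs].
  by apply: eq_integrable (@integrable0 _ _ _ mu D) => // x _ /=; rewrite big_nil.
by apply: eq_integrable (integrableDR (fi i) IHs) => // x _ /=; rewrite big_cons.
Qed.

Lemma Rintegral_sum (I : Type) (s : seq I) (f : I -> T -> R) :
  (forall i, integrable (f i)) ->
  \int[mu]_(x in D) (\sum_(i <- s) f i x) = \sum_(i <- s) \int[mu]_(x in D) f i x.
Proof.
move=> fi; elim: s => [|i s IHs].
  have h := Rintegral_cst mu mD 0; rewrite mul0r in h.
  by rewrite big_nil -[RHS]h; apply: eq_Rintegral => x _; rewrite big_nil.
rewrite big_cons -IHs -RintegralD//; last exact: integrable_sumR.
by apply: eq_Rintegral => x _; rewrite big_cons.
Qed.

End Rintegral_algebra.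

(** * Mean and variance on a set of finite measure *)

Section variance.
Context {R : realType} d {T : measurableType d}.
Variables (mu : {measure set T -> \bar R}) (D : set T) (m : R).
Hypotheses (mD : measurable D) (m0 : 0 < m) (Dm : mu D = m%:E).

Let Doo : (mu D < +oo)%E. Proof. by rewrite Dm ltry. Qed.

Lemma integrable_cst (c : R) : mu.-integrable D (EFin \o cst c).
Proof. exact: (bounded_integrable (C := `|c|)). Qed.

(** The two lemmas that follow read this identity in opposite directions: nonnegativity of the left
    side is the Cauchy-Schwarz inequality, and a bound on it by the oscillation of [h] is the
    one-dimensional core of the inequality on cubes. *)
Lemma variance_Rintegral (h : T -> R) :
  mu.-integrable D (EFin \o h) -> mu.-integrable D (EFin \o (fun x => h x ^+ 2)) ->
  \int[mu]_(x in D) ((h x - (\int[mu]_(x in D) h x) / m) ^+ 2) =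
  \int[mu]_(x in D) (h x ^+ 2) - (\int[mu]_(x in D) h x) ^+ 2 / m.
Proof.
move=> ih ih2; set c := _ / m.
have i1 : mu.-integrable D (EFin \o (fun x => 2 * c * h x)).
  exact: integrableZR.
have i2 := integrable_cst (c ^+ 2).
have i3 : mu.-integrable D (EFin \o (fun x => h x ^+ 2 - 2 * c * h x)).
  exact: integrableBR.
transitivity (\int[mu]_(x in D) (h x ^+ 2 - 2 * c * h x + c ^+ 2)).
  by apply: eq_Rintegral => x _; ring.
rewrite RintegralD// RintegralB// RintegralZl// Rintegral_cst// Dm/= /c.
by field; rewrite gt_eqF.
Qed.

Lemma Rintegral_sqr_le (h : T -> R) :
  mu.-integrable D (EFin \o h) -> mu.-integrable D (EFin \o (fun x => h x ^+ 2)) ->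
  (\int[mu]_(x in D) h x) ^+ 2 <= m * \int[mu]_(x in D) (h x ^+ 2).
Proof.
move=> ih ih2; have := variance_Rintegral ih ih2.
have : 0 <= \int[mu]_(x in D) ((h x - (\int[mu]_(x in D) h x) / m) ^+ 2).
  by apply: Rintegral_ge0 => x _; exact: sqr_ge0.
move=> h0 h1; rewrite h1 subr_ge0 in h0.
by rewrite -ler_pdivrMl// mulrC.
Qed.

(** Let [c] be the mean of [h]. Since [m * (h x - c)] is the integral of [h x - h y] over [y], every
    value of [h] is within [L] of [c], which bounds the variance by [m * L ^+ 2]. *)
Lemma oscillation_Rintegral (h : T -> R) (L : R) : D !=set0 ->
  mu.-integrable D (EFin \o h) -> 0 <= L ->
  (forall x y, D x -> D y -> h x - h y <= L) ->
  \int[mu]_(x in D) (h x ^+ 2) <= (\int[mu]_(x in D) h x) ^+ 2 / m + m * L ^+ 2.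
Proof.
move=> [x0 Dx0] ih L0 hL.
have mh : measurable_fun D h by apply/measurable_EFinP; exact: measurable_int ih.
have hb x : D x -> `|h x| <= `|h x0| + L.
  move=> Dx; have := hL _ _ Dx Dx0; have := hL _ _ Dx0 Dx.
  have := ler_norm (h x0); have := ler_norm (- h x0); rewrite normrN => *.
  by rewrite ler_norml; apply/andP; split; lra.
have ih2 : mu.-integrable D (EFin \o (fun x => h x ^+ 2)).
  apply: (bounded_integrable (C := (`|h x0| + L) ^+ 2)) => //.
    exact: measurable_funX.
  by move=> x Dx; rewrite normrX ler_sqr ?nnegrE ?addr_ge0//; exact: hb.
have := variance_Rintegral ih ih2.
set c := _ / m.
have cP x : D x -> (h x - c) ^+ 2 <= L ^+ 2.
  move=> Dx; rewrite -sqr_normr ler_sqr ?nnegrE// ler_norml.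
  have E1 : m * (h x - c) = \int[mu]_(y in D) (h x - h y).
    rewrite RintegralB//; last exact: integrable_cst.
    by rewrite Rintegral_cst// Dm/= /c; field; rewrite gt_eqF.
  have i1 : mu.-integrable D (EFin \o (fun y => h x - h y)).
    exact: integrableBR (integrable_cst (h x)) ih.
  have E2 : \int[mu]_(y in D) (h x - h y) <= m * L.
    rewrite mulrC -[m]/(fine m%:E) -Dm -Rintegral_cst//.
    apply: le_Rintegral => //; first exact: integrable_cst.
    by move=> y Dy; exact: hL.
  have E3 : - (m * L) <= \int[mu]_(y in D) (h x - h y).
    rewrite -mulrN mulrC -[m]/(fine m%:E) -Dm -Rintegral_cst//.
    apply: le_Rintegral => //; first exact: integrable_cst.
    by move=> y Dy; rewrite lerNl opprB; exact: hL.
  apply/andP; split; rewrite -(ler_pM2l m0) E1 ?mulrN//.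
have i4 : mu.-integrable D (EFin \o (fun x => (h x - c) ^+ 2)).
  apply: (bounded_integrable (C := L ^+ 2)) => //.
    by apply: measurable_funX; exact: measurable_funB.
  by move=> x Dx; rewrite ger0_norm ?sqr_ge0//; exact: cP.
have : \int[mu]_(x in D) ((h x - c) ^+ 2) <= L ^+ 2 * m.
  rewrite -[m]/(fine m%:E) -Dm -Rintegral_cst//.
  by apply: le_Rintegral => //; exact: integrable_cst.
move=> h1 h2; rewrite h2 in h1; rewrite addrC -lerBlDr; apply: le_trans h1 _.
by rewrite mulrC.
Qed.

End variance.

(** * Functions of class C^1 and their slices *)

Section C1.
Context {R : realType}.

Definition C1 n (u : 'rV[R]_n -> R) := continuous u /\ forall i,
  (forall x, derivable u x (delta_mx ord0 i)) /\ continuous (partial i u).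

Lemma cons_rV_shift n (t h : R) (y : 'rV[R]_n) j :
  cons_rV (t, h *: delta_mx ord0 j + y) =
  h *: delta_mx ord0 (lift ord0 j) + cons_rV (t, y).
Proof.
apply/rowP => k; rewrite !mxE; case: unliftP => [l ->|->].
  by rewrite !mxE (inj_eq lift_inj).
by rewrite (negbTE (neq_lift _ _)) andbF mulr0 add0r.
Qed.

Lemma cons_rV_shift0 n (t h : R) (y : 'rV[R]_n) :
  cons_rV (h + t, y) = h *: delta_mx ord0 ord0 + cons_rV (t, y).
Proof.
apply/rowP => k; rewrite !mxE; case: unliftP => [l ->|->].
  by rewrite /= mulr0 add0r.
by rewrite /= mulr1.
Qed.

Variables (n : nat) (u : 'rV[R]_n.+1 -> R).
Hypothesis C1u : C1 u.

Lemma derivable_slice t y j :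
  derivable (fun y => u (cons_rV (t, y))) y (delta_mx ord0 j).
Proof.
have [_ /(_ (lift ord0 j))[+ _]] := C1u => /(_ (cons_rV (t, y))).
rewrite /derivable /=.
by under eq_fun do rewrite -cons_rV_shift.
Qed.

Lemma partial_slice t y j :
  partial j (fun y => u (cons_rV (t, y))) y = partial (lift ord0 j) u (cons_rV (t, y)).
Proof.
rewrite /partial /derive /=.
by under eq_fun do rewrite cons_rV_shift.
Qed.

Lemma C1_slice t : C1 (fun y => u (cons_rV (t, y))).
Proof.
have [cu du] := C1u; split.
  by move=> y; apply: continuous_comp; [exact: continuous_cons_rV_l|exact: cu].
move=> j; split; first by move=> y; exact: derivable_slice.
rewrite (_ : partial j _ = partial (lift ord0 j) u \o (fun y => cons_rV (t, y))); last first.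
  by apply/funext => y; exact: partial_slice.
by move=> y; apply: continuous_comp; [exact: continuous_cons_rV_l|exact: (du _).2].
Qed.

Lemma derivable_slice0 t y : derivable (fun t => u (cons_rV (t, y))) t 1.
Proof.
have [_ /(_ ord0)[+ _]] := C1u => /(_ (cons_rV (t, y))).
rewrite /derivable /=.
under eq_fun do rewrite -cons_rV_shift0.
by under [in X in _ -> X]eq_fun do rewrite [_ *: 1]mulr1.
Qed.

Lemma derive_slice0 t y :
  derive1 (fun t => u (cons_rV (t, y))) t = partial ord0 u (cons_rV (t, y)).
Proof.
rewrite derive1E /partial /derive /=.
under [in RHS]eq_fun do rewrite -cons_rV_shift0.
by under [in LHS]eq_fun do rewrite [_ *: 1]mulr1.
Qed.

Lemma FTC_slice0 (s t : R) y : s < t ->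
  \int[lebesgue_measure]_(r in `[s, t]) partial ord0 u (cons_rV (r, y)) =
  u (cons_rV (t, y)) - u (cons_rV (s, y)).
Proof.
move=> st; have [cu du] := C1u.
have cr (v : 'rV[R]_n.+1 -> R) : continuous v -> continuous (fun r => v (cons_rV (r, y))).
  by move=> cv r; apply: continuous_comp; [exact: continuous_cons_rV_r|exact: cv].
rewrite /Rintegral (@continuous_FTC2 _ _ (fun t => u (cons_rV (t, y))))//.
- by apply: continuous_subspaceT; apply: cr; exact: (du _).2.
- split.
  + by move=> r _; exact: derivable_slice0.
  + by apply: cvg_at_right_filter; exact: cr.
  + by apply: cvg_at_left_filter; exact: cr.
- by move=> r _; exact: derive_slice0.
Qed.

End C1.

Lemma continuous_sqr {R : realType} (T : topologicalType) (f : T -> R) :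
  continuous f -> continuous (fun x => f x ^+ 2).
Proof.
move=> cf x; rewrite (_ : (fun x => f x ^+ 2) = f \* f); last first.
  by apply/funext => z /=; rewrite expr2.
by apply: continuousM; exact: cf.
Qed.

Section cube_inequality.
Context {R : realType}.
Local Notation leb := (@lebesgue_measure R).

(** The right side does not depend on [s] and [t]. Integrated over [y], it bounds the oscillation of
    the slice integrals of [u] by one constant. *)
Lemma slice0_diff_le n (u : 'rV[R]_n.+1 -> R) (a : 'rV[R]_n.+1) e s t y :
  C1 u -> 0 < e ->
  let I : set (measurableTypeR R) := [set` `[a ord0 ord0, a ord0 ord0 + e[ ] in
  I s -> I t -> cube (tail_rV a) e y ->
  u (cons_rV (t, y)) - u (cons_rV (s, y)) <=
    \int[leb]_(r in I) `|partial ord0 u (cons_rV (r, y))|.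
Proof.
move=> C1u e0 I Is It Qy.
have mI : measurable I by exact: measurable_itv.
have [cu du] := C1u.
have [_ cp] := du ord0.
have cn : continuous (fun v => `|partial ord0 u v|).
  by move=> v; apply: continuous_comp; [exact: cp|exact: norm_continuous].
have ip := slice_integrable cp Qy.
have inp := slice_integrable cn Qy.
have sub (s' t' : R) : I s' -> I t' -> [set` `[s', t']] `<=` I.
  move=> Is' It' r; move: Is' It'; rewrite /I /= !in_itv/= => /andP[+ _] /andP[_ +] /andP[].
  by move=> h1 h2 h3 h4; rewrite (le_trans h1 h3) (le_lt_trans h4 h2).
have key (s' t' : R) : I s' -> I t' -> s' < t' ->
    `|u (cons_rV (t', y)) - u (cons_rV (s', y))| <=
    \int[leb]_(r in I) `|partial ord0 u (cons_rV (r, y))|.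
  move=> Is' It' st; rewrite -(FTC_slice0 C1u _ st).
  have mJ : measurable ([set` `[s', t']] : set (measurableTypeR R)) by exact: measurable_itv.
  have sJ := sub _ _ Is' It'.
  have ipJ := integrableS mI mJ sJ ip.
  apply: le_trans (le_normr_Rintegral mJ ipJ) _.
  rewrite /Rintegral fine_le//.
  - exact: (integrable_fin_num mJ (integrableS mI mJ sJ inp)).
  - exact: (integrable_fin_num mI inp).
  - apply: ge0_subset_integral => //; exact: measurable_int inp.
have [st|ts|->] := ltgtP s t.
- by apply: le_trans (key _ _ Is It st); exact: ler_norm.
- by apply: le_trans (key _ _ It Is ts); rewrite distrC ler_norm.
- by rewrite subrr; apply: Rintegral_ge0.
Qed.

(** By induction on the dimension. The inequality on the slices gives the derivatives in all
    directions but the first, plus the integral of [U t ^+ 2], where [U t] is the integral of [u]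
    over a slice. As [U] oscillates by at most the integral [L] of [|partial ord0 u|],
    [oscillation_Rintegral] produces the mean of [u] and the missing derivative. *)
Theorem cube_inequality n (u : 'rV[R]_n -> R) (a : 'rV[R]_n) e : 0 < e -> C1 u ->
  \int[lebesgue_rV n]_(x in cube a e) (u x ^+ 2) <=
  (\int[lebesgue_rV n]_(x in cube a e) u x) ^+ 2 / e ^+ n +
  e ^+ 2 * \sum_(i < n) \int[lebesgue_rV n]_(x in cube a e) (partial i u x ^+ 2).
Proof.
elim: n u a => [|n IHn] u a e0 C1u.
  (* In dimension zero the measure is the Dirac mass at the only point, and both sides are
     [u 0 ^+ 2]. *)
  rewrite big_ord0 mulr0 addr0 expr0 divr1.
  have mQ := measurable_cube a e.
  have Q0 : cube a e (0 : 'rV[R]_0) by case.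
  have E (f : 'rV[R]_0 -> R) : continuous f ->
      \int[lebesgue_rV 0]_(x in cube a e) f x = f 0.
    move=> cf; rewrite /Rintegral /= integral_dirac//.
      by rewrite diracE mem_set//= mul1r.
    by apply/measurable_EFinP; apply: measurable_funTS; exact: continuous_measurable_rV.
  have [cu _] := C1u; rewrite !E//; exact: continuous_sqr.
have [cu du] := C1u.
have e0' := ltW e0.
pose I : set (measurableTypeR R) := [set` `[a ord0 ord0, a ord0 ord0 + e[ ].
pose Q := cube (tail_rV a) e.
have mI : measurable I by exact: measurable_itv.
have Ie : leb I = e%:E.
  by rewrite [leb I]lebesgue_measure_itv/= lte_fin ltrDl e0 -EFinD addrC addKr.
have Ioo : (leb I < +oo)%E by rewrite Ie ltry.
have I0 : I !=set0 by exists (a ord0 ord0); rewrite /I /= in_itv/= lexx ltrDl.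
have cu2 : continuous (fun x => u x ^+ 2).
  exact: continuous_sqr.
have cd2 i : continuous (fun x => partial i u x ^+ 2).
  exact: continuous_sqr (du i).2.
pose U t := \int[lebesgue_rV n]_(y in Q) u (cons_rV (t, y)).
pose g i t := \int[lebesgue_rV n]_(y in Q) (partial (lift ord0 i) u (cons_rV (t, y)) ^+ 2).
have en0 : 0 < e ^+ n by rewrite exprn_gt0.
have iU : leb.-integrable I (EFin \o U) := integrable_slice_r a e0' cu.
have ig i : leb.-integrable I (EFin \o g i) := integrable_slice_r a e0' (cd2 _).
pose L := \int[lebesgue_rV n.+1]_(x in cube a e) `|partial ord0 u x|.
have cn : continuous (fun v => `|partial ord0 u v|).
  by move=> v; apply: continuous_comp; [exact: (du _).2|exact: norm_continuous].
have L0 : 0 <= L by apply: Rintegral_ge0.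
have LL : L ^+ 2 <= e ^+ n.+1 * \int[lebesgue_rV n.+1]_(x in cube a e) (partial ord0 u x ^+ 2).
  have -> : \int[lebesgue_rV n.+1]_(x in cube a e) (partial ord0 u x ^+ 2) =
      \int[lebesgue_rV n.+1]_(x in cube a e) (`|partial ord0 u x| ^+ 2).
    by apply: eq_Rintegral => x _; rewrite sqr_normr.
  apply: Rintegral_sqr_le.
  - exact: measurable_cube.
  - by rewrite exprn_gt0.
  - exact: (lebesgue_cube a e0').
  - exact: integrable_cube.
  - by apply: integrable_cube => //; exact: continuous_sqr.
have cus t : continuous (fun y => u (cons_rV (t, y))).
  by move=> y; apply: continuous_comp; [exact: continuous_cons_rV_l|exact: cu].
have UL s t : I s -> I t -> U s - U t <= L.
  move=> Is It; rewrite /U -RintegralB; last 3 first.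
  - exact: measurable_cube.
  - exact: integrable_cube.
  - exact: integrable_cube.
  rewrite /L Fubini_cube_l//; apply: le_Rintegral.
  - exact: measurable_cube.
  - apply: integrable_cube => // y.
    by apply: (@continuousB _ _ _ _ _ y); exact: cus.
  - exact: (integrable_slice_l a e0' cn).
  - by move=> y Qy; exact: slice0_diff_le.
have iU2 : leb.-integrable I (EFin \o (fun t => U t ^+ 2)).
  have [s0 Is0] := I0.
  apply: (bounded_integrable (C := (`|U s0| + L) ^+ 2)) => //.
  - by apply: measurable_funX; apply/measurable_EFinP; exact: measurable_int iU.
  - move=> x Ix; rewrite normrX ler_sqr ?nnegrE ?addr_ge0//.
    have := UL _ _ Ix Is0; have := UL _ _ Is0 Ix.
    have := ler_norm (U s0); have := ler_norm (- U s0); rewrite normrN => *.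
    by rewrite ler_norml; apply/andP; split; lra.
have h1 := oscillation_Rintegral mI e0 Ie I0 iU L0 UL.
have isum := integrable_sumR mI (index_enum 'I_n) ig.
have iA := integrableZR mI (e ^+ n)^-1 iU2.
have iB := integrableZR mI (e ^+ 2) isum.
have h2 : \int[lebesgue_rV n.+1]_(x in cube a e) (u x ^+ 2) <=
    (e ^+ n)^-1 * \int[leb]_(t in I) (U t ^+ 2) +
    e ^+ 2 * \sum_(i < n) \int[leb]_(t in I) g i t.
  rewrite (Fubini_cube_r a e0' cu2) -/I -/Q.
  rewrite -(Rintegral_sum mI _ ig).
  rewrite -RintegralZl// -RintegralZl// -RintegralD//.
  apply: le_Rintegral => //.
  - exact: (integrable_slice_r a e0' cu2).
  - exact: integrableDR.
  - move=> t It; have := IHn _ (tail_rV a) e0 (C1_slice C1u t).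
    rewrite mulrC /g.
    under [X in _ <= _ + _ * X -> _]eq_bigr => i _.
      under eq_Rintegral do rewrite partial_slice//.
      over.
    by [].
apply: le_trans h2 _.
rewrite big_ord_recl mulrDr.
have -> : \sum_(i < n) \int[leb]_(t in I) g i t =
  \sum_(i < n) \int[lebesgue_rV n.+1]_(x in cube a e) (partial (lift ord0 i) u x ^+ 2).
  by apply: eq_bigr => i _; rewrite (Fubini_cube_r a e0' (cd2 _)).
rewrite addrA lerD2r.
rewrite -(Fubini_cube_r a e0' cu) in h1.
set A := \int[_]_(x in _) u x in h1 *.
set P := \int[_]_(x in _) (partial _ _ _ ^+ 2) in LL *.
(* The powers of [e] balance: one factor [e] comes from the length of the interval and [e ^+ n.+1]
   from Cauchy-Schwarz for [L]. Divided by [e ^+ n], they leave [e ^+ 2] before [P], and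
   [A ^+ 2 / e] becomes [A ^+ 2 / e ^+ n.+1]. *)
apply: (@le_trans _ _ ((e ^+ n)^-1 * (A ^+ 2 / e + e * (e ^+ n.+1 * P)))).
  rewrite ler_pM2l ?invr_gt0//; apply: le_trans h1 _.
  by rewrite lerD2l ler_pM2l.
rewrite le_eqVlt; apply/orP; left; apply/eqP.
by rewrite (exprS e n); field; rewrite !gt_eqF.
Qed.

End cube_inequality.

Lemma Rintegral0_eq {R : realType} d (T : measurableType d)
    (mu : {measure set T -> \bar R}) (D : set T) (f : T -> R) :
  (forall x, D x -> f x = 0) -> \int[mu]_(x in D) f x = 0.
Proof. by move=> f0; rewrite /Rintegral integral0_eq// => x Dx; rewrite f0. Qed.

(** Slicing reduces direction [i] to the first coordinate, where the fundamental theorem of calculus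
    leaves values on two opposite faces. The faces are outside the open intervals, so [w] vanishes
    there. Applied to a product, this is integration by parts. *)
Lemma Rintegral_partial_cube {R : realType} n (w : 'rV[R]_n -> R) (a : 'rV[R]_n) e i :
  0 < e -> C1 w ->
  (forall v : 'rV[R]_n, (exists k, v ord0 k \notin `]a ord0 k, a ord0 k + e[) -> w v = 0) ->
  \int[lebesgue_rV n]_(x in cube a e) partial i w x = 0.
Proof.
elim: n w a i => [|n IHn] w a i e0 C1w w0; first by case: i.
have e0' := ltW e0.
have [_ dw] := C1w.
case: (unliftP ord0 i) => [j ->|->].
  rewrite (Fubini_cube_r a e0' (dw _).2).
  apply: Rintegral0_eq => t _; have h : \int[lebesgue_rV n]_(y in cube (tail_rV a) e)
      partial j (fun y => w (cons_rV (t, y))) y = 0.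
    apply: IHn => //; first exact: C1_slice.
    move=> v [k vk]; apply: w0; exists (lift ord0 k).
    by move: vk; rewrite mxE cons_rV_lift.
  by rewrite -[RHS]h; apply: eq_Rintegral => y _; rewrite partial_slice.
rewrite (Fubini_cube_l a e0' (dw _).2).
apply: Rintegral0_eq => y Qy.
(* The cube is half-open and the fundamental theorem wants a closed interval; the end point has
   measure zero. *)
rewrite Rintegral_itv_bndo_bndc; last exact: (slice_integrable (dw ord0).2 Qy).
have ae : a ord0 ord0 < a ord0 ord0 + e by rewrite ltrDl.
rewrite (FTC_slice0 C1w _ ae) !w0 ?subrr//; exists ord0;
by rewrite cons_rV0 in_itv/= ltxx ?andbF.
Qed.

(** * Test functions *)

Section smooth1.
Context {R : realType}.
Implicit Types (f g : R -> R).

(** This is [k]-fold differentiability. Continuity of the last derivative is not demanded: it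
    follows from the next order for functions that satisfy [Ck k] for every [k]. *)
Fixpoint Ck (k : nat) f : Prop :=
  if k is k'.+1 then (forall t, derivable f t 1) /\ Ck k' (derive1 f) else True.

Lemma CkS k f : Ck k.+1 f -> Ck k f.
Proof. by elim: k f => // k IHk f [df Cf]; split=> //; exact: IHk. Qed.

Lemma CkD k f g : Ck k f -> Ck k g -> Ck k (fun t => f t + g t).
Proof.
elim: k f g => // k IHk f g [df Cf] [dg Cg]; split.
  by move=> t; exact: derivableD.
rewrite (_ : derive1 _ = fun t => derive1 f t + derive1 g t); first exact: IHk.
by apply/funext => t; rewrite !derive1E -deriveD.
Qed.

Lemma CkM k f g : Ck k f -> Ck k g -> Ck k (fun t => f t * g t).
Proof.
elim: k f g => // k IHk f g Cf Cg; have [df C'f] := Cf; have [dg C'g] := Cg.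
split; first by move=> t; exact: derivableM.
rewrite (_ : derive1 _ = fun t => f t * derive1 g t + g t * derive1 f t).
  by apply: CkD; apply: IHk => //; exact: CkS.
by apply/funext => t; rewrite !derive1E deriveM.
Qed.

(** The factor [m] makes the family closed under differentiation, which replaces it by [m * c]. *)
Lemma Ck_affine k f (m c b : R) : Ck k f -> Ck k (fun t => m * f (c * t + b)).
Proof.
elim: k f m => // k IHk f m [df Cf].
have h (t : R) : is_derive t (1 : R) (fun t : R => m * f (c * t + b))
    (m * c * derive1 f (c * t + b)).
  have h1 : is_derive t 1 (fun t : R => c * t + b) c.
    have h : is_derive t 1 ((c *: @id R) + cst b) (c *: 1 + 0).
      by apply: is_deriveD; apply: is_deriveZ.
    by apply: (is_derive_eq h); rewrite addr0 [_ *: _]mulr1.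
  have h2 : is_derive (c * t + b) 1 f (derive1 f (c * t + b)).
    by rewrite derive1E; exact: derivableP.
  have h3 := @is_derive1_comp R f (fun t : R => c * t + b) t _ _ h2 h1.
  have h4 : is_derive t 1 (m *: (f \o (fun t : R => c * t + b)))
      (m *: (derive1 f (c * t + b) * c)).
    exact: is_deriveZ.
  by apply: (is_derive_eq h4); rewrite /GRing.scale/=; ring.
split; first by move=> t; have [] := h t.
rewrite (_ : derive1 _ = fun t => m * c * derive1 f (c * t + b)); first exact: IHk.
by apply/funext => t; rewrite derive1E; have [_ ->] := h t.
Qed.

Lemma Ck_iter k f t : (forall j, Ck j f) -> derivable (iter k (@derive1 R R) f) t 1.
Proof.
move=> Cf; suff : forall j, Ck j (iter k (@derive1 R R) f) by move=> /(_ 1%N)[].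
by elim: k => // k IHk j; have [] := IHk j.+1.
Qed.

(* All derivatives of [flat 1], which is [exp(-1/t)] for positive [t], are of
   this form. *)
Definition flat (p : {poly R}) (t : R) : R :=
  if 0 < t then p.[t^-1] * expR (- t^-1) else 0.

(** Coefficient by coefficient, from [s ^+ i <= i! * expR s], a consequence of the exponential
    series. *)
Lemma horner_le_expR (q : {poly R}) :
  exists2 C, 0 <= C & forall s, 0 <= s -> `|q.[s]| <= C * expR s.
Proof.
exists (\sum_(i < size q) `|q`_i| * (i`!)%:R).
  by apply: sumr_ge0 => i _; rewrite mulr_ge0.
move=> s s0; rewrite horner_coef mulr_suml; apply: le_trans (ler_norm_sum _ _ _) _.
apply: ler_sum => i _; rewrite normrM -mulrA ler_wpM2l//.
rewrite ger0_norm ?exprn_ge0//.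
have fi : 0 < (i`!)%:R :> R by rewrite ltr0n fact_gt0.
case: (val i) fi => [|k] fi.
  rewrite expr0 mul1r; apply: le_trans (expR_ge1Dx s).
  by rewrite lerDl.
rewrite mulrC -ler_pdivrMr//; apply: le_trans (expR_ge1Dxn k s0).
by rewrite lerDr.
Qed.

(** The bound [|q(s)| <= C * expR s] for [q = p * 'X^2] at [s = t^-1]. The quadratic order forces
    the difference quotient of [flat p] at 0 to tend to 0. *)
Lemma flat_quadratic p : exists2 C, 0 <= C & forall t, `|flat p t| <= C * t ^+ 2.
Proof.
have [C C0 CP] := horner_le_expR (p * 'X^2).
exists C => // t; rewrite /flat; case: ifPn => [t0|_]; last first.
  by rewrite normr0 mulr_ge0// sqr_ge0.
have s0 : 0 <= t^-1 by rewrite invr_ge0 ltW.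
have := CP _ s0; rewrite hornerM hornerXn normrM normrX (ger0_norm s0) => h.
rewrite normrM (ger0_norm (expR_ge0 _)) expRN ler_pdivrMr ?expR_gt0// mulrAC.
rewrite -ler_pdivrMr ?exprn_gt0//.
by rewrite -exprVn.
Qed.

(** In the variable [s = t^-1], [p(s) exp(-s)] has derivative [(p' - p)(s) exp(-s)], and [s] has
    derivative [- s ^+ 2] in [t]; hence the polynomial ['X^2 * (p - p')]. *)
Lemma is_derive_flat p (t : R) : is_derive t (1 : R) (flat p) (flat ('X^2 * (p - p^`())) t).
Proof.
have [t0|t0|->] := ltgtP t 0.
- rewrite [X in is_derive _ _ _ X](_ : _ = 0); last first.
    by rewrite /flat ltNge (ltW t0).
  apply: (@near_eq_is_derive _ _ _ (cst (0 : R))).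
  near=> s; rewrite /flat ifF//; apply/negbTE; rewrite -leNgt ltW//.
  by near: s; exact: lt_nbhsl.
- have tn0 : t != 0 by rewrite gt_eqF.
  have h1 : is_derive t 1 (fun s : R => s^-1) (- t ^- 2).
    have h := @is_deriveV R id t 1 1 tn0 (is_derive_id _ _).
    by apply: (is_derive_eq h); rewrite [_ *: _]mulr1.
  have h2 := @is_derive1_comp R (horner p) (fun s : R => s^-1) t _ _
    (is_derive_poly p t^-1) h1.
  have h3 : is_derive t 1 (fun s : R => expR (- s^-1)) (expR (- t^-1) * t ^- 2).
    have h : is_derive t 1 (- (fun s : R => s^-1)) (- (- t ^- 2)) by exact: is_deriveN.
    rewrite opprK in h.
    exact: (@is_derive1_comp R expR (fun s : R => - s^-1) t _ _ (is_derive_expR _) h).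
  have h4 := is_deriveM h2 h3.
  apply: (@near_eq_is_derive _ _ _ (fun s : R => p.[s^-1] * expR (- s^-1))).
    near=> s; rewrite /flat ifT//.
    by near: s; exact: lt_nbhsr.
  apply: (is_derive_eq h4).
  rewrite /flat t0 hornerM hornerXn hornerD hornerN /= /GRing.scale /=.
  by rewrite exprVn; ring.
- rewrite /flat ltxx -/(flat p).
  have [C C0 CP] := flat_quadratic p.
  have p0 : flat p 0 = 0 by rewrite /flat ltxx.
  have cv : h^-1 *: ((flat p \o shift 0) (h *: (1:R)) - flat p 0) @[h --> 0^'] --> (0:R).
    have C1 : 0 < C + 1 by rewrite ltr_wpDl.
    apply/cvgr0Pnorm_lt => e e0; have eC : 0 < e / (C + 1) by exact: divr_gt0.
    near=> h.
    have h0 : h != 0 by near: h; exact: nbhs_dnbhs_neq.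
    rewrite p0 subr0 /= /shift/= addr0 [_ *: 1]mulr1.
    rewrite [_ *: _]/(_ * _) normrM normfV mulrC ltr_pdivrMr ?normr_gt0//.
    apply: le_lt_trans (CP _) _.
    rewrite -sqr_normr expr2 mulrA ltr_pM2r ?normr_gt0//.
    apply: (@le_lt_trans _ _ ((C + 1) * `|h|)).
      by rewrite ler_wpM2r// lerDl.
    by rewrite mulrC -ltr_pdivlMr//; near: h; exact: dnbhs0_lt.
  apply: DeriveDef; first exact: cvgP cv.
  exact: (cvg_lim (@norm_hausdorff _ _) cv).
Unshelve. all: by end_near. Qed.

Lemma Ck_flat k p : Ck k (flat p).
Proof.
elim: k p => // k IHk p; split; first by move=> t; have [] := is_derive_flat p t.
rewrite (_ : derive1 _ = flat ('X^2 * (p - p^`()))) //.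
by apply/funext => t; rewrite derive1E; have [_ ->] := is_derive_flat p t.
Qed.

(** Since [flat 1] tends to 1 at infinity, the dilation by [m.+1] makes these functions converge
    pointwise to the indicator of the open interval while keeping their support. *)
Definition bump (a b : R) (m : nat) (t : R) : R :=
  flat 1 (m.+1%:R * (t - a)) * flat 1 (m.+1%:R * (b - t)).

Lemma flat1E t : flat 1 t = if 0 < t then expR (- t^-1) else 0.
Proof. by rewrite /flat hornerC mul1r. Qed.

Lemma Ck_bump a b m k : Ck k (bump a b m).
Proof.
apply: CkM.
  rewrite (_ : (fun t => _) = fun t => 1 * flat 1 (m.+1%:R * t + (- (m.+1%:R * a)))).
    by apply: Ck_affine; exact: Ck_flat.
  by apply/funext => t; rewrite mul1r mulrBr.
rewrite (_ : (fun t => _) = fun t => 1 * flat 1 (- m.+1%:R * t + m.+1%:R * b)).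
  by apply: Ck_affine; exact: Ck_flat.
by apply/funext => t; rewrite mul1r mulrBr mulNr addrC.
Qed.

Lemma bump_ge0 a b m t : 0 <= bump a b m t.
Proof.
by rewrite /bump !flat1E mulr_ge0//; case: ifP => // _; exact: expR_ge0.
Qed.

Lemma bump_le1 a b m t : bump a b m t <= 1.
Proof.
have h s : 0 <= flat 1 s <= 1.
  rewrite flat1E; case: ifP => [s0|_]; last by rewrite lexx ler01.
  by rewrite expR_ge0 -expR0 ler_expR oppr_le0 invr_ge0 ltW.
rewrite /bump -[leRHS](mulr1 1).
have /andP[h1 h2] := h (m.+1%:R * (t - a)).
have /andP[h3 h4] := h (m.+1%:R * (b - t)).
exact: ler_pM.
Qed.

Lemma bump_neq0 a b m t : bump a b m t != 0 <-> t \in `]a, b[.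
Proof.
have m0 : 0 < m.+1%:R :> R by rewrite ltr0n.
rewrite /bump !flat1E !pmulr_rgt0// !subr_gt0 in_itv/=.
split; last by move=> /andP[-> ->]; rewrite mulf_neq0// gt_eqF// expR_gt0.
by case: ifP => at_; case: ifP => bt; rewrite ?mulr0 ?mul0r ?eqxx.
Qed.

Lemma cvg_bump a b t :
  bump a b m t @[m --> \oo] --> (if t \in `]a, b[ then 1 else 0 : R).
Proof.
case: ifPn => [|tab]; last first.
  rewrite (_ : (fun m => _) = cst 0); first exact: cvg_cst.
  apply/funext => m; apply/eqP; rewrite -[_ == _]negbK; apply/negP.
  by rewrite bump_neq0 => tab'; rewrite tab' in tab.
rewrite in_itv/= => /andP[at_ tb].
have key (d : R) : 0 < d -> flat 1 (m.+1%:R * d) @[m --> \oo] --> (1:R).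
  move=> d0.
  rewrite (_ : (fun m => _) = fun m => expR (- (d^-1 * m.+1%:R^-1))); last first.
    apply/funext => m; rewrite flat1E pmulr_rgt0 ?ltr0n// d0.
    by rewrite invfM mulrC.
  rewrite -[X in _ --> X]expR0.
  apply: continuous_cvg; first exact: continuous_expR.
  rewrite -oppr0; apply: cvgN.
  rewrite -(mulr0 d^-1); apply: cvgM; first exact: cvg_cst.
  exact: cvg_harmonic.
rewrite -[X in _ --> X](mulr1 1).
by apply: cvgM; apply: key; rewrite subr_gt0.
Qed.

End smooth1.

(** * Smooth functions of several variables *)

Section smooth.
Context {R : realType} {n : nat}.
Implicit Types (u v : 'rV[R]_n -> R) (g : 'I_n -> R -> R).

Definition tensor g (v : 'rV[R]_n) : R := \prod_(i < n) g i (v ord0 i).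

Lemma tensor_derive g i (v : 'rV[R]_n) : derivable (g i) (v ord0 i) 1 ->
  derivable (tensor g) v (delta_mx ord0 i) /\
  partial i (tensor g) v =
    tensor (fun j => if j == i then derive1 (g i) else g j) v.
Proof.
move=> dg; set C := \prod_(j < n | j != i) g j (v ord0 j).
have E : (fun h : R => h^-1 *: ((tensor g \o shift v) (h *: delta_mx ord0 i) - tensor g v)) =
    (fun h => C * (h^-1 *: ((g i \o shift (v ord0 i)) (h *: (1 : R)) - g i (v ord0 i)))).
  apply/funext => h; rewrite /tensor /shift /= (bigD1 i)//= [in X in _ - X](bigD1 i)//=.
  rewrite !mxE !eqxx /= (eq_bigr (fun j => g j (v ord0 j))); last first.
    by move=> j ji; rewrite !mxE (negbTE ji) andbF mulr0 add0r.
  by rewrite -/C /GRing.scale/=; ring.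
have cv : (fun h => C * (h^-1 *:
    ((g i \o shift (v ord0 i)) (h *: (1 : R)) - g i (v ord0 i)))) @ 0^' -->
    C * derive1 (g i) (v ord0 i).
  by apply: cvgM; [exact: cvg_cst|rewrite derive1E; exact: dg].
rewrite -E in cv; split; first exact: cvgP cv.
rewrite /partial /derive (cvg_lim (@norm_hausdorff _ _) cv) /tensor (bigD1 i)//= eqxx mulrC.
by congr (_ * _); apply: eq_bigr => j /negbTE ->.
Qed.

Lemma continuous_tensor g : (forall i, continuous (g i)) -> continuous (tensor g).
Proof.
move=> cg; apply: continuous_big; first exact: mul_continuous.
by move=> i _ v; apply: continuous_comp; [exact: continuous_coord_rV|exact: cg].
Qed.

(** An iterated partial derivative of a product of one-variable functions is again such a product,
    with the [i]-th factor differentiated as often as [i] occurs in [s]. *)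
Lemma smooth_tensor g : (forall i k, Ck k (g i)) -> smooth (tensor g).
Proof.
move=> Cg s.
have -> : foldr partial (tensor g) s =
    tensor (fun i => iter (count_mem i s) (@derive1 R R) (g i)).
  elim: s => [//|i s IHs] /=; rewrite IHs; apply/funext => v.
  rewrite (tensor_derive _).2; last exact: Ck_iter.
  by apply: eq_bigr => j _; case: eqVneq => [->|ji]; rewrite ?eqxx//= eq_sym (negbTE ji).
split; last by move=> i x; apply: (tensor_derive _).1; exact: Ck_iter.
apply: continuous_tensor => i t.
by apply: differentiable_continuous; apply/derivable1_diffP; exact: Ck_iter.
Qed.

Lemma smooth_C1 u : smooth u -> C1 u.
Proof.
move=> su; have [cu du] := su [::]; split=> // i; split; first exact: du.
by have [] := su [:: i].
Qed.

Lemma partial_lin (k : R) u v i x :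
  derivable u x (delta_mx ord0 i) -> derivable v x (delta_mx ord0 i) ->
  derivable (k *: u + v) x (delta_mx ord0 i) /\
  partial i (k *: u + v) x = k * partial i u x + partial i v x.
Proof.
move=> du dv; have dku : derivable (k *: u) x (delta_mx ord0 i) := derivableZ du.
have h1 := derivableD dku dv; have h2 := deriveD dku dv.
by rewrite deriveZ// in h2.
Qed.

Lemma smooth_lin (k : R) u v : smooth u -> smooth v -> smooth (k *: u + v).
Proof.
move=> su sv s.
have -> : foldr partial (k *: u + v) s = k *: foldr partial u s + foldr partial v s.
  elim: s => [//|i s IHs] /=; rewrite IHs; apply/funext => x.
  by rewrite (partial_lin _ ((su s).2 _ _) ((sv s).2 _ _)).2.
split; last by move=> i x; apply: (partial_lin _ ((su s).2 _ _) ((sv s).2 _ _)).1.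
move=> x; apply: continuousD; last exact: (sv s).1.
by apply: continuousZr; exact: (su s).1.
Qed.

Lemma smooth0 : smooth (0 : 'rV[R]_n -> R).
Proof.
move=> s; have -> : foldr partial (0 : 'rV[R]_n -> R) s = cst 0.
  by elim: s => [//|i s IHs] /=; rewrite IHs; apply/funext => x; rewrite /partial derive_cst.
by split=> [|i x]; [exact: cst_continuous|exact: derivable_cst].
Qed.

Lemma C1_mul u v : C1 u -> C1 v -> C1 (fun x => u x * v x) /\
  forall i x, partial i (fun x => u x * v x) x = u x * partial i v x + partial i u x * v x.
Proof.
move=> [cu du] [cv dv].
have h i x : partial i (fun x => u x * v x) x = u x * partial i v x + partial i u x * v x.
  rewrite /partial (@deriveM _ _ u v)//; [|exact: (du i).1|exact: (dv i).1].
  by rewrite /GRing.scale/=; ring.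
split=> //; split; first by move=> x; apply: continuousM; [exact: cu|exact: cv].
move=> i; split; first by move=> x; apply: derivableM; [exact: (du i).1|exact: (dv i).1].
rewrite (_ : partial i _ = u \* partial i v \+ partial i u \* v); last first.
  by apply/funext => x; rewrite h.
move=> x; apply: continuousD; apply: continuousM.
- exact: cu.
- exact: (dv i).2.
- exact: (du i).2.
- exact: cv.
Qed.

Lemma partial_outside (A : set 'rV[R]_n) u i x : open A -> A x ->
  (forall y, A y -> u y = 0) -> partial i u x = 0.
Proof.
move=> Ao Ax u0; rewrite /partial (@near_eq_derive _ _ _ _ (cst 0)) ?derive_cst//.
near=> y; apply: u0; near: y; exact: open_nbhs_nbhs.
Unshelve. all: by end_near. Qed.

(** The support is closed and lies inside [Omega], so [u] is zero in a neighbourhood of each point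
    outside [Omega], boundary points included. This is what allows integrals over [Omega] to be
    taken over cubes. *)
Lemma Cc_vanish (Omega : set 'rV[R]_n) u : Cc_infty Omega u ->
  forall x, ~ Omega x -> u x = 0 /\ forall i, partial i u x = 0.
Proof.
move=> [su cu uO] x xO.
have h : open (~` closure [set x | u x != 0]) by apply: closed_openC; exact: closed_closure.
have v0 y : (~` closure [set x | u x != 0]) y -> u y = 0.
  by move=> hy; apply/eqP; apply: contra_notT hy => uy; exact: subset_closure.
have nx : (~` closure [set x | u x != 0]) x by move=> /uO.
by split; [exact: v0|move=> i; exact: (partial_outside _ h nx v0)].
Qed.

Lemma rV_hausdorff : hausdorff_space 'rV[R]_n.
Proof. exact: norm_hausdorff. Qed.

Lemma Cc_lin (Omega : set 'rV[R]_n) (k : R) u v :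
  Cc_infty Omega u -> Cc_infty Omega v -> Cc_infty Omega (k *: u + v).
Proof.
move=> [su cu uO] [sv cv vO].
have sub : closure [set x | (k *: u + v) x != 0] `<=`
    closure [set x | u x != 0] `|` closure [set x | v x != 0].
  rewrite -closureU; apply: closure_subset => x /=.
  have [ux|] := eqVneq (u x) 0; last by left.
  have [vx|] := eqVneq (v x) 0; last by right.
  have -> : (k *: u + v) x = k * u x + v x by [].
  by rewrite ux vx mulr0 addr0 eqxx.
split; first exact: smooth_lin.
  by apply: subclosed_compact (compactU cu cv) sub; exact: closed_closure.
by apply: subset_trans sub _ => x [/uO|/vO].
Qed.

Lemma Cc0 (Omega : set 'rV[R]_n) : Cc_infty Omega 0.
Proof.
have e : closure [set x : 'rV[R]_n | (0 : 'rV[R]_n -> R) x != 0] = set0.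
  rewrite -[RHS]closure0; congr closure.
  by apply/seteqP; split=> x //= /eqP.
by rewrite /Cc_infty /= e; split=> //; [exact: smooth0|exact: compact0].
Qed.

Lemma Cc_subspace (Omega : set 'rV[R]_n) : subspace (Cc_infty Omega).
Proof. by split; [exact: Cc0|move=> k u v; exact: Cc_lin]. Qed.

Definition bumps (a b : 'rV[R]_n) m : 'rV[R]_n -> R :=
  tensor (fun i => bump (a ord0 i) (b ord0 i) m).

Lemma Cc_bumps (Omega : set 'rV[R]_n) (a b : 'rV[R]_n) m :
  [set v : 'rV[R]_n | forall i, v ord0 i \in `[a ord0 i, b ord0 i] ] `<=` Omega ->
  Cc_infty Omega (bumps a b m).
Proof.
set K := [set v : 'rV[R]_n | _] => KO.
have cK : compact K.
  apply: (@rV_compact _ _ (fun i => [set` `[a ord0 i, b ord0 i]])) => i.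
  exact: segment_compact.
have sub : closure [set x | bumps a b m x != 0] `<=` K.
  rewrite [X in _ `<=` X](iffLR (closure_id _) (compact_closed rV_hausdorff cK)).
  apply: closure_subset => x /= hx i.
  suff /bump_neq0 : bump (a ord0 i) (b ord0 i) m (x ord0 i) != 0.
    by rewrite !in_itv/= => /andP[/ltW -> /ltW ->].
  by apply: contra_neq hx => h; rewrite /bumps /tensor (bigD1 i)//= h mul0r.
split; first by apply: smooth_tensor => i k; exact: Ck_bump.
  by apply: subclosed_compact cK sub; exact: closed_closure.
exact: subset_trans sub KO.
Qed.

Lemma bumps_01 (a b : 'rV[R]_n) m x : 0 <= bumps a b m x <= 1.
Proof.
by apply/andP; split; [apply: prodr_ge0 => i _; exact: bump_ge0|
  apply: prodr_ile1 => i _; rewrite bump_ge0 bump_le1].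
Qed.

Definition obox (a b : 'rV[R]_n) : set 'rV[R]_n :=
  [set v | forall i, v ord0 i \in `]a ord0 i, b ord0 i[ ].

Lemma cvg_bumps (a b : 'rV[R]_n) x :
  bumps a b m x @[m --> \oo] --> (\1_(obox a b) x : R).
Proof.
have -> : \1_(obox a b) x =
    \prod_(i < n) (if x ord0 i \in `]a ord0 i, b ord0 i[ then 1 else 0) :> R.
  rewrite indicE; case: (pselect (obox a b x)) => h.
    by rewrite mem_set// big1// => i _; rewrite h.
  have [i hi] := (existsNP _).2 h.
  by rewrite memNset// (bigD1 i)//= (negbTE (introN idP hi)) mul0r.
by apply: cvg_big => [|i _]; [exact: mul_continuous|exact: cvg_bump].
Qed.

End smooth.

(** * Square integrable functions *)

Section square_integrable.
Context {R : realType} d {T : measurableType d}.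
Variables (mu : {measure set T -> \bar R}) (D : set T).
Hypothesis mD : measurable D.
Implicit Types u v w : T -> R.
Local Notation integrable f := (mu.-integrable D (EFin \o f)).

(* [L2 Omega] of the statement is [sqint lebesgue_rV Omega] by conversion. *)
Definition sqint u := measurable_fun D u /\
  (\int[mu]_(x in D) (u x ^+ 2)%:E < +oo)%E.

Definition ip u v : R := \int[mu]_(x in D) (u x * v x).

Lemma sqint_integrable_sqr u : sqint u -> integrable (fun x => u x ^+ 2).
Proof.
move=> [mu_ ui]; apply/integrableP; split.
  by apply/measurable_EFinP; exact: measurable_funX.
by under eq_integral do rewrite /= ger0_norm ?sqr_ge0//.
Qed.

Lemma integrable_sqr_sqint u : measurable_fun D u ->
  integrable (fun x => u x ^+ 2) -> sqint u.
Proof.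
move=> mu_ /integrableP[_ h]; split=> //.
by under eq_integral do rewrite -[_ ^+ 2]ger0_norm ?sqr_ge0//.
Qed.

Lemma sqint_integrable u v : sqint u -> sqint v -> integrable (fun x => u x * v x).
Proof.
move=> Lu Lv.
have iuv := integrableDR mD (sqint_integrable_sqr Lu) (sqint_integrable_sqr Lv).
apply: le_integrable iuv => //.
  apply/measurable_EFinP; apply: measurable_funM; [exact: Lu.1|exact: Lv.1].
move=> x Dx /=; rewrite lee_fin normrM [leRHS]ger0_norm ?addr_ge0 ?sqr_ge0//.
rewrite -(sqr_normr (u x)) -(sqr_normr (v x)).
move: (`|u x|) (`|v x|) (normr_ge0 (u x)) (normr_ge0 (v x)) => a b a0 b0; nra.
Qed.

Lemma sqint_lin (k : R) u v : sqint u -> sqint v -> sqint (k *: u + v).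
Proof.
move=> Lu Lv; have [mu_ _] := Lu; have [mv _] := Lv.
have m : measurable_fun D (k *: u + v).
  by apply: measurable_funD => //; exact: measurable_funM.
apply: integrable_sqr_sqint => //.
have i1 := integrableZR mD (k ^+ 2) (sqint_integrable_sqr Lu).
have i2 := integrableZR mD (2 * k) (sqint_integrable Lu Lv).
have i3 := integrableDR mD (integrableDR mD i1 i2) (sqint_integrable_sqr Lv).
apply: eq_integrable i3 => // x _ /=; congr EFin.
have -> : (k *: u + v) x = k * u x + v x by [].
by ring.
Qed.

Lemma sqint0 : sqint 0.
Proof.
apply: integrable_sqr_sqint; first exact: measurable_cst.
apply: eq_integrable (@integrable0 _ _ _ mu D) => // x _ /=.
by rewrite expr0n.
Qed.

Lemma sqint_subspace : subspace sqint.
Proof. by split; [exact: sqint0|exact: sqint_lin]. Qed.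

Lemma ip_lin (k : R) u v w : sqint u -> sqint v -> sqint w ->
  ip (k *: u + v) w = k * ip u w + ip v w.
Proof.
move=> Lu Lv Lw; have iu := sqint_integrable Lu Lw.
rewrite /ip -RintegralZl// -RintegralD//; last 2 first.
- exact: integrableZR.
- exact: sqint_integrable.
apply: eq_Rintegral => x _.
have -> : (k *: u + v) x = k * u x + v x by [].
by ring.
Qed.

Lemma ipC u v : ip u v = ip v u.
Proof. by apply: eq_Rintegral => x _; rewrite mulrC. Qed.

Lemma ip_ge0 u : 0 <= ip u u.
Proof. by apply: Rintegral_ge0 => x _; rewrite -expr2 sqr_ge0. Qed.

Lemma ip_psd : psd_form sqint ip.
Proof.
split=> [u v _ _|k u v w|u _]; [exact: ipC|exact: ip_lin|exact: ip_ge0].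
Qed.

Lemma ip_sqr u : sqint u -> (\int[mu]_(x in D) (u x ^+ 2)%:E)%E = (ip u u)%:E.
Proof.
move=> Lu; rewrite /ip /Rintegral fineK.
  by apply: eq_integral => x _; rewrite expr2.
by apply: integrable_fin_num => //; exact: sqint_integrable.
Qed.

Lemma ip_eq0 u : sqint u -> ip u u = 0 -> \forall x \ae mu, D x -> u x = 0.
Proof.
move=> Lu u0; have h := ip_sqr Lu; rewrite u0 in h.
have m : measurable_fun D (EFin \o (fun x => u x ^+ 2)).
  by apply: measurable_int (sqint_integrable_sqr Lu).
have h' : (\int[mu]_(x in D) `|(u x ^+ 2)%:E| = 0)%E.
  by apply: (etrans _ h); apply: eq_integral => x _ /=; rewrite ger0_norm ?sqr_ge0.
have := (ae_eq_integral_abs mu mD m).1 h'.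
apply: filterS => x /= hx Dx; have [/eqP] := hx Dx.
by rewrite sqrf_eq0 => /eqP.
Qed.

Lemma ae_eq_Rintegral (f g : T -> R) : measurable_fun D f -> measurable_fun D g ->
  (\forall x \ae mu, D x -> f x = g x) ->
  \int[mu]_(x in D) f x = \int[mu]_(x in D) g x.
Proof.
move=> mf mg fg; congr fine; apply: ae_eq_integral => //.
- exact/measurable_EFinP.
- exact/measurable_EFinP.
- by apply: filterS fg => x h Dx; rewrite h.
Qed.

(** * Completeness of L^2 (Riesz-Fischer) *)

Section complete.
Variable v : nat -> T -> R.
Hypothesis Lv : forall k, sqint (v k).
Hypothesis cv : forall k, ip (v k.+1 - v k) (v k.+1 - v k) <= 4^-1 ^+ k.

Let LB u w : sqint u -> sqint w -> sqint (u - w).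
Proof. exact: subspaceB sqint_subspace. Qed.

Let ip0 : ip 0 0 = 0.
Proof. by apply: Rintegral0_eq => x _; rewrite mul0r. Qed.

Let N u := Num.sqrt (ip u u).

Let quarter_expr k : 4^-1 ^+ k = (2^-1 ^+ k) ^+ 2 :> R.
Proof. by rewrite -exprM mulnC exprM; congr (_ ^+ k); field. Qed.

Let N_step k : N (v k.+1 - v k) <= 2^-1 ^+ k.
Proof.
have -> : 2^-1 ^+ k = Num.sqrt (4^-1 ^+ k) :> R.
  by rewrite quarter_expr sqrtr_sqr ger0_norm// exprn_ge0.
exact: ler_wsqrtr.
Qed.

(** The subtracted term is the tail of the geometric series; it makes the induction on [m] close and
    is dropped afterwards. *)
Let N_cauchy k m : N (v (k + m)%N - v k) <= 2 * 2^-1 ^+ k - 2 * 2^-1 ^+ (k + m).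
Proof.
elim: m => [|m IHm].
  by rewrite addn0 !subrr /N ip0 sqrtr0.
rewrite addnS.
have -> : v (k + m).+1 - v k = (v (k + m).+1 - v (k + m)%N) + (v (k + m)%N - v k).
  by rewrite addrA subrK.
apply: le_trans (psd_form_sqrtD sqint_subspace ip_psd (LB (Lv _) (Lv _)) (LB (Lv _) (Lv _))) _.
rewrite -/(N _) -/(N (v (k + m)%N - v k)).
have := N_step (k + m).
have : 2^-1 ^+ (k + m).+1 = 2^-1 * 2^-1 ^+ (k + m) :> R by rewrite exprS.
by lra.
Qed.

Let ip_cauchy k m : ip (v (k + m)%N - v k) (v (k + m)%N - v k) <= 4 * 4^-1 ^+ k.
Proof.
have h : N (v (k + m)%N - v k) <= 2 * 2^-1 ^+ k.
  apply: le_trans (N_cauchy k m) _; rewrite lerBlDr lerDl mulr_ge0// exprn_ge0//.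
have -> : 4 * 4^-1 ^+ k = (2 * 2^-1 ^+ k) ^+ 2 :> R.
  by rewrite quarter_expr; ring.
by rewrite -[leLHS](sqr_sqrtr (ip_ge0 _)) ler_sqr// nnegrE ?sqrtr_ge0.
Qed.

Let a k x := `|v k.+1 x - v k x|.
Let G n x := \sum_(k < n) a k x.

Let La k : sqint (a k).
Proof.
have [mB _] := LB (Lv k.+1) (Lv k).
apply: integrable_sqr_sqint; first exact: measurableT_comp.
have := sqint_integrable_sqr (LB (Lv k.+1) (Lv k)).
by apply: eq_integrable => // x _; rewrite /= /a sqr_normr.
Qed.

Let LG n : sqint (G n).
Proof.
elim: n => [|n IHn].
  rewrite (_ : G 0 = 0); first exact: sqint0.
  by apply/funext => x; rewrite /G big_ord0.
rewrite (_ : G n.+1 = G n + a n); last by apply/funext => x; rewrite /G big_ord_recr.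
exact: (subspaceD sqint_subspace).
Qed.

Let NG n : N (G n) <= 2 - 2 * 2^-1 ^+ n.
Proof.
elim: n => [|n IHn].
  rewrite (_ : G 0 = 0); last by apply/funext => x; rewrite /G big_ord0.
  by rewrite /N ip0 sqrtr0 expr0 mulr1 subrr.
rewrite (_ : G n.+1 = G n + a n); last by apply/funext => x; rewrite /G big_ord_recr.
apply: le_trans (psd_form_sqrtD sqint_subspace ip_psd (LG _) (La _)) _.
have Na : ip (a n) (a n) = ip (v n.+1 - v n) (v n.+1 - v n).
  by apply: eq_Rintegral => x _; rewrite -!expr2 /a sqr_normr.
rewrite Na -/(N _) -/(N (v n.+1 - v n)).
have := N_step n; have : 2^-1 ^+ n.+1 = 2^-1 * 2^-1 ^+ n :> R by rewrite exprS.
by lra.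
Qed.

Let a_ge0 k x : 0 <= a k x. Proof. exact: normr_ge0. Qed.
Let G_ge0 k x : 0 <= G k x. Proof. by apply: sumr_ge0 => i _; exact: a_ge0. Qed.
Let G_nd x : {homo G^~ x : m n / (m <= n)%N >-> m <= n}.
Proof.
apply: (@homo_leq _ _ (fun a b => a <= b)) => [y //|y z w|n]; first exact: le_trans.
by rewrite /G big_ord_recr/= lerDl.
Qed.

Let mG n : measurable_fun D (fun x => (G n x ^+ 2)%:E).
Proof. exact: measurable_int (sqint_integrable_sqr (LG n)). Qed.

Let G2_nd x : {homo (fun n => (G n x ^+ 2)%:E) : m n / (m <= n)%N >-> (m <= n)%E}.
Proof. by move=> m n mn; rewrite lee_fin ler_sqr ?nnegrE//; exact: G_nd. Qed.

(** The norms of the sums [G n] stay below 2. By monotone convergence the limit of their squares has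
    integral at most 4, so it is finite almost everywhere. *)
Let G_bounded : \forall x \ae mu, D x -> cvgn (fun n => G n x).
Proof.
have h := monotone_convergence mu mD mG (fun n x _ => sqr_ge0 (G n x)) (fun x _ => @G2_nd x).
have h2 : (\int[mu]_(x in D) limn (fun n => (G n x ^+ 2)%:E) <= 4%:E)%E.
  rewrite h; apply: lime_le.
    apply: ereal_nondecreasing_is_cvgn => m n mn.
    by apply: ge0_le_integral => // x _; [rewrite lee_fin sqr_ge0|exact: G2_nd].
  near=> n; rewrite ip_sqr// lee_fin.
  have h3 : N (G n) <= 2.
    by apply: le_trans (NG n) _; rewrite lerBlDr lerDl mulr_ge0// exprn_ge0.
  rewrite -[leLHS](sqr_sqrtr (ip_ge0 _)) (_ : 4 = 2 ^+ 2); last by ring.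
  by rewrite ler_sqr ?nnegrE ?sqrtr_ge0.
have ml : measurable_fun D (fun x => limn (fun n => (G n x ^+ 2)%:E)).
  apply: emeasurable_fun_cvg mG _ => x _.
  by apply: ereal_nondecreasing_is_cvgn; exact: G2_nd.
have l0 x : (0 <= limn (fun n => (G n x ^+ 2)%:E))%E.
  apply: lime_ge; first by apply: ereal_nondecreasing_is_cvgn; exact: G2_nd.
  by near=> n; rewrite lee_fin sqr_ge0.
have il : mu.-integrable D (fun x => limn (fun n => (G n x ^+ 2)%:E)).
  apply/integrableP; split=> //.
  under eq_integral do rewrite gee0_abs//.
  by apply: le_lt_trans h2 _; rewrite ltry.
have := integrable_ae mD il; apply: filterS => x /= hx Dx.
have {hx} := hx Dx; rewrite ge0_fin_numE// => lx.
apply: nondecreasing_is_cvgn; first exact: G_nd.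
exists (fine (limn (fun n => (G n x ^+ 2)%:E)) + 1) => _ [n _ <-].
have h4 : G n x ^+ 2 <= fine (limn (fun n => (G n x ^+ 2)%:E)).
  rewrite -lee_fin fineK ?ge0_fin_numE//.
  apply: lime_ge; first by apply: ereal_nondecreasing_is_cvgn; exact: G2_nd.
  by near=> m; apply: G2_nd; near: m; exact: nbhs_infty_ge.
have := G_ge0 n x; move: (G n x) (fine _) h4 => y z h4 y0; nra.
Unshelve. all: by end_near. Qed.

Let v_cvg : \forall x \ae mu, D x -> cvgn (fun n => v n x).
Proof.
apply: filterS G_bounded => x hx Dx.
have cs : cvgn (series (fun k => v k.+1 x - v k x)).
  apply: normed_cvg; have := hx Dx.
  rewrite (_ : (fun n => G n x) = (fun n => \sum_(0 <= k < n) `|v k.+1 x - v k x|))//.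
  by apply/funext => n; rewrite big_mkord.
have e : (fun n => v n x) = (fun n => v 0 x + series (fun k => v k.+1 x - v k x) n).
  apply/funext => n; rewrite /series/= telescope_sumr// addrC subrK//.
rewrite e; apply: is_cvgD => //; exact: is_cvg_cst.
Qed.

Lemma sqint_complete : exists2 w, sqint w &
  forall e, 0 < e -> exists k0, forall k, (k0 <= k)%N -> ip (w - v k) (w - v k) <= e.
Proof.
(* The upper limit is measurable whether or not the sequence converges; where it converges, that is
   almost everywhere, it is the limit. *)
pose w x := fine (limn_esup (fun n => (v n x)%:E)).
have mw : measurable_fun D w.
  apply: measurableT_comp; first exact: fine_measurable.
  apply: measurable_fun_limn_esup => n; apply/measurable_EFinP; exact: (Lv n).1.
have wlim : \forall x \ae mu, D x -> v n x @[n --> \oo] --> w x.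
  apply: filterS v_cvg => x hx Dx; have := hx Dx => /cvg_ex[l vl].
  rewrite (_ : w x = l)//.
  have h : (v n x)%:E @[n --> \oo] --> l%:E by apply: cvg_EFin => //; near do by [].
  by rewrite /w (cvg_limn_einf_sup h).2.
have mvk k m : measurable_fun D (fun x => ((v (k + m)%N x - v k x) ^+ 2)%:E).
  exact: measurable_int (sqint_integrable_sqr (LB (Lv _) (Lv _))).
have mwk k : measurable_fun D (fun x => ((w x - v k x) ^+ 2)%:E).
  apply/measurable_EFinP; apply: measurable_funX; apply: measurable_funB => //.
  exact: (Lv k).1.
(* Fatou's lemma along [v (k + m)], with [m] tending to infinity and [k] fixed: the Cauchy estimate
   passes to the limit [w]. *)
have key k : (\int[mu]_(x in D) ((w x - v k x) ^+ 2)%:E <= (4 * 4^-1 ^+ k)%:E)%E.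
  have F := fatou mu mD (mvk k) (fun n x _ => sqr_ge0 (v (k + n)%N x - v k x)).
  apply: le_trans (le_trans F _).
    rewrite le_eqVlt; apply/orP; left; apply/eqP; apply: ae_eq_integral => //.
      rewrite /limn_einf; apply: (measurableT_comp (f := @oppe R)) => //.
      by apply: measurable_fun_limn_esup => n; exact: measurableT_comp.
    apply: filterS wlim => x hx Dx.
    suff h : ((v (k + m)%N x - v k x) ^+ 2)%:E @[m --> \oo] --> ((w x - v k x) ^+ 2)%:E.
      by rewrite (cvg_limn_einf_sup h).1.
    apply: cvg_EFin; first by near do by [].
    have h1 : v (k + m)%N x - v k x @[m --> \oo] --> w x - v k x.
      apply: cvgB; last exact: cvg_cst.
      exact: (cvg_comp _ _ (cvg_addnl k) (hx Dx)).
    by under eq_fun do rewrite /= expr2; rewrite expr2; exact: cvgM.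
  rewrite limn_einf_lim; apply: lime_le; first exact: is_cvg_einfs.
  near=> n; apply: ereal_inf_le.
  exists (\int[mu]_(x in D) ((v (k + n)%N x - v k x) ^+ 2)%:E)%E.
    by exists n => //=.
  by rewrite (ip_sqr (LB (Lv (k + n)%N) (Lv k))) lee_fin ip_cauchy.
have Lwk k : sqint (w - v k).
  split; first by apply: measurable_funB => //; exact: (Lv k).1.
  by apply: le_lt_trans (key k) _; rewrite ltry.
exists w.
  by rewrite -[w](subrK (v 0)); exact: (subspaceD sqint_subspace).
move=> e e0.
have : 4 * 4^-1 ^+ k @[k --> \oo] --> (4 * 0 : R).
  by apply: cvgM; [exact: cvg_cst|apply: cvg_expr; rewrite ger0_norm// invf_lt1// ltr1n].
rewrite mulr0 => /cvgr0Pnorm_lt/(_ e e0)[k0 _ hk0]; exists k0 => k kk0.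
rewrite -lee_fin -ip_sqr//; apply: le_trans (key k) _.
rewrite lee_fin; apply: ltW; apply: le_lt_trans (ler_norm _) _; exact: hk0.
Unshelve. all: by end_near. Qed.

End complete.
End square_integrable.

(** * The fundamental lemma of the calculus of variations *)

Section fundamental_lemma.
Context {R : realType} {n : nat}.
Local Notation mu := (@lebesgue_rV R n).

Definition oboxes : set (set 'rV[R]_n) := [set B | exists a b, B = obox a b].

Lemma open_obox (a b : 'rV[R]_n) : open (obox a b).
Proof.
rewrite openE => v vab; rewrite /interior.
have h : \forall w \near v, forall i, (w : 'rV[R]_n) ord0 i \in `]a ord0 i, b ord0 i[.
  apply: (@filter_forall _ _
    (fun i (w : 'rV[R]_n) => w ord0 i \in `]a ord0 i, b ord0 i[) (nbhs v)) => i.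
  have cv := @continuous_coord_rV R n i v.
  exact: (cv _ (near_in_itvoo (vab i))).
exact: h.
Qed.

Lemma rat_ball_obox (q : 'rV[rat]_n * nat) :
  @rat_ball R n q = obox (\row_i (ratr (q.1 ord0 i) - q.2.+1%:R^-1))
    (\row_i (ratr (q.1 ord0 i) + q.2.+1%:R^-1)).
Proof.
by apply/seteqP; split=> v h i; have := h i; rewrite !mxE in_itv/= ltr_distlC.
Qed.

Lemma oboxI (a b a' b' : 'rV[R]_n) : obox a b `&` obox a' b' =
  obox (\row_i Num.max (a ord0 i) (a' ord0 i)) (\row_i Num.min (b ord0 i) (b' ord0 i)).
Proof.
apply/seteqP; split=> v.
  move=> [h h'] i; have := h i; have := h' i.
  rewrite !mxE !in_itv/= gt_max lt_min.
  by move=> /andP[-> ->] /andP[-> ->].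
move=> h; split=> i; have := h i;
  by rewrite !mxE !in_itv/= gt_max lt_min => /andP[/andP[? ?] /andP[? ?]]; apply/andP.
Qed.

Lemma oboxes_setI : setI_closed oboxes.
Proof. by move=> _ _ [a [b ->]] [a' [b' ->]]; rewrite oboxI; eexists; eexists. Qed.

(** The coordinate sigma-algebra is exchanged for one generated by a family stable under
    intersection, as Dynkin induction requires. *)
Lemma measurable_oboxes : @measurable _ 'rV[R]_n = <<s oboxes >>.
Proof.
apply/seteqP; split; last first.
  apply: smallest_sub; first exact: sigma_algebra_measurable.
  by move=> _ [a [b ->]]; apply: open_measurable_rV; exact: open_obox.
have sO (A : set 'rV[R]_n) : open A -> <<s oboxes >> A.
  move=> Ao.
  rewrite (_ : A = \bigcup_q (if `[< @rat_ball R n q `<=` A >] then rat_ball q else set0)).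
    apply: (@countable_bigcupT_measurable _ (g_sigma_algebraType oboxes)) => // q.
    case: ifP => // _; apply: sub_sigma_algebra; rewrite rat_ball_obox.
    by eexists; eexists; reflexivity.
  apply/seteqP; split=> [x Ax|x [q _]].
    have [q [qx qA]] := open_rat_ball Ao Ax; exists q => //; rewrite asboolT//.
    exact: subset_trans (@rat_ball_cball _ _ q) qA.
  by case: asboolP => // qA; exact: qA.
have mc (i : 'I_n) : measurable_fun [set: g_sigma_algebraType oboxes]
    (fun v : g_sigma_algebraType oboxes => (v : 'rV[R]_n) ord0 i).
  apply: (measurability _ (measurable_realfun.RGenOInfty.measurableE R)).
  move=> _ [_ [x ->] <-]; rewrite setTI; apply: sO.
  by have /continuousP := @continuous_coord_rV R n i; apply; exact: rray_open.
apply: smallest_sub; first exact: smallest_sigma_algebra.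
move=> A; rewrite -bigcup_seq => -[i _ [B mB <-]].
by have := mc i measurableT B mB; rewrite !setTI.
Qed.

Variables (Omega : set 'rV[R]_n) (g : 'rV[R]_n -> R).
Hypothesis Omega_open : open Omega.
Hypothesis ig : mu.-integrable Omega (EFin \o g).
Hypothesis g0 : forall psi, Cc_infty Omega psi ->
  \int[mu]_(x in Omega) (g x * psi x) = 0.

Let mO : measurable Omega. Proof. exact: open_measurable_rV. Qed.

Definition cbox (a b : 'rV[R]_n) : set 'rV[R]_n :=
  [set v | forall i, v ord0 i \in `[a ord0 i, b ord0 i] ].

Lemma obox_cbox (a b : 'rV[R]_n) : obox a b `<=` cbox a b.
Proof.
by move=> v h i; have := h i; rewrite !in_itv/= => /andP[/ltW -> /ltW ->].
Qed.

Lemma continuous_bumps (a b : 'rV[R]_n) m : continuous (bumps a b m).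
Proof.
have : smooth (bumps a b m) by apply: smooth_tensor => i k; exact: Ck_bump.
by move=> /(_ [::])[].
Qed.

(** The bumps on the box are admissible test functions with values in [0, 1] that converge to the
    indicator of the box; dominated convergence applies with bound [|g|]. *)
Let int_obox a b : cbox a b `<=` Omega -> (\int[mu]_(x in obox a b) (g x)%:E = 0)%E.
Proof.
move=> abO.
have mB : measurable (obox a b) by apply: open_measurable_rV; exact: open_obox.
have mg : measurable_fun Omega g by apply/measurable_EFinP; exact: measurable_int ig.
have mb m : measurable_fun Omega (bumps a b m).
  by apply: measurable_funTS; apply: continuous_measurable_rV; exact: continuous_bumps.
have ib m : mu.-integrable Omega (EFin \o (fun x => g x * bumps a b m x)).
  apply: le_integrable ig => //.
    by apply/measurable_EFinP; exact: measurable_funM.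
  move=> x _ /=; rewrite lee_fin normrM ler_piMr//.
  by have /andP[h1 h2] := bumps_01 a b m x; rewrite ger0_norm.
have int0 m : (\int[mu]_(x in Omega) (g x * bumps a b m x)%:E = 0)%E.
  have := g0 (Cc_bumps m abO); rewrite /Rintegral => h.
  rewrite -[LHS]fineK; first by rewrite h.
  exact: integrable_fin_num (ib m).
have iabs : mu.-integrable Omega (fun x => `|(g x)%:E|%E) by exact: integrable_abse ig.
have cv := @dominated_cvg _ _ _ mu Omega mO
  (fun m x => (g x * bumps a b m x)%:E)
  (fun x => (g x * (\1_(obox a b) x : R))%:E) (fun x => `|(g x)%:E|%E).
have {cv} : (\int[mu]_(x in Omega) (g x * bumps a b m x)%:E)%E @[m --> \oo] -->
    (\int[mu]_(x in Omega) (g x * (\1_(obox a b) x : R))%:E)%E.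
  apply: cv => //.
  - by move=> m; apply/measurable_EFinP; exact: measurable_funM.
  - move=> x _; apply: cvg_EFin; first by near do by [].
    by apply: cvgM; [exact: cvg_cst|exact: cvg_bumps].
  - move=> m x _; rewrite abse_EFin lee_fin normrM ler_piMr//.
    by have /andP[h1 h2] := bumps_01 a b m x; rewrite ger0_norm.
under eq_fun do rewrite int0.
move=> /(cvg_lim (@ereal_hausdorff R)); rewrite lim_cst; last exact: ereal_hausdorff.
move=> h.
rewrite -[obox a b](setIidr (subset_trans (@obox_cbox a b) abO)) integral_mkcondr.
rewrite [RHS]h; apply: eq_integral => x _.
by rewrite /patch indicE; case: ifP => _; rewrite ?mulr1 ?mulr0.
Unshelve. all: by end_near. Qed.

(** By Dynkin induction from boxes to all measurable [S]. Intersecting with a fixed box inside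
    [Omega] puts the whole space into the class, by [int_obox], and keeps [g] integrable. *)
Let int_meas a b (S : set 'rV[R]_n) : cbox a b `<=` Omega -> measurable S ->
  (\int[mu]_(x in obox a b `&` S) (g x)%:E = 0)%E.
Proof.
move=> abO.
have mB : measurable (obox a b) by apply: open_measurable_rV; exact: open_obox.
have sub S' : obox a b `&` S' `<=` Omega.
  by move=> x [h _]; apply: abO; exact: obox_cbox.
have mg S' : measurable S' -> measurable_fun (obox a b `&` S') (EFin \o g).
  move=> mS'; apply: measurable_funS (measurable_int _ ig) => //.
rewrite measurable_oboxes.
apply: (@dynkin_induction _ 'rV[R]_n oboxes
  (fun S => (\int[mu]_(x in obox a b `&` S) (g x)%:E = 0)%E)).
- exact: measurable_oboxes.
- exact: oboxes_setI.
- by rewrite setIT; exact: int_obox.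
- move=> _ [a' [b' ->]].
  rewrite oboxI; apply: int_obox; apply: subset_trans abO => v h i.
  have := h i; rewrite !mxE !in_itv/= ge_max le_min.
  by move=> /andP[/andP[-> _] /andP[-> _]].
- move=> S' mS' h; have mBS : measurable (obox a b `&` S') by exact: measurableI.
  have mBC : measurable (obox a b `&` ~` S').
    by apply: measurableI => //; exact: measurableC.
  have := int_obox abO; rewrite -[obox a b in X in X -> _](setIT) -(setvU S') setIUr.
  rewrite integral_setU//; first by rewrite h adde0.
    by rewrite -setIUr; apply: mg; exact: measurableU (measurableC mS') mS'.
  by apply/disj_setPS => x [[_ h1] [_ h2]].
- move=> F mF tF hF; rewrite setI_bigcupr integral_bigcup.
  + by apply: eseries0 => i _ _; exact: hF.
  + by apply: trivIset_setIl.
  + by move=> k; exact: measurableI.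
  + rewrite -setI_bigcupr; apply: integrableS ig => //.
    by apply: measurableI => //; exact: bigcup_measurable.
Qed.

Let ae_obox a b : cbox a b `<=` Omega -> \forall x \ae mu, obox a b x -> g x = 0.
Proof.
move=> abO.
have mB : measurable (obox a b) by apply: open_measurable_rV; exact: open_obox.
have BO : obox a b `<=` Omega by apply: subset_trans abO; exact: obox_cbox.
have iB : mu.-integrable (obox a b) (EFin \o g) by exact: integrableS ig.
have := @integral_ae_eq _ _ _ mu (obox a b) mB (cst 0%E) _ iB (measurable_cst _).
move=> h; apply: filterS (h _); first by move=> x hx Bx; have [] := hx Bx.
move=> E EB mE; rewrite integral0 -(setIidr EB); exact: int_meas.
Qed.

Theorem fundamental_lemma : \forall x \ae mu, Omega x -> g x = 0.
Proof.
(* Enumerating the rational balls makes the exceptional set a countable union of null sets. Codes of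
   no ball, and balls whose closure is not inside [Omega], impose nothing. *)
pose P k x := if @unpickle ('rV[rat]_n * nat)%type k is Some q then
  @rat_cball R n q `<=` Omega -> rat_ball q x -> g x = 0 else True.
have h : \forall x \ae mu, forall k, P k x.
  apply: ae_foralln => k; rewrite /P; case: unpickle => [q|]; last exact: aeW.
  have [qO|qO] := pselect (@rat_cball R n q `<=` Omega); last exact: aeW.
  rewrite rat_ball_obox; apply: filterS (ae_obox _) => [x hx _|]; first exact: hx.
  apply: subset_trans qO => v hv i; have := hv i.
  by rewrite !mxE in_itv/= ler_distlC.
apply: filterS h => x hx Ox.
have [q [qx qO]] := open_rat_ball Omega_open Ox.
by have := hx (pickle q); rewrite /P pickleK; apply.
Qed.

End fundamental_lemma.

(** * Sobolev spaces *)

Lemma lin_approx {R : realFieldType} (k e x y z : R) : 0 <= k -> 0 <= x ->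
  x < e / (2 * (k + 1)) -> y < e / 2 -> z <= k * x + y -> z < e.
Proof.
move=> k0 x0; rewrite ltr_pdivlMr; last by rewrite mulr_gt0// ltr_wpDl.
by move=> hx hy hz; apply: le_lt_trans hz _; nra.
Qed.

(** The intervals are open so that the faces of the cube miss [Omega]: test functions vanish on them
    and integration by parts leaves no boundary term. *)
Lemma bounded_obox {R : realType} n (Omega : set 'rV[R]_n) : bounded_set Omega ->
  exists (a : 'rV[R]_n) (e : R), 0 < e /\
    forall x, Omega x -> forall i, x ord0 i \in `]a ord0 i, a ord0 i + e[.
Proof.
move=> [M [_ bM]]; pose M1 := `|M| + 1.
have MM1 : M < M1 by rewrite /M1 (le_lt_trans (ler_norm M))// ltrDl.
have M10 : 0 < M1 + 1 by rewrite /M1 addr_gt0// ltr_wpDl.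
exists (const_mx (- (M1 + 1))), (2 * (M1 + 1)); split; first by rewrite mulr_gt0.
move=> x Ox i; have xM : ball (0 : 'rV[R]_n) (M1 + 1) x.
  rewrite -ball_normE /ball_/= sub0r normrN.
  by apply: le_lt_trans (bM _ MM1 _ Ox) _; rewrite ltrDl.
have := (rV_ballP _ _ M10).1 xM i.
rewrite !mxE sub0r normrN ltr_norml in_itv/= => /andP[h1 h2].
by apply/andP; split=> //; lra.
Qed.

Section sobolev.
Context {R : realType} {n : nat}.
Variables (Omega : set 'rV[R]_n) (a0 : 'rV[R]_n) (e0 : R).
Hypothesis Omega_open : open Omega.
Hypothesis e0_gt0 : 0 < e0.
Hypothesis Omega_cube :
  forall x, Omega x -> forall i, x ord0 i \in `]a0 ord0 i, a0 ord0 i + e0[.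
Implicit Types (u v g psi : 'rV[R]_n -> R).
Local Notation mu := (@lebesgue_rV R n).
Local Notation ip := (ip mu Omega).

Lemma measurable_Omega : measurable Omega. Proof. exact: open_measurable_rV. Qed.
Let mO := measurable_Omega.

Lemma Omega_sub_cube : Omega `<=` cube a0 e0.
Proof.
by move=> x Ox i; have := Omega_cube Ox i; rewrite !in_itv/= => /andP[/ltW -> ->].
Qed.

Lemma continuous_L2 u : continuous u -> L2 Omega u.
Proof.
move=> cu; have m : measurable_fun Omega u.
  by apply: measurable_funTS; exact: continuous_measurable_rV.
apply: (@integrable_sqr_sqint _ _ _ mu Omega u m).
have := integrable_cube a0 (ltW e0_gt0) (continuous_sqr cu).
by apply: integrableS => //; [exact: measurable_cube|exact: Omega_sub_cube].
Qed.

Lemma L2_mul_integrable u v : L2 Omega u -> L2 Omega v ->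
  mu.-integrable Omega (EFin \o (fun x => u x * v x)).
Proof. exact: (@sqint_integrable _ _ _ mu Omega mO). Qed.

Lemma L2_integrable u : L2 Omega u -> mu.-integrable Omega (EFin \o u).
Proof.
move=> Lu; have L1 : L2 Omega (cst 1) by apply: continuous_L2; exact: cst_continuous.
have := @sqint_integrable _ _ _ mu Omega mO u (cst 1) Lu L1.
by apply: eq_integrable => // x _ /=; rewrite mulr1.
Qed.

Lemma Cc_continuous psi : Cc_infty Omega psi ->
  continuous psi /\ forall i, continuous (partial i psi).
Proof.
by move=> [s _ _]; have [c d] := smooth_C1 s; split=> // i; have [] := d i.
Qed.

Lemma Cc_L2 psi : Cc_infty Omega psi ->
  L2 Omega psi /\ forall i, L2 Omega (partial i psi).
Proof.
move=> /Cc_continuous[c d]; split=> [|i]; apply: continuous_L2 => //; exact: d.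
Qed.

Lemma Rintegral_Omega_cube (A : set 'rV[R]_n) (f : 'rV[R]_n -> R) : Omega `<=` A ->
  (forall x, ~ Omega x -> f x = 0) ->
  \int[mu]_(x in Omega) f x = \int[mu]_(x in A) f x.
Proof.
move=> OA f0; rewrite !(Rintegral_mkcond mu _ f); congr (Rintegral mu setT _).
apply/funext => x; rewrite /patch.
case: ifPn => [|/negP]; rewrite inE => Ox; first by rewrite mem_set//; exact: OA.
by case: ifPn => // _; rewrite f0.
Qed.

(** The product [psi * eta] vanishes outside [Omega], so its derivative integrates to zero over the
    enclosing cube; the product rule splits that integral. *)
Lemma Cc_weak_partial i psi : Cc_infty Omega psi ->
  is_weak_partial Omega i psi (partial i psi).
Proof.
move=> Cp; split; first exact: (Cc_L2 Cp).2.
move=> eta Ce; have [Lp Ldp] := Cc_L2 Cp; have [Le Lde] := Cc_L2 Ce.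
have [sp _ _] := Cp; have [se _ _] := Ce.
have [C1w wE] := C1_mul (smooth_C1 sp) (smooth_C1 se).
have h := @Rintegral_partial_cube R n _ a0 e0 i e0_gt0 C1w.
have {h} : \int[mu]_(x in cube a0 e0) partial i (fun x => psi x * eta x) x = 0.
  apply: h => v [k vk]; have nO : ~ Omega v by move=> /Omega_cube/(_ k); apply/negP.
  by rewrite (Cc_vanish Cp nO).1 mul0r.
rewrite -(Rintegral_Omega_cube Omega_sub_cube); last first.
  move=> x nO; rewrite wE (Cc_vanish Cp nO).1 (Cc_vanish Ce nO).1.
  by rewrite mul0r mulr0 addr0.
move=> h; apply/eqP; rewrite -addr_eq0 -RintegralD//; last 2 first.
- exact: L2_mul_integrable.
- exact: L2_mul_integrable.
by rewrite -[X in _ == X]h; apply/eqP; apply: eq_Rintegral => x _; rewrite wE.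
Qed.

Lemma L2_subspace : subspace (L2 Omega).
Proof. exact: (@sqint_subspace _ _ _ mu Omega mO). Qed.

Lemma L2_ip_psd : psd_form (L2 Omega) ip.
Proof. exact: (@ip_psd _ _ _ mu Omega mO). Qed.

(** The difference of two weak derivatives is orthogonal to all test functions. It is integrable
    because [Omega] is bounded, so the fundamental lemma applies. *)
Lemma weak_partial_unique i u g g' :
  is_weak_partial Omega i u g -> is_weak_partial Omega i u g' ->
  \forall x \ae mu, Omega x -> g x = g' x.
Proof.
move=> [Lg hg] [Lg' hg'].
have Ld : L2 Omega (g - g') by exact: subspaceB L2_subspace Lg Lg'.
have := fundamental_lemma Omega_open (L2_integrable Ld).
move=> h; apply: filterS (h _) => [x hx Ox|psi Cp].
  by have /eqP := hx Ox; rewrite -[(g - g') x]/(g x - g' x) subr_eq0 => /eqP.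
have [Lp _] := Cc_L2 Cp.
have := hg psi Cp; rewrite (hg' psi Cp) => /eqP; rewrite eqr_opp => /eqP E.
transitivity (\int[mu]_(x in Omega) (g x * psi x - g' x * psi x)).
  by apply: eq_Rintegral => x _; rewrite -[(g - g') x]/(g x - g' x) mulrBl.
rewrite RintegralB//; first by rewrite E subrr.
- exact: L2_mul_integrable.
- exact: L2_mul_integrable.
Qed.

Lemma weak_partial_lin i (k : R) u v g h : L2 Omega u -> L2 Omega v ->
  is_weak_partial Omega i u g -> is_weak_partial Omega i v h ->
  is_weak_partial Omega i (k *: u + v) (k *: g + h).
Proof.
move=> Lu Lv [Lg hg] [Lh hh]; split; first exact: L2_subspace.2.
move=> psi Cp; have [Lp Ldp] := Cc_L2 Cp.
have h1 := @ip_lin _ _ _ mu Omega mO k u v (partial i psi) Lu Lv (Ldp i).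
have h2 := @ip_lin _ _ _ mu Omega mO k g h psi Lg Lh Lp.
have := hg _ Cp; have := hh _ Cp; rewrite /ip /= in h1 h2.
by rewrite h1 h2 => -> ->; ring.
Qed.

Lemma H1_wpartial i u : H1 Omega u -> is_weak_partial Omega i u (wpartial Omega i u).
Proof. by move=> [_ /(_ i)[g hg]]; exact: (xgetPex 0 (ex_intro _ g hg)). Qed.

Lemma H1_L2 u : H1 Omega u -> L2 Omega u. Proof. by case. Qed.

Lemma wpartial_L2 i u : H1 Omega u -> L2 Omega (wpartial Omega i u).
Proof. by move=> /(H1_wpartial i)[]. Qed.

Lemma wpartial_ae i u g : H1 Omega u -> is_weak_partial Omega i u g ->
  \forall x \ae mu, Omega x -> wpartial Omega i u x = g x.
Proof. by move=> Hu; apply: weak_partial_unique; exact: H1_wpartial. Qed.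

Lemma H1_subspace : subspace (H1 Omega).
Proof.
split.
  split; first exact: L2_subspace.1.
  move=> i; exists 0; split; first exact: L2_subspace.1.
  by move=> psi _; rewrite !Rintegral0_eq ?oppr0// => x _; rewrite mul0r.
move=> k u v Hu Hv; split; first by apply: L2_subspace.2; exact: H1_L2.
move=> i; exists (k *: wpartial Omega i u + wpartial Omega i v).
by apply: weak_partial_lin; (exact: H1_L2 || exact: H1_wpartial).
Qed.

(** Nothing relates the representatives chosen for [u], [v] and the combination except uniqueness of
    weak derivatives. *)
Lemma wpartial_lin i (k : R) u v : H1 Omega u -> H1 Omega v ->
  \forall x \ae mu, Omega x ->
    wpartial Omega i (k *: u + v) x = k * wpartial Omega i u x + wpartial Omega i v x.
Proof.
move=> Hu Hv; apply: wpartial_ae; first exact: H1_subspace.2.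
by apply: weak_partial_lin; (exact: H1_L2 || exact: H1_wpartial).
Qed.

Lemma Cc_H1 psi : Cc_infty Omega psi -> H1 Omega psi.
Proof.
move=> Cp; split; first exact: (Cc_L2 Cp).1.
by move=> i; exists (partial i psi); exact: Cc_weak_partial.
Qed.

Lemma wpartial_Cc i psi : Cc_infty Omega psi ->
  \forall x \ae mu, Omega x -> wpartial Omega i psi x = partial i psi x.
Proof. by move=> Cp; apply: wpartial_ae; [exact: Cc_H1|exact: Cc_weak_partial]. Qed.

Lemma L2_measurable u : L2 Omega u -> measurable_fun Omega u. Proof. by case. Qed.

Lemma ae_ip u u' v v' : L2 Omega u -> L2 Omega u' -> L2 Omega v -> L2 Omega v' ->
  (\forall x \ae mu, Omega x -> u x = u' x) ->
  (\forall x \ae mu, Omega x -> v x = v' x) -> ip u v = ip u' v'.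
Proof.
move=> Lu Lu' Lv Lv' uu vv; apply: ae_eq_Rintegral => //.
- by apply: measurable_funM; exact: L2_measurable.
- by apply: measurable_funM; exact: L2_measurable.
- by apply: filterS2 uu vv => x h1 h2 Ox; rewrite h1// h2.
Qed.

Definition H1form u v : R :=
  ip u v + \sum_(i < n) ip (wpartial Omega i u) (wpartial Omega i v).

Lemma wpartial_psd i : psd_form (H1 Omega)
  (fun u v => ip (wpartial Omega i u) (wpartial Omega i v)).
Proof.
have L u := @wpartial_L2 i u.
split=> [u v _ _|k u v w Hu Hv Hw|u _].
- exact: (@ipC _ _ _ mu Omega (wpartial Omega i u) (wpartial Omega i v)).
- rewrite -(@ip_lin _ _ _ mu Omega mO k _ _ _ (L _ Hu) (L _ Hv) (L _ Hw)).
  apply: ae_ip; [|exact: L2_subspace.2 (L _ Hu) (L _ Hv)|exact: L|exact: L| |].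
  + by apply: L; exact: H1_subspace.2.
  + exact: wpartial_lin.
  + exact: aeW.
- exact: (@ip_ge0 _ _ _ mu Omega (wpartial Omega i u)).
Qed.

Lemma H1form_psd : psd_form (H1 Omega) H1form.
Proof.
have h0 : psd_form (H1 Omega) ip := psd_form_sub H1_L2 L2_ip_psd.
exact: psd_form_add h0 (psd_form_sum wpartial_psd).
Qed.

Lemma L2norm_sqr u : L2norm Omega u ^+ 2 = ip u u.
Proof.
rewrite /L2norm sqr_sqrtr; last by apply: Rintegral_ge0 => x _; exact: sqr_ge0.
by apply: eq_Rintegral => x _; rewrite sqr_normr expr2.
Qed.

Lemma L2normE u : L2norm Omega u = Num.sqrt (ip u u).
Proof.
by rewrite -L2norm_sqr sqrtr_sqr ger0_norm// /L2norm sqrtr_ge0.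
Qed.

Lemma H1normE u : H1norm Omega u = Num.sqrt (H1form u u).
Proof.
rewrite /H1norm /H1form L2norm_sqr; congr (Num.sqrt (_ + _)).
by apply: eq_bigr => i _; rewrite L2norm_sqr.
Qed.

Lemma H1form_ge0 u : 0 <= H1form u u.
Proof. by rewrite addr_ge0 ?ip_ge0// sumr_ge0// => i _; exact: ip_ge0. Qed.

Lemma H1norm_sqr u : H1norm Omega u ^+ 2 = H1form u u.
Proof. by rewrite H1normE sqr_sqrtr// H1form_ge0. Qed.

Lemma H10_H1 : H10 Omega `<=` H1 Omega. Proof. by move=> u []. Qed.

Lemma Cc_H10 : Cc_infty Omega `<=` H10 Omega.
Proof.
move=> psi Cp; split; first exact: Cc_H1.
move=> e e_gt0; exists psi => //; rewrite subrr H1normE.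
have := psd_formZ H1_subspace H1form_psd 0 H1_subspace.1.
by rewrite scaler0 expr0n mul0r => ->; rewrite sqrtr0.
Qed.

Lemma H10_subspace : subspace (H10 Omega).
Proof.
split; first by apply: Cc_H10; exact: Cc0.
move=> k u v [Hu au] [Hv av]; split; first exact: H1_subspace.2.
move=> e e_gt0; have k0 : 0 < 2 * (`|k| + 1) by rewrite mulr_gt0// ltr_wpDl.
have [psi Cp hp] := au (e / (2 * (`|k| + 1))) (divr_gt0 e_gt0 k0).
have [eta Ce he] := av (e / 2) (divr_gt0 e_gt0 (ltr0n _ 2)).
exists (k *: psi + eta); first exact: Cc_lin.
have H1 := subspaceB H1_subspace Hu (Cc_H1 Cp).
have H2 := subspaceB H1_subspace Hv (Cc_H1 Ce).
have -> : k *: u + v - (k *: psi + eta) = k *: (u - psi) + (v - eta).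
  by rewrite scalerBr opprD addrACA.
have := psd_form_sqrtD H1_subspace H1form_psd (subspaceZ k H1_subspace H1) H2.
rewrite (psd_formZ H1_subspace H1form_psd k H1) sqrtrM ?sqr_ge0// sqrtr_sqr.
rewrite (H1normE (u - psi)) in hp; rewrite (H1normE (v - eta)) in he.
rewrite (H1normE (k *: (u - psi) + (v - eta))).
move=> h; exact: lin_approx (normr_ge0 k) (sqrtr_ge0 _) hp he h.
Qed.

Lemma H10_dense u e : H10 Omega u -> 0 < e ->
  exists2 v, Cc_infty Omega v & H1form (u - v) (u - v) < e.
Proof.
move=> [Hu au] e_gt0; have [|psi Cp hp] := au (Num.sqrt e); first by rewrite sqrtr_gt0.
exists psi => //; rewrite -H1norm_sqr -[ltRHS](sqr_sqrtr (ltW e_gt0)).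
by rewrite ltr_sqr ?nnegrE ?sqrtr_ge0// H1normE sqrtr_ge0.
Qed.

Lemma wpartialB_ae i u g psi : H1 Omega u -> is_weak_partial Omega i u g ->
  Cc_infty Omega psi -> \forall x \ae mu, Omega x ->
    wpartial Omega i (u - psi) x = (g - partial i psi) x.
Proof.
move=> Hu ug Cp; apply: wpartial_ae; first exact: subspaceB H1_subspace Hu (Cc_H1 Cp).
have := weak_partial_lin (-1) (H1_L2 (Cc_H1 Cp)) (H1_L2 Hu) (Cc_weak_partial i Cp) ug.
by rewrite !scaleN1r ![- _ + _]addrC.
Qed.

Lemma H1formB u psi (g : 'I_n -> 'rV[R]_n -> R) :
  H1 Omega u -> (forall i, is_weak_partial Omega i u (g i)) -> Cc_infty Omega psi ->
  H1form (u - psi) (u - psi) = ip (u - psi) (u - psi) +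
    \sum_(i < n) ip (g i - partial i psi) (g i - partial i psi).
Proof.
move=> Hu ug Cp; have HB := subspaceB H1_subspace Hu (Cc_H1 Cp).
congr (_ + _); apply: eq_bigr => i _.
have Lg : L2 Omega (g i - partial i psi).
  by apply: subspaceB L2_subspace _ ((Cc_L2 Cp).2 i); have [] := ug i.
have h := wpartialB_ae Hu (ug i) Cp.
by apply: ae_ip => //; exact: wpartial_L2.
Qed.

(** The functions [v k] and their classical partial derivatives are separately Cauchy in L^2. The
    identity defining weak derivatives passes to L^2 limits, so the limits [g i] are the gradient of
    [w], and the [v k] themselves approximate [w] by test functions. *)
Lemma H10_complete (v : nat -> 'rV[R]_n -> R) : (forall k, Cc_infty Omega (v k)) ->
  (forall k, H1form (v k.+1 - v k) (v k.+1 - v k) <= 4^-1 ^+ k) ->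
  exists2 w, H10 Omega w & forall e, 0 < e ->
    exists k0, forall k, (k0 <= k)%N -> H1form (w - v k) (w - v k) <= e.
Proof.
move=> vC vG.
have Gk k : H1form (v k.+1 - v k) (v k.+1 - v k) = ip (v k.+1 - v k) (v k.+1 - v k) +
    \sum_(i < n) ip (partial i (v k.+1) - partial i (v k))
      (partial i (v k.+1) - partial i (v k)).
  by apply: H1formB => //; [exact: Cc_H1|move=> i; exact: Cc_weak_partial].
have s0 (f : 'I_n -> 'rV[R]_n -> R) : 0 <= \sum_(i < n) ip (f i) (f i).
  by apply: sumr_ge0 => i _; exact: ip_ge0.
have [w Lw wv] : exists2 w, L2 Omega w &
  forall e, 0 < e -> exists k0, forall k, (k0 <= k)%N -> ip (w - v k) (w - v k) <= e.
  apply: (@sqint_complete _ _ _ mu Omega mO) => k; first exact: (Cc_L2 (vC k)).1.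
  by apply: le_trans (vG k); rewrite Gk lerDl.
have /choice[g gP] : forall i, exists g, L2 Omega g /\
    forall e, 0 < e -> exists k0, forall k, (k0 <= k)%N ->
      ip (g - partial i (v k)) (g - partial i (v k)) <= e.
  move=> i; have [|k|g Lg gP] := @sqint_complete _ _ _ mu Omega mO (fun k => partial i (v k)).
  - by move=> k; exact: (Cc_L2 (vC k)).2.
  - apply: le_trans (vG k); rewrite Gk (bigD1 i)//= addrCA lerDl addr_ge0 ?ip_ge0//.
    by apply: sumr_ge0 => j _; exact: ip_ge0.
  - by exists g.
have wg i : is_weak_partial Omega i w (g i).
  have [Lg gv] := gP i; split=> // psi Cp; have [Lp Ldp] := Cc_L2 Cp.
  rewrite -/(ip w (partial i psi)) -/(ip (g i) psi).
  apply/eqP; rewrite -addr_eq0 -normr_le0; apply/ler_addgt0Pl => e e_gt0.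
  (* [A] bounds the squared norms of both [psi] and its derivative. With [t * A = (e / 2) ^+ 2],
     Cauchy-Schwarz makes each of the two error terms at most [e / 2]. *)
  pose A := ip (partial i psi) (partial i psi) + ip psi psi + 1.
  have A0 : 0 < A by rewrite ltr_wpDl// addr_ge0 ?ip_ge0.
  pose t := (e / 2) ^+ 2 / A.
  have t0 : 0 < t by rewrite divr_gt0// exprn_gt0// divr_gt0.
  have [k1 hk1] := wv t t0; have [k2 hk2] := gv t t0.
  pose k := maxn k1 k2; have [Lv Ldv] := Cc_L2 (vC k).
  have h1 := hk1 k (leq_maxl _ _); have h2 := hk2 k (leq_maxr _ _).
  have Lwv := subspaceB L2_subspace Lw Lv.
  have Lgv := subspaceB L2_subspace Lg (Ldv i).
  have E : ip w (partial i psi) + ip (g i) psi =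
      ip (w - v k) (partial i psi) + ip (g i - partial i (v k)) psi.
    have B (x y z : 'rV[R]_n -> R) : L2 Omega x -> L2 Omega y -> L2 Omega z ->
        ip (x - y) z = ip x z - ip y z.
      move=> Lx Ly Lz; rewrite addrC -scaleN1r.
      by rewrite (@ip_lin _ _ _ mu Omega mO (-1) y x z Ly Lx Lz); ring.
    rewrite !B//; have := (Cc_weak_partial i (vC k)).2 psi Cp.
    rewrite -/(ip (v k) (partial i psi)) -/(ip (partial i (v k)) psi) => ->; ring.
  have CS (x y : 'rV[R]_n -> R) : L2 Omega x -> L2 Omega y -> ip x x <= t -> ip y y <= A ->
      `|ip x y| <= e / 2.
    move=> Lx Ly hx hy.
    have e2 : 0 <= e / 2 by rewrite divr_ge0// ltW.
    rewrite -ler_sqr ?nnegrE// sqr_normr.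
    apply: le_trans (psd_form_CS L2_subspace L2_ip_psd Lx Ly) _.
    have -> : (e / 2) ^+ 2 = t * A by rewrite /t divfK// gt_eqF.
    by apply: ler_pM => //; exact: ip_ge0.
  rewrite E addr0; apply: le_trans (ler_normD _ _) _.
  have c1 := CS _ _ Lwv (Ldp i) h1; have c2 := CS _ _ Lgv Lp h2.
  have : `|ip (w - v k) (partial i psi)| <= e / 2.
    by apply: c1; rewrite /A -addrA lerDl addr_ge0// ip_ge0.
  have : `|ip (g i - partial i (v k)) psi| <= e / 2.
    by apply: c2; rewrite /A addrAC lerDr addr_ge0// ip_ge0.
  by lra.
have Hw : H1 Omega w by split=> // i; exists (g i).
have conv e : 0 < e -> exists k0, forall k, (k0 <= k)%N -> H1form (w - v k) (w - v k) <= e.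
  move=> e_gt0; have n0 : 0 < n.+1%:R :> R by rewrite ltr0n.
  have t0 : 0 < e / n.+1%:R by exact: divr_gt0.
  have [k1 hk1] := wv _ t0.
  have /choice[k2 hk2] : forall i, exists k0, forall k, (k0 <= k)%N ->
      ip (g i - partial i (v k)) (g i - partial i (v k)) <= e / n.+1%:R.
    by move=> i; have [_ h] := gP i; exact: h.
  exists (maxn k1 (\max_(i < n) k2 i)) => k; rewrite geq_max => /andP[kk1 kk2].
  rewrite (H1formB Hw wg (vC k)).
  (* One share of [e] for the function and one for each of its [n] derivatives. *)
  have -> : e = e / n.+1%:R + \sum_(i < n) e / n.+1%:R.
    rewrite sumr_const card_ord -mulrS -[RHS]mulr_natr divfK// gt_eqF//.
  apply: lerD; first exact: hk1.
  apply: ler_sum => i _; apply: hk2; apply: leq_trans kk2.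
  exact: (leq_bigmax i).
exists w => //; split=> // e e_gt0.
have e2 : 0 < (e / 2) ^+ 2 by rewrite exprn_gt0// divr_gt0.
have [k0 hk0] := conv _ e2; exists (v k0) => //.
have h := ler_wsqrtr (hk0 _ (leqnn k0)).
have e2' : 0 <= e / 2 by rewrite divr_ge0// ltW.
rewrite sqrtr_sqr (ger0_norm e2') -(H1normE (w - v k0)) in h.
by apply: le_lt_trans h _; rewrite ltr_pdivrMr// ltr_pMr// ltr1n.
Qed.

End sobolev.

(** * Compactness and the Poincare inequality *)

Section grid.
Context {R : realType} {n : nat}.
Local Notation mu := (@lebesgue_rV R n).

Definition grid_corner (a : 'rV[R]_n) (h : R) N (k : {ffun 'I_n -> 'I_N}) : 'rV[R]_n :=
  \row_i (a ord0 i + (k i)%:R * h).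

(** In each direction the index of the cell is the integer part of [(x i - a i) / h]. Half-open
    cells make it unique. *)
Lemma grid_index (a : 'rV[R]_n) (h : R) N (x : 'rV[R]_n) : 0 < h ->
  cube a (N%:R * h) x -> exists k0 : {ffun 'I_n -> 'I_N},
    forall k, cube (grid_corner a h k) h x <-> k = k0.
Proof.
move=> h0 ax; pose y i := (x ord0 i - a ord0 i) / h.
have y0 i : 0 <= y i.
  by have := ax i; rewrite in_itv/= => /andP[? _]; rewrite divr_ge0 ?subr_ge0// ltW.
have yN i : (Num.truncn (y i) < N)%N.
  have := ax i; rewrite in_itv/= => /andP[_ xN].
  by rewrite truncn_lt_nat// ltr_pdivrMr// ltrBlDl.
have E i (k : 'I_N) : (x ord0 i \in `[a ord0 i + k%:R * h, a ord0 i + k%:R * h + h[) =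
    (Num.truncn (y i) == k).
  rewrite truncn_eq// ler_pdivlMr// ltr_pdivrMr// in_itv/= lerBrDl ltrBlDl.
  by rewrite -natr1 mulrDl mul1r addrA.
exists [ffun i => Ordinal (yN i)] => k; split=> [kx|-> i].
  apply/ffunP => i; rewrite ffunE; apply: val_inj => /=.
  by have := kx i; rewrite mxE E => /eqP ->.
by rewrite mxE E ffunE.
Qed.

Lemma grid_sub (a : 'rV[R]_n) (h : R) N (k : {ffun 'I_n -> 'I_N}) : 0 < h ->
  cube (grid_corner a h k) h `<=` cube a (N%:R * h).
Proof.
move=> h0 x kx i; have := kx i; rewrite mxE !in_itv/= => /andP[h1 h2]; apply/andP; split.
  by apply: le_trans h1; rewrite lerDl mulr_ge0// ltW.
apply: lt_le_trans h2 _; rewrite -addrA lerD2l -[X in _ + X <= _]mul1r.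
by rewrite -mulrDl natr1 ler_pM2r// ler_nat.
Qed.

Lemma Rintegral_grid (a : 'rV[R]_n) (h : R) N (f : 'rV[R]_n -> R) : 0 < h ->
  continuous f -> \int[mu]_(x in cube a (N%:R * h)) f x =
    \sum_(k : {ffun 'I_n -> 'I_N}) \int[mu]_(x in cube (grid_corner a h k) h) f x.
Proof.
move=> h0 cf; have mQ b e : measurable (@cube R n b e) by exact: measurable_cube.
have i1 : mu.-integrable (cube a (N%:R * h)) (EFin \o f).
  by apply: integrable_cube => //; rewrite mulr_ge0// ltW.
have i2 (k : {ffun 'I_n -> 'I_N}) :
    mu.-integrable (cube a (N%:R * h)) (EFin \o (f \_ (cube (grid_corner a h k) h))).
  have := (@integrable_restrict _ _ _ mu _ (mQ (grid_corner a h k) h) _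
    (mQ a (N%:R * h)) (EFin \o f)).1.
  rewrite restrict_EFin; apply; apply: integrableS i1 => //.
  by apply: measurableI; exact: mQ.
under [RHS]eq_bigr => k _.
  rewrite -(setIidr (grid_sub (a := a) (k := k) h0)) Rintegral_mkcondr.
  over.
rewrite -(Rintegral_sum (mQ _ _) _ i2).
apply: eq_Rintegral => x; rewrite inE => xQ.
have [k0 k0P] := grid_index h0 xQ.
rewrite (bigD1 k0)//= /patch mem_set; last exact/k0P.
rewrite big1 ?addr0// => k kk0; rewrite memNset//.
by move=> /k0P kE; rewrite kE eqxx in kk0.
Qed.

End grid.

Section rellich.
Context {R : realType} {n : nat}.
Variables (Omega : set 'rV[R]_n) (a0 : 'rV[R]_n) (e0 : R).
Hypothesis Omega_open : open Omega.
Hypothesis e0_gt0 : 0 < e0.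
Hypothesis Omega_cube :
  forall x, Omega x -> forall i, x ord0 i \in `]a0 ord0 i, a0 ord0 i + e0[.
Local Notation mu := (@lebesgue_rV R n).
Local Notation ip := (ip mu Omega).
Let OQ := Omega_sub_cube Omega_cube.

Lemma ip_Cc_cube (A : set 'rV[R]_n) psi : Cc_infty Omega psi -> Omega `<=` A ->
  ip psi psi = \int[mu]_(x in A) (psi x ^+ 2) /\
  forall i, ip (partial i psi) (partial i psi) = \int[mu]_(x in A) (partial i psi x ^+ 2).
Proof.
move=> Cp OA; split=> [|i]; rewrite -(Rintegral_Omega_cube OA).
- by apply: eq_Rintegral => x _; rewrite expr2.
- by move=> x nO; rewrite (Cc_vanish Cp nO).1 expr0n.
- by apply: eq_Rintegral => x _; rewrite expr2.
- by move=> x nO; rewrite (Cc_vanish Cp nO).2 expr0n.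
Qed.

(* The functionals are the normalised means over the cells of a fine grid. *)
Lemma rellich_Cc (e : R) : 0 < e ->
  exists (I : finType) (l : I -> ('rV[R]_n -> R) -> R) (C : R),
  [/\ forall i u v, Cc_infty Omega u -> Cc_infty Omega v -> l i (u - v) = l i u - l i v,
      forall i u, Cc_infty Omega u -> l i u ^+ 2 <= C * ip u u &
      forall u, Cc_infty Omega u -> ip u u <= \sum_i l i u ^+ 2 +
        e * \sum_(i < n) ip (partial i u) (partial i u)].
Proof.
(* [N] exceeds [e0 / Num.sqrt e], so the side [h = e0 / N] of the cells satisfies [h ^+ 2 <= e]. *)
move=> e_gt0; pose N := (Num.truncn (e0 / Num.sqrt e)).+1.
have se : 0 < Num.sqrt e by rewrite sqrtr_gt0.
have N0 : 0 < N%:R :> R by rewrite ltr0n.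
pose h := e0 / N%:R; have h0 : 0 < h by exact: divr_gt0.
have he : h ^+ 2 <= e.
  rewrite -[leRHS](sqr_sqrtr (ltW e_gt0)) ler_sqr ?nnegrE ?sqrtr_ge0 ?(ltW h0)//.
  rewrite /h ler_pdivrMr// mulrC -ler_pdivrMr//; apply: ltW; exact: truncnS_gt.
have Nh : N%:R * h = e0 by rewrite /h mulrCA mulfV ?mulr1// gt_eqF.
have hn0 : 0 < h ^+ n by rewrite exprn_gt0.
pose Q (k : {ffun 'I_n -> 'I_N}) := cube (grid_corner a0 h k) h.
have mQ k : measurable (Q k) by exact: measurable_cube.
have cC u : Cc_infty Omega u -> continuous u by move=> /Cc_continuous[].
have iQ k u : continuous u -> mu.-integrable (Q k) (EFin \o u).
  by move=> cu; apply: integrable_cube => //; exact: ltW.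
(* Dividing by the root of the volume of a cell makes the square of the functional the mean term of
   [cube_inequality], and gives the constant 1 in Cauchy-Schwarz. *)
exists {ffun 'I_n -> 'I_N}, (fun k u => (\int[mu]_(x in Q k) u x) / Num.sqrt (h ^+ n)), 1.
have sq k u : ((\int[mu]_(x in Q k) u x) / Num.sqrt (h ^+ n)) ^+ 2 =
    (\int[mu]_(x in Q k) u x) ^+ 2 / h ^+ n.
  by rewrite expr_div_n sqr_sqrtr// ltW.
have grid f : continuous f -> \int[mu]_(x in cube a0 e0) f x =
    \sum_k \int[mu]_(x in Q k) f x.
  by move=> cf; rewrite -Nh Rintegral_grid.
split.
- move=> k u v Cu Cv; rewrite -mulrBl -RintegralB//; exact/iQ/cC.
- move=> k u Cu; rewrite sq mul1r ler_pdivrMr// mulrC.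
  rewrite (ip_Cc_cube Cu OQ).1 (grid _ (continuous_sqr (cC _ Cu))).
  apply: (@le_trans _ _ (h ^+ n * \int[mu]_(x in Q k) (u x ^+ 2))).
    apply: Rintegral_sqr_le => //; last 2 first.
    + exact/iQ/cC.
    + exact/iQ/continuous_sqr/cC.
    + exact: lebesgue_cube (ltW h0).
  rewrite ler_pM2l// (bigD1 k)//= lerDl; apply: sumr_ge0 => j _.
  by apply: Rintegral_ge0 => x _; exact: sqr_ge0.
- move=> u Cu; rewrite (ip_Cc_cube Cu OQ).1.
  under [X in _ + _ * X]eq_bigr do rewrite (ip_Cc_cube Cu OQ).2.
  rewrite (grid _ (continuous_sqr (cC _ Cu))).
  under [X in _ + _ * X]eq_bigr => i _.
    rewrite (grid _ (continuous_sqr ((Cc_continuous Cu).2 i))).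
    over.
  (* The gradient integrals are regrouped by cell, so that [cube_inequality] can be applied to each
     cell with [h ^+ 2 <= e]. *)
  rewrite exchange_big/= mulr_sumr -big_split/=; apply: ler_sum => k _.
  rewrite sq; have [su _ _] := Cu.
  apply: le_trans (cube_inequality _ h0 (smooth_C1 su)) _.
  rewrite lerD2l ler_wpM2r// sumr_ge0// => i _.
  by apply: Rintegral_ge0 => x _; exact: sqr_ge0.
Qed.

(* [cube_inequality] on a cube so large that the mean term can be absorbed. *)
Lemma poincare_Cc psi : (0 < n)%N -> Cc_infty Omega psi ->
  ip psi psi <= 8 * e0 ^+ 2 * \sum_(i < n) ip (partial i psi) (partial i psi).
Proof.
move=> n_gt0 Cp; have [sp _ _] := Cp; have [cp _] := Cc_continuous Cp.
(* Doubling the side leaves the integral of [psi] unchanged and divides the mean term by [2 ^+ n],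
   at least 2 as [n > 0]. Absorbing half of the left side doubles [S ^+ 2 = 4 * e0 ^+ 2], whence the
   factor 8. *)
pose S := 2 * e0; have S0 : 0 < S by rewrite mulr_gt0.
have QS : cube a0 e0 `<=` cube a0 S.
  move=> x xQ i; have := xQ i; rewrite !in_itv/= => /andP[-> h] /=.
  by apply: lt_le_trans h _; rewrite lerD2l /S ler_peMl ?ler1n ?ltW.
have OS := subset_trans OQ QS.
have := cube_inequality a0 S0 (smooth_C1 sp).
rewrite -(ip_Cc_cube Cp OS).1.
under eq_bigr do rewrite -(ip_Cc_cube Cp OS).2.
have -> : \int[mu]_(x in cube a0 S) psi x = \int[mu]_(x in cube a0 e0) psi x.
  have p0 x : ~ Omega x -> psi x = 0 by move=> nO; exact: (Cc_vanish Cp nO).1.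
  by rewrite -(Rintegral_Omega_cube OS p0) (Rintegral_Omega_cube OQ p0).
have h1 : (\int[mu]_(x in cube a0 e0) psi x) ^+ 2 <= e0 ^+ n * ip psi psi.
  rewrite (ip_Cc_cube Cp OQ).1; apply: Rintegral_sqr_le.
  - exact: measurable_cube.
  - by rewrite exprn_gt0.
  - exact: lebesgue_cube (ltW e0_gt0).
  - exact: integrable_cube (ltW e0_gt0) cp.
  - exact: integrable_cube (ltW e0_gt0) (continuous_sqr cp).
have h2 : (\int[mu]_(x in cube a0 e0) psi x) ^+ 2 / S ^+ n <= 2^-1 * ip psi psi.
  rewrite ler_pdivrMr ?exprn_gt0//; apply: le_trans h1 _.
  have p2 : 2 <= 2 ^+ n :> R.
    by rewrite -[leLHS]expr1; apply: ler_weXn2l => //; rewrite ler1n.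
  have X0 : 0 <= e0 ^+ n * ip psi psi by rewrite mulr_ge0 ?ip_ge0// exprn_ge0// ltW.
  rewrite /S exprMn; move: (2 ^+ n) (e0 ^+ n) (ip psi psi) p2 X0 => x y z p2 X0.
  have -> : 2^-1 * z * (x * y) = 2^-1 * x * (y * z) by ring.
  by rewrite ler_peMl//; lra.
have -> : S ^+ 2 = 4 * e0 ^+ 2 by rewrite /S; ring.
move: (_ / S ^+ n) (ip psi psi) (\sum_(i < n) _) h2 => x y z h2 h3; lra.
Qed.

(** A bump on a small box around a point of [Omega]. It is nonzero throughout the open box, which
    has positive measure, so it cannot vanish almost everywhere. *)
Lemma Cc_nonzero : Omega !=set0 -> exists2 psi, Cc_infty Omega psi & 0 < ip psi psi.
Proof.
move=> [x Ox]; have [q [qx qO]] := open_rat_ball Omega_open Ox.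
pose r : R := q.2.+1%:R^-1; have r0 : 0 < r by rewrite invr_gt0 ltr0n.
pose a : 'rV[R]_n := \row_i (ratr (q.1 ord0 i) - r).
pose b : 'rV[R]_n := \row_i (ratr (q.1 ord0 i) + r).
have abO : cbox a b `<=` Omega.
  by apply: subset_trans qO => v h i; have := h i; rewrite !mxE in_itv/= ler_distlC.
have Cb := Cc_bumps 0 abO; exists (bumps a b 0) => //.
rewrite lt_def ip_ge0 andbT; apply/eqP => b0.
have [L _] := Cc_L2 Omega_open e0_gt0 Omega_cube Cb.
have [A [mA A0 hA]] := @ip_eq0 _ _ _ mu Omega (measurable_Omega Omega_open) _ L b0.
have mab : measurable (obox a b) by apply: open_measurable_rV; exact: open_obox.
have : obox a b `<=` A.
  move=> v vab; apply: hA => /= h.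
  have := h (abO _ (obox_cbox vab)); apply/eqP; apply/prodf_neq0 => i _.
  by apply/bump_neq0; exact: vab.
move=> /(le_measure mu); rewrite !inE => /(_ mab mA) leA.
have A0' : mu A = 0%E by exact: A0.
have {}A0' : (mu A <= 0)%E by rewrite A0'.
have {leA A0'} : (mu (obox a b) <= 0)%E by exact: le_trans leA A0'.
have -> : mu (obox a b) = ((2 * r) ^+ n)%:E.
  rewrite (lebesgue_rV_box (A := fun i => [set` `]a ord0 i, b ord0 i[ ])); last first.
    by move=> i; exact: measurable_itv.
  rewrite (eq_bigr (fun=> (2 * r)%:E)); last first.
    move=> i _; rewrite lebesgue_measure_itv/= lte_fin !mxE ltrD2l gtrN// -EFinB.
    by congr EFin; ring.
  by rewrite prodEFin prodr_const card_ord.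
by rewrite lee_fin leNgt exprn_gt0// mulr_gt0.
Qed.

End rellich.

(** * The energy functional *)

Section energy.
Context {R : realType} {V : lmodType R}.
Variables (H D : set V) (M B G : V -> V -> R) (K gamma : R).
Hypotheses (sH : subspace H) (sD : subspace D) (DH : D `<=` H).
Hypotheses (pM : psd_form H M) (pB : psd_form H B) (pG : psd_form H G).
Hypothesis MG : forall u, H u -> M u u <= G u u.
Hypothesis BG : forall u, H u -> B u u <= K * G u u.
Hypothesis K_gt0 : 0 < K.
Hypothesis gamma_gt0 : 0 < gamma.
Hypothesis dense : forall u e, H u -> 0 < e ->
  exists2 v, D v & G (u - v) (u - v) < e.

Definition energy u : R := 2^-1 * B u u + gamma / 2 * M u u - gamma * Num.sqrt (M u u).

Definition dform l u h : R := B u h - l * M u h.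

(** By Cauchy-Schwarz [dform l u] is continuous for [G], so its zeros extend from the dense [D]. In
    particular an eigenfunction may be tested against itself. *)
Lemma dform_ext l u : H u -> (forall h, D h -> dform l u h = 0) ->
  forall h, H h -> dform l u h = 0.
Proof.
move=> Hu hD h Hh; apply/eqP; rewrite -normr_le0; apply/ler_addgt0Pl => e e_gt0.
rewrite addr0.
have [_ _ B0] := pB; have [_ _ M0] := pM; have [_ _ G0] := pG.
have Bu0 := B0 _ Hu; have Mu0 := M0 _ Hu.
(* [A] dominates the squared bounds of both terms of [dform l u]; with [t * A = (e / 2) ^+ 2] each
   of them is at most [e / 2] at [h - v]. *)
pose A := B u u * K + l ^+ 2 * M u u + 1.
have K0 := ltW K_gt0.
have BK0 : 0 <= B u u * K by exact: mulr_ge0.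
have lM0 : 0 <= l ^+ 2 * M u u by rewrite mulr_ge0 ?sqr_ge0.
have A0 : 0 < A by rewrite ltr_wpDl// addr_ge0.
pose t := (e / 2) ^+ 2 / A.
have t0 : 0 < t by rewrite divr_gt0// exprn_gt0// divr_gt0.
have tA : t * A = (e / 2) ^+ 2 by rewrite /t divfK// gt_eqF.
have [v Dv Gv] := dense Hh t0; have Hv := DH Dv; have Hd := subspaceB sH Hh Hv.
have E : dform l u h = dform l u (h - v).
  have [Bs Bl _] := pB; have [Ms Ml _] := pM.
  have Bd : B u (h - v) = B u h - B u v.
    by rewrite !(Bs u)// addrC -scaleN1r Bl//; ring.
  have Md : M u (h - v) = M u h - M u v.
    by rewrite !(Ms u)// addrC -scaleN1r Ml//; ring.
  have := hD _ Dv; rewrite /dform Bd Md => h0.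
  by lra.
have e2 : 0 <= e / 2 by rewrite divr_ge0// ltW.
have b1 : `|B u (h - v)| <= e / 2.
  rewrite -ler_sqr ?nnegrE// sqr_normr; apply: le_trans (psd_form_CS sH pB Hu Hd) _.
  have h1 : B u u * B (h - v) (h - v) <= B u u * (K * t).
    apply: ler_wpM2l => //; apply: le_trans (BG Hd) _.
    by rewrite ler_pM2l// ltW.
  apply: le_trans h1 _; rewrite -tA mulrA mulrC ler_pM2l// /A.
  by rewrite -addrA lerDl addr_ge0.
have b2 : `|l * M u (h - v)| <= e / 2.
  rewrite -ler_sqr ?nnegrE// sqr_normr exprMn.
  have h1 : M u (h - v) ^+ 2 <= M u u * t.
    apply: le_trans (psd_form_CS sH pM Hu Hd) _; apply: ler_wpM2l => //.
    by apply: le_trans (MG Hd) _; exact: ltW.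
  apply: (@le_trans _ _ (l ^+ 2 * (M u u * t))); first by rewrite ler_wpM2l// sqr_ge0.
  rewrite -tA mulrA mulrC ler_pM2l// /A.
  by rewrite -addrA addrCA lerDl addr_ge0.
rewrite E /dform; apply: le_trans (ler_normB _ _) _; lra.
Qed.

Let r u := Num.sqrt (M u u).

Definition multiplier u := gamma / r u - gamma.

Lemma sqrt_form_sqr u : H u -> r u ^+ 2 = M u u.
Proof. by move=> Hu; have [_ _ M0] := pM; rewrite sqr_sqrtr// M0. Qed.

Lemma sqrt_form_triangle u h : H u -> H h -> (r (u + h) - r u) ^+ 2 <= M h h.
Proof.
move=> Hu Hh; have Huh := subspaceD sH Hu Hh.
have h1 := psd_form_sqrtD sH pM Hu Hh.
have h2 := psd_form_sqrtD sH pM Huh (subspaceZ (-1) sH Hh).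
rewrite scaleN1r addrK (_ : M (- h) (- h) = M h h) in h2; last first.
  by rewrite -scaleN1r (psd_formZ sH pM)//; ring.
rewrite -(sqrt_form_sqr Hh) -[leLHS]sqr_normr ler_sqr ?nnegrE ?sqrtr_ge0//.
by rewrite /r ler_norml; apply/andP; split; lra.
Qed.

(* With [r = |u|], the identity
   [r (u + h) - r u = (2 M u h + M h h - (r (u + h) - r u)^2) / (2 r u)]
   isolates the linear part of the square root. *)
Lemma energy_expansion u h : H u -> H h -> 0 < r u ->
  `|energy (u + h) - energy u - dform (multiplier u) u h| <=
    (K / 2 + gamma / 2 + gamma / (2 * r u)) * G h h.
Proof.
move=> Hu Hh r0; have Huh := subspaceD sH Hu Hh.
have E : energy (u + h) - energy u - dform (multiplier u) u h =
    B h h / 2 + gamma / 2 * M h h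
      - gamma / (2 * r u) * (M h h - (r (u + h) - r u) ^+ 2).
  have h1 : r (u + h) ^+ 2 = r u ^+ 2 + 2 * M u h + M h h.
    by rewrite !sqrt_form_sqr// (psd_formD sH pM).
  have h2 : M u h = (r (u + h) ^+ 2 - r u ^+ 2 - M h h) / 2 by rewrite h1; field.
  rewrite /energy /dform /multiplier -/(r _) -/(r _) (psd_formD sH pB)//.
  rewrite -(sqrt_form_sqr Huh) -(sqrt_form_sqr Hu) h2.
  by field; rewrite gt_eqF.
have [_ _ B0] := pB; have [_ _ M0] := pM.
have c0 : 0 < gamma / (2 * r u) by rewrite divr_gt0// mulr_gt0.
have := sqrt_form_triangle Hu Hh; have := sqr_ge0 (r (u + h) - r u).
rewrite E; have := MG Hh; have := BG Hh; have := B0 _ Hh; have := M0 _ Hh.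
move: (gamma / (2 * r u)) c0 => c c0.
move: (B h h) (M h h) (G h h) ((r (u + h) - r u) ^+ 2) => b m g q m0 b0 bg mg q0 qm.
have g0 : 0 <= g by exact: le_trans m0 mg.
have p1 : c * (m - q) <= c * g by rewrite ler_pM2l//; lra.
have p2 : 0 <= c * (m - q) by rewrite mulr_ge0 ?(ltW c0)// subr_ge0.
have p3 : gamma * m <= gamma * g by rewrite ler_pM2l.
have p4 : 0 <= gamma * m by rewrite mulr_ge0// ltW.
have p5 : 0 <= K * g by rewrite mulr_ge0// ltW.
have p6 : 0 <= c * g by rewrite mulr_ge0// ltW.
rewrite ler_norml; apply/andP; split; lra.
Qed.

(** In the direction [t *: h] the linear term is of order [t] and the error of [energy_expansion] of
    order [t ^+ 2]. Dividing by [t] leaves [dform (multiplier u) u h] arbitrarily small. *)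
Lemma energy_deriv0 u : H u -> 0 < r u ->
  (forall e, 0 < e -> exists2 delta, 0 < delta & forall h, H h ->
    Num.sqrt (G h h) < delta -> `|energy (u + h) - energy u| <= e * Num.sqrt (G h h)) ->
  forall h, H h -> dform (multiplier u) u h = 0.
Proof.
move=> Hu r0 du h Hh; apply/eqP; rewrite -normr_le0; apply/ler_addgt0Pl => e e_gt0.
rewrite addr0; have [_ _ G0] := pG; have Gh := G0 _ Hh.
set N := Num.sqrt (G h h); have N0 : 0 <= N by exact: sqrtr_ge0.
have NN : G h h = N ^+ 2 by rewrite sqr_sqrtr.
have N1 : 0 < N + 1 by rewrite ltr_wpDl.
set C := K / 2 + gamma / 2 + gamma / (2 * r u).
have C0 : 0 < C by rewrite !addr_gt0 ?divr_gt0// mulr_gt0.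
have e1 : 0 < e / (2 * (N + 1)) by rewrite divr_gt0// mulr_gt0.
have [delta d0 hd] := du _ e1.
have G1 : 0 < 2 * C * (G h h + 1) by rewrite !mulr_gt0// ltr_wpDl.
(* The first bound keeps the norm of [t *: h] below [delta], the second makes the quadratic error at
   most [t * (e / 2)]. The added ones avoid division by zero when [h] has norm zero. *)
pose t := Num.min (delta / (N + 1)) (e / (2 * C * (G h h + 1))).
have t0 : 0 < t by rewrite /t lt_min !divr_gt0.
have Hth := subspaceZ t sH Hh.
have St : Num.sqrt (G (t *: h) (t *: h)) = t * N.
  by rewrite (psd_formZ sH pG)// sqrtrM ?sqr_ge0// sqrtr_sqr gtr0_norm.
have t1 : t * (N + 1) <= delta by rewrite -ler_pdivlMr// /t ge_min lexx.
have t2 : t * (2 * C * (G h h + 1)) <= e by rewrite -ler_pdivlMr// /t ge_min lexx orbT.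
have h1 : `|energy (u + t *: h) - energy u| <= e / (2 * (N + 1)) * (t * N).
  by rewrite -St; apply: hd => //; rewrite St; apply: lt_le_trans t1; rewrite ltr_pM2l// ltrDl.
have h2 := energy_expansion Hu Hth r0; rewrite -/C (psd_formZ sH pG)// in h2.
have Dt : dform (multiplier u) u (t *: h) = t * dform (multiplier u) u h.
  by rewrite /dform (psd_formZr sH pB)// (psd_formZr sH pM)//; ring.
rewrite Dt in h2.
have h3 : t * `|dform (multiplier u) u h| <=
    e / (2 * (N + 1)) * (t * N) + C * (t ^+ 2 * G h h).
  rewrite -[t in leLHS](gtr0_norm t0) -normrM.
  move: (energy _ - energy u) (t * dform _ _ _) h1 h2 => x y h1 h2.
  rewrite -[y in leLHS](subKr x).
  by apply: le_trans (ler_normB _ _) _; exact: lerD.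
have h4 : e / (2 * (N + 1)) * N <= e / 2.
  by rewrite invfM mulrA mulrAC ler_pdivrMr// ler_pM2l ?divr_gt0// lerDl.
have h5 : C * (t * G h h) <= e / 2.
  have tC : 0 <= t * C by rewrite mulr_ge0 ?ltW.
  by move: (G h h) t2 => g t2; lra.
rewrite -(ler_pM2l t0); apply: le_trans h3 _.
have -> : e / (2 * (N + 1)) * (t * N) = t * (e / (2 * (N + 1)) * N) by ring.
have -> : C * (t ^+ 2 * G h h) = t * (C * (t * G h h)) by ring.
by rewrite -mulrDr ler_pM2l//; lra.
Qed.

(** No differentiation is involved: minimality of [l] makes [dform l] positive semidefinite, and it
    vanishes at [(u, u)], so by Cauchy-Schwarz [u] is in its kernel. *)
Lemma rayleigh_stationary l u : (forall w, H w -> l * M w w <= B w w) ->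
  H u -> B u u = l * M u u -> forall h, H h -> dform l u h = 0.
Proof.
move=> lB Hu Bu h Hh; have [Bs Bl B0] := pB; have [Ms Ml M0] := pM.
have pQ : psd_form H (dform l).
  split=> [x y Hx Hy|k x y z Hx Hy Hz|x Hx]; rewrite /dform.
  - by rewrite Bs// Ms.
  - by rewrite Bl// Ml//; ring.
  - by rewrite subr_ge0 lB.
by apply: (psd_form_ker sH pQ) => //; rewrite /dform Bu subrr.
Qed.

Lemma energy_min l u : 0 < l -> (forall w, H w -> l * M w w <= B w w) ->
  H u -> M u u = 1 -> B u u = l ->
  is_min_on H energy (- (gamma ^+ 2 / (2 * (gamma + l)))).
Proof.
move=> l0 lB Hu Mu Bu; have [_ _ M0] := pM.
have gl : 0 < gamma + l by rewrite addr_gt0.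
split.
  (* On multiples of [u] the energy is [(gamma + l) / 2 * s ^+ 2 - gamma * s] with [s >= 0] the
     norm; this scale is its vertex. *)
  exists ((gamma / (gamma + l)) *: u); first exact: subspaceZ.
  rewrite /energy (psd_formZ sH pB)// (psd_formZ sH pM)// Mu Bu mulr1 sqrtr_sqr.
  rewrite ger0_norm; last by rewrite divr_ge0// ltW.
  by field; rewrite gt_eqF.
move=> w Hw; rewrite /energy -/(r w); have := lB _ Hw; rewrite -(sqrt_form_sqr Hw).
move: (r w) (B w w) => s b sb.
(* Completing the square in the norm [s] of [w], after [B w w] has been bounded below by
   [l * s ^+ 2]. *)
have : 0 <= (gamma + l) / 2 * (s - gamma / (gamma + l)) ^+ 2.
  by rewrite mulr_ge0 ?sqr_ge0// divr_ge0// ltW.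
have -> : (gamma + l) / 2 * (s - gamma / (gamma + l)) ^+ 2 =
    2^-1 * (l * s ^+ 2) + gamma / 2 * s ^+ 2 - gamma * s + gamma ^+ 2 / (2 * (gamma + l)).
  by field; rewrite gt_eqF.
by lra.
Qed.

End energy.

Section ae_integral.
Context {R : realType} d {T : measurableType d}.
Variables (mu : {measure set T -> \bar R}) (D : set T).
Hypothesis mD : measurable D.
Local Notation integrable f := (mu.-integrable D (EFin \o f)).

Lemma ae_le_Rintegral (f g : T -> R) : integrable f -> integrable g ->
  (\forall x \ae mu, D x -> f x <= g x) ->
  \int[mu]_(x in D) f x <= \int[mu]_(x in D) g x.
Proof.
move=> fi gi fg; rewrite -subr_ge0 -RintegralB//.
have mB : measurable_fun D (fun x => g x - f x).
  by apply/measurable_EFinP; exact: measurable_int (integrableBR mD gi fi).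
rewrite (@ae_eq_Rintegral _ _ _ mu D mD _ (fun x => `|g x - f x|))//.
- by apply: Rintegral_ge0.
- exact: measurableT_comp.
- by apply: filterS fg => x h Dx; rewrite ger0_norm// subr_ge0 h.
Qed.

Lemma integrable0R : integrable (fun=> 0).
Proof. exact: integrable0. Qed.

Lemma ae_bounded_integrable (b f : T -> R) (C : R) : measurable_fun D b ->
  (\forall x \ae mu, D x -> `|b x| <= C) -> integrable f ->
  integrable (fun x => b x * f x).
Proof.
move=> mb bC fi; have /integrableP[mf ifoo] := fi.
have mf' : measurable_fun D f by apply/measurable_EFinP.
have mbf : measurable_fun D (fun x => b x * f x) by exact: measurable_funM.
apply/integrableP; split; first exact/measurable_EFinP.
(* A negative [C] can bound an absolute value only if almost no point lies in [D]; any two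
   integrands then agree almost everywhere. *)
have [C0|C0] := leP 0 C; last first.
  rewrite (@ae_eq_integral _ _ _ mu D (fun x => `|(f x)%:E|%E))//.
  - by apply: measurableT_comp => //; exact/measurable_EFinP.
  - exact: measurableT_comp.
  - apply: filterS bC => x h Dx; exfalso; have := h Dx; apply/negP.
    by rewrite -ltNge (lt_le_trans C0).
apply: (@le_lt_trans _ _ (\int[mu]_(x in D) (C%:E * `|(f x)%:E|))%E).
  apply: ae_ge0_le_integral => //.
  - by apply: measurableT_comp => //; exact/measurable_EFinP.
  - by move=> x _; rewrite mule_ge0.
  - by apply: measurable_funeM; apply: measurableT_comp.
  - apply: filterS bC => x h Dx; rewrite /= lee_fin normrM ler_wpM2r//; exact: h.
rewrite ge0_integralZl//; first by rewrite lte_mul_pinfty.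
by apply: measurableT_comp.
Qed.

End ae_integral.

(** * The bilinear form of the operator *)

Section elliptic.
Context {R : realType} {n : nat}.
Variables (Omega : set 'rV[R]_n) (a0 : 'rV[R]_n) (e0 : R).
Hypothesis Omega_open : open Omega.
Hypothesis e0_gt0 : 0 < e0.
Hypothesis Omega_cube :
  forall x, Omega x -> forall i, x ord0 i \in `]a0 ord0 i, a0 ord0 i + e0[.
Variables (a : 'I_n -> 'I_n -> 'rV[R]_n -> R) (c : 'rV[R]_n -> R) (alpha beta : R).
Hypothesis a_Linfty : forall i j, Linfty Omega (a i j).
Hypothesis c_Linfty : Linfty Omega c.
Hypothesis a_sym : forall i j, \forall x \ae @lebesgue_rV R n,
  Omega x -> a i j x = a j i x.
Hypothesis c_ge0 : \forall x \ae @lebesgue_rV R n, Omega x -> 0 <= c x.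
Hypothesis alpha_gt0 : 0 < alpha.
Hypothesis alpha_le_beta : alpha <= beta.
Hypothesis a_elliptic : \forall x \ae @lebesgue_rV R n, Omega x ->
  forall xi : 'rV[R]_n,
    alpha * (\sum_(i < n) xi ord0 i ^+ 2)
      <= \sum_(i < n) \sum_(j < n) a i j x * xi ord0 i * xi ord0 j
      <= beta * (\sum_(i < n) xi ord0 i ^+ 2).
Implicit Types u v w h psi : 'rV[R]_n -> R.
Local Notation mu := (@lebesgue_rV R n).
Local Notation ip := (ip mu Omega).
Local Notation integrable f := (mu.-integrable Omega (EFin \o f)).
Local Notation wp := (wpartial Omega).
Let mO := measurable_Omega Omega_open.

Lemma Linfty_integrable b f : Linfty Omega b -> integrable f ->
  integrable (fun x => b x * f x).
Proof. by move=> [mb [C bC]]; exact: (ae_bounded_integrable mO mb bC). Qed.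

Lemma L2_prod_integrable f g : L2 Omega f -> L2 Omega g ->
  integrable (fun x => f x * g x).
Proof. exact: L2_mul_integrable. Qed.

(* [p] and [q] stand for gradients: weak ones, or classical ones in the case of
   test functions. *)
Definition adens (p q : 'I_n -> 'rV[R]_n -> R) (x : 'rV[R]_n) : R :=
  \sum_(i < n) \sum_(j < n) a i j x * p j x * q i x.

Lemma adens_integrable p q : (forall i, L2 Omega (p i)) -> (forall i, L2 Omega (q i)) ->
  integrable (adens p q).
Proof.
move=> Lp Lq; apply: integrable_sumR => // i; apply: integrable_sumR => // j.
have := Linfty_integrable (a_Linfty i j) (L2_prod_integrable (Lp j) (Lq i)).
by apply: eq_integrable => // x _ /=; rewrite mulrA.
Qed.

Lemma integrable_measurable f : integrable f -> measurable_fun Omega f.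
Proof. by move=> fi; apply/measurable_EFinP; exact: measurable_int fi. Qed.

Definition aform u v : R := \int[mu]_(x in Omega) adens (wp^~ u) (wp^~ v) x.

Definition cform u v : R := \int[mu]_(x in Omega) (c x * (u x * v x)).

Let Lw u i : H1 Omega u -> L2 Omega (wp i u). Proof. exact: wpartial_L2. Qed.

(** The quantifiers over [p] and [q] stand inside the almost everywhere statement: one null set,
    depending only on the coefficients, serves all gradients. The same holds for [adens_bounds]. *)
Lemma adens_sym : \forall x \ae mu, Omega x -> forall p q, adens p q x = adens q p x.
Proof.
have h : \forall x \ae mu, forall i, forall j, Omega x -> a i j x = a j i x.
  by apply: filter_forall => i; apply: filter_forall => j; exact: a_sym.
apply: filterS h => x hx Ox p q; rewrite /adens exchange_big/=.
by apply: eq_bigr => i _; apply: eq_bigr => j _; rewrite hx// mulrAC.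
Qed.

Lemma adens_lin k p q s x : (forall i, p i x = k * q i x + s i x) ->
  forall r, adens p r x = k * adens q r x + adens s r x.
Proof.
move=> E r; rewrite /adens mulr_sumr -big_split; apply: eq_bigr => i _.
rewrite mulr_sumr -big_split; apply: eq_bigr => j _; rewrite /= E; ring.
Qed.

Lemma adens_bounds : \forall x \ae mu, Omega x -> forall p,
  alpha * (\sum_(i < n) p i x ^+ 2) <= adens p p x <= beta * (\sum_(i < n) p i x ^+ 2).
Proof.
apply: filterS a_elliptic => x hx Ox p; have := hx Ox (\row_i p i x).
have -> : \sum_(i < n) (\row_i p i x : 'rV[R]_n) ord0 i ^+ 2 = \sum_(i < n) p i x ^+ 2.
  by apply: eq_bigr => i _; rewrite mxE.
suff -> : \sum_(i < n) \sum_(j < n) a i j x * (\row_i p i x : 'rV[R]_n) ord0 i *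
    (\row_i p i x : 'rV[R]_n) ord0 j = adens p p x by [].
by apply: eq_bigr => i _; apply: eq_bigr => j _; rewrite !mxE mulrAC.
Qed.

Lemma wpartial_lin_all k u v : H1 Omega u -> H1 Omega v ->
  \forall x \ae mu, Omega x -> forall i, wp i (k *: u + v) x = k * wp i u x + wp i v x.
Proof.
move=> Hu Hv.
have h : \forall x \ae mu, forall i, Omega x ->
    wp i (k *: u + v) x = k * wp i u x + wp i v x.
  by apply: filter_forall => i; apply: (wpartial_lin Omega_open e0_gt0 Omega_cube).
by apply: filterS h => x hx Ox i; exact: hx.
Qed.

Let H1s := H1_subspace Omega_open e0_gt0 Omega_cube.

Definition grad2 u : R := \sum_(i < n) ip (wp i u) (wp i u).

Lemma grad2_ge0 u : 0 <= grad2 u.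
Proof. by apply: sumr_ge0 => i _; exact: ip_ge0. Qed.

Lemma aform_bounds u : H1 Omega u -> alpha * grad2 u <= aform u u <= beta * grad2 u.
Proof.
move=> Hu; have i1 := adens_integrable (fun i => Lw i Hu) (fun i => Lw i Hu).
have i2 i : integrable (fun x => wp i u x ^+ 2).
  by apply: (@sqint_integrable_sqr _ _ _ mu Omega); exact: Lw.
have i3 : integrable (fun x => \sum_(i < n) wp i u x ^+ 2) by exact: integrable_sumR.
have -> : grad2 u = \int[mu]_(x in Omega) \sum_(i < n) wp i u x ^+ 2.
  rewrite (Rintegral_sum mO _ i2); apply: eq_bigr => i _.
  by apply: eq_Rintegral => x _; rewrite expr2.
rewrite -!RintegralZl//; apply/andP; split; apply: ae_le_Rintegral => //;
  try exact: (integrableZR mO _ i3);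
  by apply: filterS adens_bounds => x h Ox; have /andP[] := h Ox (wp^~ u).
Qed.

Lemma aform_psd : psd_form (H1 Omega) aform.
Proof.
split=> [u v Hu Hv|k u v w Hu Hv Hw|u Hu].
- apply: ae_eq_Rintegral => //.
  + exact: integrable_measurable (adens_integrable (fun i => Lw i Hu) (fun i => Lw i Hv)).
  + exact: integrable_measurable (adens_integrable (fun i => Lw i Hv) (fun i => Lw i Hu)).
  + by apply: filterS adens_sym => x h Ox; exact: h.
- have i1 := adens_integrable (fun i => Lw i Hu) (fun i => Lw i Hw).
  have i2 := adens_integrable (fun i => Lw i Hv) (fun i => Lw i Hw).
  have i3 := integrableZR mO k i1.
  have i4 := adens_integrable (fun i => Lw i (H1s.2 k _ _ Hu Hv)) (fun i => Lw i Hw).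
  rewrite /aform -RintegralZl// -RintegralD//.
  apply: ae_eq_Rintegral => //; first exact: integrable_measurable i4.
  + exact: integrable_measurable (integrableDR mO i3 i2).
  + apply: filterS (wpartial_lin_all k Hu Hv) => x h Ox.
    by apply: adens_lin => i; exact: h.
- by apply: le_trans (andP (aform_bounds Hu)).1; rewrite mulr_ge0 ?grad2_ge0// ltW.
Qed.

Lemma cform_integrable u v : L2 Omega u -> L2 Omega v ->
  integrable (fun x => c x * (u x * v x)).
Proof. by move=> Lu Lv; apply: (Linfty_integrable c_Linfty); exact: L2_prod_integrable. Qed.

Lemma cform_psd : psd_form (L2 Omega) cform.
Proof.
split=> [u v Lu Lv|k u v w Lu Lv Lw'|u Lu].
- by apply: eq_Rintegral => x _; ring.
- have i1 := cform_integrable Lu Lw'; have i2 := cform_integrable Lv Lw'.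
  have i3 := integrableZR mO k i1.
  rewrite /cform -RintegralZl// -RintegralD//; apply: eq_Rintegral => x _.
  by have -> : (k *: u + v) x = k * u x + v x by []; ring.
- have h := ae_le_Rintegral mO (integrable0R mu Omega) (cform_integrable Lu Lu).
  have z : \int[mu]_(x in Omega) (0 : R) = 0 by apply: Rintegral0_eq.
  rewrite /cform -z; apply: h; apply: filterS c_ge0 => x h Ox.
  by rewrite mulr_ge0 ?h// -expr2 sqr_ge0.
Qed.

Lemma cform_le : exists2 C, 0 <= C & forall u, L2 Omega u -> cform u u <= C * ip u u.
Proof.
have [mc [C hC]] := c_Linfty; exists `|C| => // u Lu.
rewrite -RintegralZl//; last exact: L2_prod_integrable.
apply: ae_le_Rintegral => //; first exact: cform_integrable.
  by apply: integrableZR => //; exact: L2_prod_integrable.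
apply: filterS hC => x h Ox; have u2 : 0 <= u x * u x by rewrite -expr2 sqr_ge0.
by apply: (ler_wpM2r u2); apply: le_trans (le_trans (ler_norm _) (h Ox)) (ler_norm _).
Qed.

Definition bform u v : R := aform u v + cform u v.

Lemma bform_psd : psd_form (H1 Omega) bform.
Proof. exact: psd_form_add aform_psd (psd_form_sub (@H1_L2 _ _ Omega) cform_psd). Qed.

Lemma F_L_energy gamma u : F_L Omega a c gamma u = energy ip bform gamma u.
Proof.
rewrite /F_L /energy /bform mulrDr.
have -> : \int[mu]_(x in Omega) (`|u x| ^+ 2) = ip u u.
  by apply: eq_Rintegral => x _; rewrite sqr_normr expr2.
congr (_ + _ * _ + _ - _); apply: eq_Rintegral => x _.
by rewrite sqr_normr expr2.
Qed.

(** The weak equation is tested with classical derivatives of [psi], whereas [aform] contains the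
    chosen weak ones; they agree almost everywhere. *)
Lemma aform_Cc u psi : H1 Omega u -> Cc_infty Omega psi ->
  \int[mu]_(x in Omega)
    (\sum_(i < n) \sum_(j < n) a i j x * wp j u x * partial i psi x) = aform u psi.
Proof.
move=> Hu Cp; have [_ Ldp] := Cc_L2 Omega_open e0_gt0 Omega_cube Cp.
have Hp := Cc_H1 Omega_open e0_gt0 Omega_cube Cp.
have h : \forall x \ae mu, forall i, Omega x -> wp i psi x = partial i psi x.
  by apply: filter_forall => i; apply: (wpartial_Cc Omega_open e0_gt0 Omega_cube).
apply: (ae_eq_Rintegral mO).
- exact: integrable_measurable (adens_integrable (fun i => Lw i Hu) Ldp).
- exact: integrable_measurable (adens_integrable (fun i => Lw i Hu) (fun i => Lw i Hp)).
apply: filterS h => x hx Ox; apply: eq_bigr => i _; apply: eq_bigr => j _.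
by rewrite hx.
Qed.

Lemma weak_solutionE lambda phi : weak_solution Omega a c lambda phi <->
  H10 Omega phi /\ forall psi, Cc_infty Omega psi -> dform ip bform lambda phi psi = 0.
Proof.
have E psi : H1 Omega phi -> Cc_infty Omega psi ->
    \int[mu]_(x in Omega)
      (\sum_(i < n) \sum_(j < n) a i j x * wp j phi x * partial i psi x)
    + \int[mu]_(x in Omega) ((c x - lambda) * phi x * psi x) =
    dform ip bform lambda phi psi.
  move=> Hu Cp; rewrite aform_Cc//.
  have [Lp _] := Cc_L2 Omega_open e0_gt0 Omega_cube Cp; have Lu := H1_L2 Hu.
  have i1 := cform_integrable Lu Lp; have i2 := L2_prod_integrable Lu Lp.
  have i3 := integrableZR mO lambda i2.
  rewrite /dform /bform -addrA; congr (_ + _).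
  rewrite -RintegralZl// -RintegralB//; apply: eq_Rintegral => x _; ring.
split=> -[Hphi h]; split=> // psi Cp; have H1phi := H10_H1 Hphi.
  by rewrite -E//; exact: h.
by rewrite E//; exact: h.
Qed.

Lemma H10_zeroE u : L2 Omega u -> H10_zero Omega u <-> ip u u = 0.
Proof.
move=> Lu; split=> [h|h]; last exact: (ip_eq0 mO Lu h).
have L0 := (L2_subspace Omega_open).1.
rewrite (ae_ip Omega_open Lu L0 Lu L0 h h).
by apply: Rintegral0_eq => x _; rewrite mul0r.
Qed.

End elliptic.

Lemma comparison_le {R : realFieldType} (b C A m g x y : R) : 0 <= b -> 0 <= C ->
  x <= b * g -> y <= C * m -> 0 <= A -> 0 <= m -> 0 <= g ->
  x + y <= (b + C + A) * (m + g).
Proof.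
move=> b0 C0 hx hy A0 m0 g0.
have := mulr_ge0 b0 m0; have := mulr_ge0 C0 g0.
by have := mulr_ge0 A0 m0; have := mulr_ge0 A0 g0; lra.
Qed.

Lemma comparison_ge {R : realFieldType} (b C al m g x y : R) : 0 <= b -> 0 <= C ->
  0 < al -> al * g <= x -> 0 <= y -> 0 <= g ->
  m + g <= m + (b + C + al^-1) * (x + y).
Proof.
move=> b0 C0 al0 hx y0 g0; rewrite lerD2l.
have x0 : 0 <= x by apply: le_trans hx; rewrite mulr_ge0// ltW.
have h : g <= al^-1 * (x + y).
  by rewrite ler_pdivlMl//; apply: le_trans hx _; rewrite lerDl.
apply: le_trans h _; rewrite [leRHS]mulrDl lerDr mulr_ge0 ?addr_ge0//.
Qed.

(** * Critical points and the ground state *)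

Section final.
Context {R : realType} {n : nat}.
Variables (Omega : set 'rV[R]_n) (a0 : 'rV[R]_n) (e0 : R).
Hypothesis Omega_open : open Omega.
Hypothesis e0_gt0 : 0 < e0.
Hypothesis Omega_cube :
  forall x, Omega x -> forall i, x ord0 i \in `]a0 ord0 i, a0 ord0 i + e0[.
Variables (a : 'I_n -> 'I_n -> 'rV[R]_n -> R) (c : 'rV[R]_n -> R) (alpha beta gamma : R).
Hypothesis a_Linfty : forall i j, Linfty Omega (a i j).
Hypothesis c_Linfty : Linfty Omega c.
Hypothesis a_sym : forall i j, \forall x \ae @lebesgue_rV R n,
  Omega x -> a i j x = a j i x.
Hypothesis c_ge0 : \forall x \ae @lebesgue_rV R n, Omega x -> 0 <= c x.
Hypothesis alpha_gt0 : 0 < alpha.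
Hypothesis alpha_le_beta : alpha <= beta.
Hypothesis a_elliptic : \forall x \ae @lebesgue_rV R n, Omega x ->
  forall xi : 'rV[R]_n,
    alpha * (\sum_(i < n) xi ord0 i ^+ 2)
      <= \sum_(i < n) \sum_(j < n) a i j x * xi ord0 i * xi ord0 j
      <= beta * (\sum_(i < n) xi ord0 i ^+ 2).
Hypothesis gamma_gt0 : 0 < gamma.
Local Notation mu := (@lebesgue_rV R n).
Local Notation M := (ip mu Omega).
Local Notation B := (bform Omega a c).
Local Notation G := (H1form Omega).
Local Notation H := (H10 Omega).
Local Notation D := (Cc_infty Omega).

Let sH : subspace H. Proof. exact: H10_subspace e0_gt0 Omega_cube. Qed.
Let sD : subspace D. Proof. exact: Cc_subspace. Qed.
Let DH : D `<=` H. Proof. exact: Cc_H10 e0_gt0 Omega_cube. Qed.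
Let HL2 : H `<=` L2 Omega. Proof. by move=> u /H10_H1/H1_L2. Qed.
Let pM : psd_form H M.
Proof. exact: psd_form_sub HL2 (L2_ip_psd Omega_open). Qed.
Let pB : psd_form H B.
Proof.
apply: psd_form_sub (@H10_H1 _ _ Omega) _.
exact: (bform_psd Omega_open e0_gt0 Omega_cube a_Linfty c_Linfty a_sym c_ge0
  alpha_gt0 a_elliptic).
Qed.
Let pG : psd_form H G.
Proof. exact: psd_form_sub (@H10_H1 _ _ Omega) (H1form_psd Omega_open e0_gt0 Omega_cube). Qed.

Let MG u : H u -> M u u <= G u u.
Proof. by move=> _; rewrite /H1form lerDl; exact: grad2_ge0. Qed.

Let aB u : H u -> alpha * grad2 Omega u <= aform Omega a u u <= beta * grad2 Omega u.
Proof. by move=> /H10_H1 Hu; exact: (aform_bounds Omega_open a_Linfty a_elliptic Hu). Qed.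

Let cB0 u : H u -> 0 <= cform Omega c u u.
Proof. by move=> /HL2 Lu; have [_ _ h] := cform_psd Omega_open c_Linfty c_ge0; exact: h. Qed.

Lemma energy_comparison : exists K : R, [/\ 0 < K,
  forall u, H u -> B u u <= K * G u u & forall u, H u -> G u u <= M u u + K * B u u].
Proof.
have [C C0 hC] := cform_le Omega_open c_Linfty.
have b0 : 0 < beta by exact: lt_le_trans alpha_le_beta.
(* [beta + C] bounds [B] from above, with [C] a bound for [c], and [alpha^-1] recovers the gradient
   from [B]; the sum is one constant for both comparisons. *)
exists (beta + C + alpha^-1); split.
- by rewrite addr_gt0 ?invr_gt0// ltr_wpDr.
- move=> u Hu; have A0 : 0 <= alpha^-1 by rewrite invr_ge0 ltW.
  exact: (comparison_le (ltW b0) C0 (andP (aB Hu)).2 (hC _ (HL2 Hu)) A0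
    (ip_ge0 mu Omega u) (grad2_ge0 Omega u)).
- move=> u Hu; exact: (comparison_ge (M u u) (ltW b0) C0 alpha_gt0 (andP (aB Hu)).1
    (cB0 Hu) (grad2_ge0 Omega u)).
Qed.

Let grad_Cc psi : D psi -> \sum_(i < n) M (partial i psi) (partial i psi) = grad2 Omega psi.
Proof.
move=> Cp; have [_ Ldp] := Cc_L2 Omega_open e0_gt0 Omega_cube Cp.
have Hp := Cc_H1 Omega_open e0_gt0 Omega_cube Cp.
apply: eq_bigr => i _; apply/esym; have h := wpartial_Cc Omega_open e0_gt0 Omega_cube i Cp.
by apply: (ae_ip Omega_open) => //; exact: wpartial_L2.
Qed.

Let FE u : F_L Omega a c gamma u = energy M B gamma u. Proof. exact: F_L_energy. Qed.

(** The norm condition and the multiplier determine each other through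
    [gamma + (gamma / r - gamma) = gamma / r], [r] being the norm of [u]. As [x / 0 = 0], the clause
    [gamma + lambda != 0] is what keeps the zero function out when [lambda = - gamma]. *)
Theorem critical_pointE u : nonzero_critical_point Omega (F_L Omega a c gamma) u <->
  H u /\ exists lambda, [/\ weak_solution Omega a c lambda u,
    gamma + lambda != 0 & L2norm Omega u = gamma / (gamma + lambda)].
Proof.
have [K [K0 BG _]] := energy_comparison.
have dense := @H10_dense R n Omega.
have multE r : r != 0 -> gamma + (gamma / r - gamma) = gamma / r by move=> _; ring.
split=> [[Hu nz [l [_ _ lF] l0]]|[Hu [lam [wu gl uN]]]].
  have [_ _ M0] := pM.
  have Mu : 0 < M u u.
    rewrite lt_def M0// andbT; apply/eqP => z; apply: nz.
    exact: (H10_zeroE Omega_open (HL2 Hu)).2.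
  have ru : 0 < Num.sqrt (M u u) by rewrite sqrtr_gt0.
  have rn : Num.sqrt (M u u) != 0 by rewrite gt_eqF.
  split=> //; exists (multiplier M gamma u); rewrite /multiplier; split.
  - apply: (weak_solutionE Omega_open e0_gt0 Omega_cube a_Linfty c_Linfty _ _).2.
    split=> // psi Cp.
    apply: (energy_deriv0 sH pM pB pG MG BG K0 gamma_gt0 Hu ru) (DH Cp) => e e_gt0.
    have [delta d0 hd] := lF e e_gt0; exists delta => // h Hh.
    rewrite -(H1normE Omega h) => /(hd h Hh).
    by rewrite l0// subr0 !FE.
  - by rewrite multE// mulf_neq0 ?invr_eq0// gt_eqF.
  - by rewrite multE// invf_div mulrCA mulfV ?mulr1 ?gt_eqF// (L2normE Omega u).
have [_ wD] := (weak_solutionE Omega_open e0_gt0 Omega_cube a_Linfty c_Linfty _ _).1 wu.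
have r0 : Num.sqrt (M u u) != 0.
  by rewrite -(L2normE Omega u) uN mulf_neq0 ?invr_eq0// gt_eqF.
have ru : 0 < Num.sqrt (M u u) by rewrite lt_def r0 sqrtr_ge0.
have multL : multiplier M gamma u = lam.
  by rewrite /multiplier -(L2normE Omega u) uN; field; rewrite gl gt_eqF.
have dD := dform_ext sH DH pM pB pG MG BG K0 dense Hu wD.
split=> //.
  move=> /(H10_zeroE Omega_open (HL2 Hu)) z; by move: ru; rewrite z sqrtr0 ltxx.
(* [dform] vanishes on all of [H] by density, so the candidate derivative is zero. The remainder is
   at most [C] times the squared norm of [h], whence the radius [e / C]. *)
exists (fun=> 0); [split|by move=> h _].
- by move=> k h1 h2 _ _; rewrite mulr0 addr0.
- by exists 0 => h _; rewrite normr0 mul0r.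
- move=> e e_gt0.
  set C := K / 2 + gamma / 2 + gamma / (2 * Num.sqrt (M u u)).
  have C0 : 0 < C by rewrite !addr_gt0 ?divr_gt0// mulr_gt0.
  exists (e / C) => [|h Hh hd]; first exact: divr_gt0.
  rewrite subr0 !FE.
  have := energy_expansion sH pM pB MG BG K0 gamma_gt0 Hu Hh ru.
  rewrite multL dD// subr0 -/C -(H1norm_sqr Omega h) => h1.
  apply: le_trans h1 _; rewrite expr2 mulrA ler_wpM2r//.
    by rewrite (H1normE Omega h) sqrtr_ge0.
  by rewrite mulrC -ler_pdivlMr// ltW.
Qed.

(** In dimension zero there is no gradient, and the least eigenvalue need not be positive; on an
    empty domain every function is zero almost everywhere, and there is no eigenvalue. Hence the two
    hypotheses. *)
Theorem ground_state : (0 < n)%N -> Omega !=set0 -> exists lambda_star : R,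
  [/\ smallest_eigenvalue Omega a c lambda_star, 0 < lambda_star &
      is_min_on H (F_L Omega a c gamma) (- (gamma ^+ 2 / (2 * (gamma + lambda_star))))].
Proof.
move=> n_gt0 O0; have [K [K0 BG GMB]] := energy_comparison.
have dense := @H10_dense R n Omega.
have compact_embedding e : 0 < e ->
    exists (I : finType) (l : I -> ('rV[R]_n -> R) -> R) (C : R),
    [/\ forall i u v, D u -> D v -> l i (u - v) = l i u - l i v,
        forall i u, D u -> l i u ^+ 2 <= C * M u u &
        forall u, D u -> M u u <= \sum_i l i u ^+ 2 + e * G u u].
  move=> e_gt0; have [I [l [C [h1 h2 h3]]]] := rellich_Cc e0_gt0 Omega_cube e_gt0.
  exists I, l, C; split=> // u Du; apply: le_trans (h3 u Du) _.
  by rewrite grad_Cc// lerD2l ler_pM2l// /H1form lerDr ip_ge0.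
(* The Poincare constant for the gradient, divided by the ellipticity constant to pass from the
   gradient to [B]. *)
pose P := 8 * e0 ^+ 2 / alpha.
have P0 : 0 < P by rewrite divr_gt0// mulr_gt0// exprn_gt0.
have poincare u : D u -> M u u <= P * B u u.
  move=> Du; apply: le_trans (poincare_Cc e0_gt0 Omega_cube n_gt0 Du) _.
  rewrite grad_Cc// /P -[leRHS]mulrA ler_pM2l ?mulr_gt0 ?exprn_gt0// ler_pdivlMl//.
  apply: le_trans (andP (aB (DH Du))).1 _; rewrite /bform lerDl; exact: cB0 (DH Du).
have complete := H10_complete Omega_open e0_gt0 Omega_cube.
have nz := Cc_nonzero Omega_open e0_gt0 Omega_cube O0.
have [lam [lam0 lamB [u [Hu Mu Bu]]]] := rayleigh_minimizer sH sD DH pM pB pG MG BG GMB K0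
  dense complete compact_embedding poincare P0 nz.
exists lam; split=> //.
- split.
    exists u; last first.
      by move=> /(H10_zeroE Omega_open (HL2 Hu)); rewrite Mu => /eqP; rewrite oner_eq0.
    apply: (weak_solutionE Omega_open e0_gt0 Omega_cube a_Linfty c_Linfty _ _).2.
    split=> // psi Cp; apply: (rayleigh_stationary sH pM pB lamB Hu _ (DH Cp)).
    by rewrite Bu Mu mulr1.
  move=> l [phi wphi nzphi].
  have [Hp wD] := (weak_solutionE Omega_open e0_gt0 Omega_cube a_Linfty c_Linfty _ _).1 wphi.
  (* Testing the equation of [phi] with [phi] itself shows that [l] is its Rayleigh quotient, hence
     at least [lam]. *)
  have := dform_ext sH DH pM pB pG MG BG K0 dense Hp wD Hp.
  have [_ _ M0] := pM.
  have Mp : 0 < M phi phi.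
    rewrite lt_def M0// andbT; apply/eqP => z; apply: nzphi.
    exact: (H10_zeroE Omega_open (HL2 Hp)).2.
  by move=> /eqP; rewrite subr_eq0 => /eqP E; rewrite -(ler_pM2r Mp) -E; exact: lamB.
- have -> : F_L Omega a c gamma = energy M B gamma by apply/funext => w; exact: FE.
  exact: (energy_min sH pM pB gamma_gt0 lam0 lamB Hu Mu Bu).
Qed.

End final.

Theorem lemma2 (R : realType) (d : nat) (Omega : set 'rV[R]_d)
    (a : 'I_d -> 'I_d -> 'rV[R]_d -> R) (c : 'rV[R]_d -> R)
    (alpha beta gamma : R)
    (d_gt0 : (0 < d)%N)
    (Omega_bounded : bounded_set Omega)
    (Omega_open : open Omega)
    (Omega_lipschitz : lipschitz_boundary Omega)
    (a_Linfty : forall i j, Linfty Omega (a i j))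
    (c_Linfty : Linfty Omega c)
    (a_sym : forall i j, \forall x \ae @lebesgue_rV R d,
       Omega x -> a i j x = a j i x)
    (c_ge0 : \forall x \ae @lebesgue_rV R d, Omega x -> 0 <= c x)
    (alpha_gt0 : 0 < alpha) (alpha_le_beta : alpha <= beta)
    (a_elliptic : \forall x \ae @lebesgue_rV R d, Omega x ->
       forall xi : 'rV[R]_d,
         alpha * (\sum_(i < d) xi ord0 i ^+ 2)
           <= \sum_(i < d) \sum_(j < d) a i j x * xi ord0 i * xi ord0 j
           <= beta * (\sum_(i < d) xi ord0 i ^+ 2))
    (gamma_gt0 : 0 < gamma) :
  [set u | nonzero_critical_point Omega (F_L Omega a c gamma) u] =
  [set phi | H10 Omega phi /\
     exists lambda : R,
       [/\ weak_solution Omega a c lambda phi,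
           gamma + lambda != 0 &
           L2norm Omega phi = gamma / (gamma + lambda)]]
  /\
  (Omega !=set0 ->
   exists lambda_star : R,
     [/\ smallest_eigenvalue Omega a c lambda_star,
         0 < lambda_star &
         is_min_on (H10 Omega) (F_L Omega a c gamma)
           (- (gamma ^+ 2 / (2 * (gamma + lambda_star))))]).
Proof.
have [a0 [e0 [e0_gt0 OQ]]] := bounded_obox Omega_bounded.
split; last exact: (ground_state Omega_open e0_gt0 OQ a_Linfty c_Linfty a_sym c_ge0
  alpha_gt0 alpha_le_beta a_elliptic gamma_gt0 d_gt0).
have E := critical_pointE Omega_open e0_gt0 OQ a_Linfty c_Linfty a_sym c_ge0
  alpha_gt0 alpha_le_beta a_elliptic gamma_gt0.
by apply/seteqP; split=> u /E.
Qed.
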